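(* Let $D=[0,1]\times[0,1]$, $0<\alpha\le1$, let $k_1,k_2,k_3,k_4,f:D\to\mathbb{R}$ be continuous, and put $F(\xi,\eta,u,v)=f(\xi,\eta)-k_4(\xi,\eta)uv$. Consider in $W_2^{(3,2)}(D)$ the problem $$Ly(\xi,\eta)=F(\xi,\eta,y(\xi,\eta),y_\xi(\xi,\eta)),\quad (\xi,\eta)\in D,\qquad y(\xi,0)=y(0,\eta)=y(1,\eta)=0.\qquad(\ast)$$ Let $\{(\xi_i,\eta_i)\}_{i=1}^\infty$ be a sequence of points of $D$ with $(\xi_1,\eta_1)=(0,0)$, let $\psi_i(\xi,\eta)=L_{(x,t)}K_{(x,t)}(\xi,\eta)\big|_{(x,t)=(\xi_i,\eta_i)}$, and let $\overline\psi_i=\sum_{k=1}^i\beta_{ik}\psi_k$ ($\beta_{ii}>0$) be the orthonormal system obtained from $\{\psi_i\}_{i=1}^\infty$ by Gram–Schmidt orthogonalization in $W_2^{(3,2)}(D)$. Put $y_0(\xi_1,\eta_1)=y(\xi_1,\eta_1)$, where $y$ is the exact solution of $(\ast)$ (this value is known from the initial condition), and define the $n$-term approximation $$y_n(\xi,\eta)=\sum_{i=1}^nB_i\overline\psi_i(\xi,\eta),\qquad B_i=\sum_{k=1}^i\beta_{ik}\,F\big(\xi_k,\eta_k,y_{k-1}(\xi_k,\eta_k),\partial_\xi y_{k-1}(\xi_k,\eta_k)\big).$$ Suppose that $\|y_n\|_{W_2^{(3,2)}}$ is bounded and that $(\ast)$ has a unique solution. If $\{(\xi_i,\eta_i)\}_{i=1}^\infty$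 is dense in $D$, then the $n$-term approximate solution $y_n$ converges (in $W_2^{(3,2)}(D)$) to the exact solution $y$ of $(\ast)$, and $$y(\xi,\eta)=\sum_{i=1}^\infty B_i\overline\psi_i(\xi,\eta).$$
   Context: All functions are real-valued. Caputo derivative: for $0<\alpha<1$, $D_\eta^\alpha y(\xi,\eta)=\frac{1}{\Gamma(1-\alpha)}\int_0^\eta \frac{\partial_r y(\xi,r)}{(\eta-r)^\alpha}\,dr$; for $\alpha=1$, $D_\eta^\alpha y=\partial_\eta y$. The linear operator $L:W_2^{(3,2)}(D)\to W_2^{(1,1)}(D)$ is $Ly=D_\eta^\alpha y+k_1(\xi,\eta)y_{\xi\xi}+k_2(\xi,\eta)y+k_3(\xi,\eta)y_\xi$. The notation $L_{(x,t)}$ means that $L$ is applied with respect to the variables $(x,t)$ ($x$ in the role of $\xi$, $t$ in the role of $\eta$). Thus $(\ast)$ is the time-fractional Burgers problem $D_\eta^\alpha y+k_1y_{\xi\xi}+k_2y+k_3y_\xi+k_4yy_\xi=f$ with homogeneous initial and boundary conditions. The space $W_2^{(1,1)}(D)$ consists of all functions $y(\xi,\eta)$ that are completely continuous in $D$ with $\frac{\partial^2 y}{\partial\xi\partial\eta}\in L^2(D)$, with inner product $$\langle y,v\rangle_{W_2^{(1,1)}}=\int_0^1\partial_\eta y(0,\eta)\,\partial_\eta v(0,\eta)\,d\eta+\langle y(\cdot,0),v(\cdot,0)\rangle_{W_2^1}+\int_0^1\!\!\int_0^1\partial_\xi\partial_\eta y\;\partial_\xi\partial_\eta v\,d\xi\,d\eta,$$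 where $\langle g,f\rangle_{W_2^1}=g(0)f(0)+\int_0^1g'(\xi)f'(\xi)\,d\xi$. The space $W_2^{(3,2)}(D)$ consists of all functions $y(\xi,\eta)$ on $D$ such that $\frac{\partial^3 y}{\partial\xi^2\partial\eta}$ is completely continuous in $D$ (i.e. absolutely continuous as a function of two variables), $\frac{\partial^5 y}{\partial\xi^3\partial\eta^2}\in L^2(D)$, and $y(\xi,0)=y(0,\eta)=y(1,\eta)=0$. Its inner product is $$\langle y,v\rangle_{W_2^{(3,2)}}=\sum_{i=0}^1\int_0^1 \partial_\eta^2\partial_\xi^i y(0,\eta)\,\partial_\eta^2\partial_\xi^i v(0,\eta)\,d\eta+\int_0^1\partial_\eta^2y(1,\eta)\,\partial_\eta^2v(1,\eta)\,d\eta+\sum_{j=0}^1\langle\partial_\eta^jy(\cdot,0),\partial_\eta^jv(\cdot,0)\rangle_{W_2^3}+\int_0^1\!\!\int_0^1\partial_\xi^3\partial_\eta^2y\;\partial_\xi^3\partial_\eta^2v\,d\xi\,d\eta,$$ where $\langle g,f\rangle_{W_2^3}=g(0)f(0)+g'(0)f'(0)+g(1)f(1)+\int_0^1g^{(3)}(\xi)f^{(3)}(\xi)\,d\xi$, and $\|y\|_{W_2^{(3,2)}}^2=\langle y,y\rangle_{W_2^{(3,2)}}$. With this inner product $W_2^{(3,2)}(D)$ is a reproducing kernel Hilbert space. Its reproducing kernel is $K_{(x,t)}(\xi,\eta)=R_x^{\{3\}}(\xi)\,R_t^{\{2\}}(\eta)$, so $y(x,t)=\langle y,K_{(x,t)}\rangle_{W_2^{(3,2)}}$,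 where $R_t^{\{2\}}(\eta)=\eta t+\frac12 t\eta^2-\frac16\eta^3$ for $\eta\le t$ and $R_t^{\{2\}}(\eta)=-\frac16t^3+\frac12\eta t^2+t\eta$ for $\eta>t$; $R_x^{\{3\}}(\xi)=-\frac1{120}(x-1)\xi\,(\xi x^4-4\xi x^3+6\xi x^2+x\xi^4-5x\xi^3-120x\xi+120x+\xi^4)$ for $\xi\le x$ and $R_x^{\{3\}}(\xi)=-\frac1{120}(\xi-1)x\,(x\xi^4-4x\xi^3+6x\xi^2+\xi x^4-5\xi x^3-120\xi x+120\xi+x^4)$ for $\xi>x$.
   Formalization: Since (ξ_1,η_1)=(0,0) forces ψ_1=0, no orthonormal system with all β_ii>0 exists; Gram–Schmidt here skips ψ_i depending linearly on predecessors (row of β zero). Membership in W_2^{(3,2)} explicitly requires every integral in the norm to be finite. *)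

(* Defs.v *)
From HB Require Import structures.
From mathcomp Require Import all_boot all_order all_algebra.
From mathcomp Require Import all_classical all_reals all_analysis.
Import Order.TTheory GRing.Theory Num.Theory.
Import numFieldNormedType.Exports.

Set Implicit Arguments.
Unset Strict Implicit.
Unset Printing Implicit Defensive.

Local Open Scope classical_set_scope.
Local Open Scope ring_scope.

Section Functions_on_the_square.
Context {R : realType}.
Implicit Types (g : R -> R) (y v : R -> R -> R).

Definition I01 : set R := [set` `[0, 1]].
Definition sqD : set (R * R) := I01 `*` I01.

Notation mu := (@lebesgue_measure R).
Notation mu2 := (mu \x mu)%E.

(* Difference quotients only see points of [0, 1], so that the derivative is
   one-sided at the end points and does not depend on values taken outside. *)
Definition quot01 g (x z : R) : R := (g z - g x) / (z - x).
Definition derivable01 g (x : R) : Prop :=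
  cvg (quot01 g x z @[z --> within I01 x^']).
Definition deriv01 g (x : R) : R :=
  lim (quot01 g x z @[z --> within I01 x^']).

Definition dxi y : R -> R -> R := fun xi eta => deriv01 (y ^~ eta) xi.
Definition deta y : R -> R -> R := fun xi eta => deriv01 (y xi) eta.

(* Classes of functions modulo null sets: a derivative which exists almost
   everywhere need not be Borel measurable on its exceptional set. *)
Definition in_L2 d (T : measurableType d) (m : {measure set T -> \bar R})
    (A : set T) (u : T -> R) : Prop :=
  exists w : T -> R,
    [/\ measurable_fun A w,
        {ae m, forall x, A x -> u x = w x} &
        m.-integrable A (EFin \o (fun x => w x ^+ 2))].

Definition abs_cont01 g : Prop :=
  forall e : R, 0 < e -> exists2 d : R, 0 < d &
  forall (n : nat) (a b : 'I_n -> R),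
    (forall i, [/\ 0 <= a i, a i <= b i & b i <= 1]) ->
    trivIset setT (fun i => [set` `]a i, b i[]) ->
    \sum_(i < n) (b i - a i) < d ->
    \sum_(i < n) `|g (b i) - g (a i)| < e.

(* Absolute continuity of a function of two variables on the square, in the
   sense of Caratheodory. *)
Definition abs_cont_sq y : Prop :=
  [/\ (forall e : R, 0 < e -> exists2 d : R, 0 < d &
       forall (n : nat) (a b a' b' : 'I_n -> R),
         (forall i, [/\ 0 <= a i, a i <= b i & b i <= 1]) ->
         (forall i, [/\ 0 <= a' i, a' i <= b' i & b' i <= 1]) ->
         trivIset setT
           (fun i => [set` `]a i, b i[] `*` [set` `]a' i, b' i[]) ->
         \sum_(i < n) (b i - a i) * (b' i - a' i) < d ->
         \sum_(i < n)
           `|y (b i) (b' i) - y (a i) (b' i) - y (b i) (a' i) + y (a i) (a' i)|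
           < e),
      abs_cont01 (y ^~ 0) &
      abs_cont01 (y 0)].

Definition W3_inner (g h : R -> R) : R :=
  g 0 * h 0 + deriv01 g 0 * deriv01 h 0 + g 1 * h 1 +
  \int[mu]_(x in I01) (iter 3 deriv01 g x * iter 3 deriv01 h x).

Definition W32_inner y v : R :=
  \sum_(i < 2) \int[mu]_(eta in I01)
     (iter 2 deta (iter i dxi y) 0 eta * iter 2 deta (iter i dxi v) 0 eta) +
  \int[mu]_(eta in I01) (iter 2 deta y 1 eta * iter 2 deta v 1 eta) +
  \sum_(j < 2) W3_inner ((iter j deta y) ^~ 0) ((iter j deta v) ^~ 0) +
  \int[mu2]_(z in sqD) (iter 3 dxi (iter 2 deta y) z.1 z.2 *
                        iter 3 dxi (iter 2 deta v) z.1 z.2).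

Definition W32_norm y : R := Num.sqrt (W32_inner y y).

(* The last conjuncts of [W32] say that every integral of [W32_inner y y] is
   finite.  They have to be required: if q' is absolutely continuous, q 0 = 0
   and q'' is not square integrable, then xi (1 - xi) q(eta) satisfies all the
   other conditions but has infinite norm.  The derivatives that enter only
   through integrals exist almost everywhere by absolute continuity of the
   derivative of order (2, 1). *)
Definition W32 y : Prop :=
  [/\ (forall xi eta, I01 xi -> I01 eta ->
        [/\ derivable01 (y xi) eta,
            derivable01 (deta y ^~ eta) xi &
            derivable01 (dxi (deta y) ^~ eta) xi]),
      abs_cont_sq (iter 2 dxi (deta y)),
      in_L2 mu2 sqD (fun z => iter 3 dxi (iter 2 deta y) z.1 z.2),
      (forall x, I01 x -> [/\ y x 0 = 0, y 0 x = 0 & y 1 x = 0]) &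
      [/\ forall i : 'I_2, in_L2 mu I01 (iter 2 deta (iter i dxi y) 0),
          in_L2 mu I01 (iter 2 deta y 1) &
          forall j : 'I_2, in_L2 mu I01 (iter 3 deriv01 ((iter j deta y) ^~ 0))]].

Definition kernel2 (t eta : R) : R :=
  if eta <= t then eta * t + 2^-1 * t * eta ^+ 2 - 6^-1 * eta ^+ 3
  else - (6^-1 * t ^+ 3) + 2^-1 * eta * t ^+ 2 + t * eta.

Definition kernel3 (x xi : R) : R :=
  if xi <= x then
    - (120^-1 * (x - 1) * xi *
       (xi * x ^+ 4 - 4 * xi * x ^+ 3 + 6 * xi * x ^+ 2 + x * xi ^+ 4
        - 5 * x * xi ^+ 3 - 120 * x * xi + 120 * x + xi ^+ 4))
  else
    - (120^-1 * (xi - 1) * x *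
       (x * xi ^+ 4 - 4 * x * xi ^+ 3 + 6 * x * xi ^+ 2 + xi * x ^+ 4
        - 5 * xi * x ^+ 3 - 120 * xi * x + 120 * xi + x ^+ 4)).

Definition kernelW32 (x t xi eta : R) : R := kernel3 x xi * kernel2 t eta.

End Functions_on_the_square.

Section Burgers_problem.
Context {R : realType}.
Implicit Types y : R -> R -> R.

Notation mu := (@lebesgue_measure R).

Definition Gamma (z : R) : R :=
  \int[mu]_(s in `]0, +oo[) (s `^ (z - 1) * expR (- s)).

Definition caputo (alpha : R) y : R -> R -> R := fun xi eta =>
  if alpha == 1 then deta y xi eta
  else (Gamma (1 - alpha))^-1 *
       \int[mu]_(r in `]0, eta[) (deta y xi r / (eta - r) `^ alpha).

Definition burgersL (alpha : R) (k1 k2 k3 : R -> R -> R) y : R -> R -> R :=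
  fun xi eta =>
    caputo alpha y xi eta + k1 xi eta * dxi (dxi y) xi eta +
    k2 xi eta * y xi eta + k3 xi eta * dxi y xi eta.

Definition burgersF (f k4 : R -> R -> R) (xi eta u v : R) : R :=
  f xi eta - k4 xi eta * u * v.

Definition burgers_solution (alpha : R) (k1 k2 k3 k4 f : R -> R -> R) y :
    Prop :=
  W32 y /\
  forall xi eta, I01 xi -> I01 eta ->
    burgersL alpha k1 k2 k3 y xi eta =
    burgersF f k4 xi eta (y xi eta) (dxi y xi eta).

End Burgers_problem.

Section Approximation.
Context {R : realType}.

(* Sequences are indexed from 0: the term of rank i + 1 has index i. *)

Definition psi (alpha : R) (k1 k2 k3 : R -> R -> R) (p : nat -> R * R)
    (i : nat) : R -> R -> R := fun xi eta =>
  burgersL alpha k1 k2 k3 (fun x t => kernelW32 x t xi eta) (p i).1 (p i).2.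

Definition psibar (ps : nat -> R -> R -> R) (beta : nat -> nat -> R)
    (i : nat) : R -> R -> R := fun xi eta =>
  \sum_(k < i.+1) beta i k * ps k xi eta.

Definition gs_residual (ps : nat -> R -> R -> R) (beta : nat -> nat -> R)
    (i : nat) : R -> R -> R := fun xi eta =>
  ps i xi eta - \sum_(k < i)
    W32_inner (ps i) (psibar ps beta k) * psibar ps beta k xi eta.

(* The coefficients of the normalised Gram-Schmidt process
     psibar_i = r_i / |r_i|,  r_i = ps_i - sum_(k < i) <ps_i, psibar_k> psibar_k.
   A vector depending linearly on its predecessors has r_i = 0; then row i of
   beta and psibar_i vanish since 0^-1 = 0, i.e., this vector is skipped.  This
   case does occur: every y in W32 satisfies (L y)(0, 0) = 0, so the function
   [psi] attached to the point (0, 0) is identically 0.  For the other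
   indices beta i i > 0, and the psibar_i so obtained are orthonormal. *)
Definition gram_schmidt (ps : nat -> R -> R -> R) (beta : nat -> nat -> R) :
    Prop :=
  (forall i, beta i i = (W32_norm (gs_residual ps beta i))^-1) /\
  (forall i j, (j < i)%N ->
     beta i j = - (\sum_(j <= k < i)
                     W32_inner (ps i) (psibar ps beta k) * beta k j) /
                (W32_norm (gs_residual ps beta i))).

Definition nterm_approx (B : nat -> R) (pb : nat -> R -> R -> R) (n : nat) :
    R -> R -> R := fun xi eta => \sum_(i < n) B i * pb i xi eta.

(* The approximation at which F is evaluated: by convention the one of rank 0
   is the exact solution y, used at the first point only. *)
Definition prev_approx (y : R -> R -> R) (B : nat -> R)
    (pb : nat -> R -> R -> R) (n : nat) : R -> R -> R :=
  if n is 0 then y else nterm_approx B pb n.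

End Approximation.

(* Main.v *)
(* The map y |-> (y_(xi eta)(0, 0), y_(xi xi xi eta)(., 0), y_(xi eta eta)(0, .),
   y_(xi xi xi eta eta)) turns the W32 inner product into an l2 inner product of
   square integrable data.  In terms of the data, point values of y, of its
   derivatives up to (2, 1) and of its Caputo derivative are inner products with
   explicit bounded tensors, which depend continuously on the point.  Hence
   (L y)(p_i) = <y, psi_i>, and the approximations y_n are the partial sums of a
   series along an orthonormal system.  Being bounded they converge to some s,
   and <s, psi_j> is the value of F at p_j prescribed by y_j for every psi_j that
   is not skipped by Gram-Schmidt.

   No psi_j is skipped if p_j is an interior point that differs from all its
   predecessors: a cubic B-spline in xi concentrated near xi_j, times a bump in
   eta placed at the latest time that carries weight in a linear relation between
   psi_j and its predecessors, annihilates all but one group of terms of the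
   relation.  By density these p_j accumulate at every point q of D, and since
   y_j and its xi-derivative converge uniformly, (L s)(q) = F(q, s(q), s_xi(q)).
   So s solves the problem, and s = y by uniqueness. *)
Require Import Defs.
From HB Require Import structures.
From mathcomp Require Import all_boot all_order all_algebra.
From mathcomp Require Import all_classical all_reals all_analysis.
From mathcomp Require Import measurable_realfun.
From mathcomp Require Import ring lra.
Import Order.TTheory GRing.Theory Num.Theory.
Import numFieldNormedType.Exports.

Set Implicit Arguments.
Unset Strict Implicit.
Unset Printing Implicit Defensive.

Local Open Scope classical_set_scope.
Local Open Scope ring_scope.

(** * Integrals of real-valued functions *)

(** Everything runs from data to functions: the limit s is obtained as data, the function built from
    it is shown to solve the problem, and y is reached through uniqueness.

    The delicate point is that the inner product of W32 is made of iterated one-sided derivatives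
    that exist only almost everywhere. For the derivative of order (3, 2) the exceptional times of
    the second time derivative must not depend on xi, since three derivatives in xi follow at a
    fixed time; and the good points of the last one must form a measurable set before Tonelli's
    theorem can turn null sections into a null set.

    The test functions of the independence argument exploit causality: apart from the boundary
    datum, values and Caputo derivatives at a time involve the data at earlier times only, so that a
    bump just before the latest time is not seen at earlier ones. The bump is also orthogonal to the
    evaluation at the latest time. This removes the terms with k1, k2 and k3, which are arbitrary,
    and leaves the Caputo term, whose coefficient in L is 1. *)

Section Real_integrals.
Import HBNNSimple.
Context d (T : measurableType d) (R : realType).
Variable m : {measure set T -> \bar R}.
Implicit Types f g : T -> R.

Definition itg f : Prop := m.-integrable setT (EFin \o f).

Lemma itg_measurable f : itg f -> measurable_fun setT f.
Proof. by move=> /measurable_int/measurable_EFinP. Qed.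

Lemma itgD f g : itg f -> itg g -> itg (fun x => f x + g x).
Proof. exact: integrableD. Qed.

Lemma itgN f : itg f -> itg (fun x => - f x).
Proof. by move=> F; exact: (integrableN F). Qed.

Lemma itgB f g : itg f -> itg g -> itg (fun x => f x - g x).
Proof. by move=> F G; apply: itgD => //; exact: itgN. Qed.

Lemma itgZ (k : R) f : itg f -> itg (fun x => k * f x).
Proof. by move=> F; exact: (integrableZl measurableT k F). Qed.

Lemma itg0 : itg (fun=> 0).
Proof. exact: integrable0. Qed.

Lemma itg_le f g : measurable_fun setT f -> (forall x, `|f x| <= g x) ->
  itg g -> itg f.
Proof.
move=> mf fg ig; apply: (le_integrable measurableT _ _ ig).
  exact/measurable_EFinP.
move=> x _ /=; rewrite lee_fin (le_trans (fg x))//; exact: ler_norm.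
Qed.

Lemma itg_abs f : itg f -> itg (fun x => `|f x|).
Proof. by move=> F; exact: integrable_norm. Qed.

Lemma itg_bounded_mul f g (K : R) : itg f -> measurable_fun setT g ->
  (forall x, `|g x| <= K) -> itg (fun x => f x * g x).
Proof.
move=> F mg gK; apply: (@itg_le _ (fun x => K * `|f x|)).
- exact: measurable_funM (itg_measurable F) mg.
- by move=> x; rewrite normrM mulrC ler_wpM2r.
- exact/itgZ/itg_abs.
Qed.

Lemma RintD f g : itg f -> itg g ->
  \int[m]_x (f x + g x) = \int[m]_x f x + \int[m]_x g x.
Proof. by move=> F G; rewrite RintegralD. Qed.

Lemma RintB f g : itg f -> itg g ->
  \int[m]_x (f x - g x) = \int[m]_x f x - \int[m]_x g x.
Proof. by move=> F G; rewrite RintegralB. Qed.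

Lemma RintZ (k : R) f : itg f -> \int[m]_x (k * f x) = k * \int[m]_x f x.
Proof. by move=> F; rewrite RintegralZl. Qed.

Lemma Rintegral0 : \int[m]_x (0 : R) = 0.
Proof. by rewrite /Rintegral integral0. Qed.

Lemma Rint_le f g : itg f -> itg g -> (forall x, f x <= g x) ->
  \int[m]_x f x <= \int[m]_x g x.
Proof. by move=> F G fg; apply: le_Rintegral => // x _. Qed.

Lemma Rint_abs_le f g : itg f -> itg g -> (forall x, `|f x| <= g x) ->
  `|\int[m]_x f x| <= \int[m]_x g x.
Proof.
move=> F G fg; rewrite (le_trans (le_normr_Rintegral _ _))//.
by apply: Rint_le => //; exact: itg_abs.
Qed.

Lemma EFin_Rint f : itg f -> (\int[m]_x f x)%:E = (\int[m]_x (f x)%:E)%E.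
Proof. by move=> F; rewrite /Rintegral fineK//; exact: integrable_fin_num. Qed.

Lemma Rint_cvg (f_ : nat -> T -> R) f g :
  (forall n, measurable_fun setT (f_ n)) -> measurable_fun setT f ->
  {ae m, forall x, f_ ^~ x @ \oo --> f x} -> itg g ->
  (forall n x, `|f_ n x| <= g x) ->
  \int[m]_x f_ n x @[n --> \oo] --> \int[m]_x f x.
Proof.
move=> mf_ mf cf ig fg.
have I n : itg (f_ n) by exact: itg_le ig.
have [] := @dominated_convergence _ _ _ m setT measurableT
  (fun n => EFin \o f_ n) (EFin \o f) (EFin \o g).
- by move=> n; exact/measurable_EFinP.
- exact/measurable_EFinP.
- by apply: filterS cf => x cfx _; apply: cvg_EFin; [exact: nearW|exact: cfx].
- exact: ig.
- by apply: aeW => x n _; rewrite /= lee_fin.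
move=> F _; rewrite -EFin_Rint// => /fine_cvg; apply: cvg_trans.
by apply: near_eq_cvg; near=> n.
Unshelve. all: by end_near. Qed.

(* [integral] is a supremum over simple functions below the integrand, so
   neither side has to be measurable. *)
Lemma le_integral_ae_eq (f g : T -> \bar R) (N : set T) :
  measurable N -> m N = 0%E -> (forall x, ~ N x -> f x = g x) ->
  (forall x, 0 <= f x)%E -> (forall x, 0 <= g x)%E ->
  (\int[m]_x f x <= \int[m]_x g x)%E.
Proof.
move=> mN N0 fg f0 g0; rewrite ge0_integralTE// ge0_integralTE//.
apply: ge_ereal_sup => /= _ [h hf <-].
pose k := proj_nnsfun h (measurableC mN).
rewrite -integralT_nnsfun.
have -> : (\int[m]_x (h x)%:E = \int[m]_x (k x)%:E)%E.
  apply: ge0_ae_eq_integral => //.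
  - exact/measurable_EFinP.
  - exact/measurable_EFinP.
  - by move=> x _; rewrite lee_fin.
  - by move=> x _; rewrite lee_fin.
  exists N; split => // x /= hk; apply: contrapT => Nx; apply: hk => _.
  by rewrite /k /= mindicE mem_set// mulr1.
rewrite integralT_nnsfun; apply: ereal_sup_ubound => /=; exists k => // x.
rewrite /k /= mindicE; have [Nx|Nx] := pselect (N x).
  by rewrite memNset ?mulr0//; apply/negP; rewrite inE => /(_ Nx).
by rewrite mem_set// mulr1 -fg.
Qed.

(** The derivatives in [W32_inner] agree almost everywhere with measurable functions but need not be
    measurable themselves, so equality almost everywhere has to suffice. *)
Lemma ae_eq_integral_nonmeasurable (D : set T) (f g : T -> \bar R) :
  {ae m, forall x, D x -> f x = g x} ->
  (\int[m]_(x in D) f x = \int[m]_(x in D) g x)%E.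
Proof.
move=> [N [mN N0 subN]].
rewrite integral_mkcond [RHS]integral_mkcond.
have fg x : ~ N x -> (f \_ D) x = (g \_ D) x.
  move=> Nx; rewrite !patchE; case: ifPn => // /set_mem Dx.
  by apply: contrapT => fgx; apply/Nx/subN => /(_ Dx).
rewrite integralE [RHS]integralE; congr (_ - _)%E; apply/eqP;
  rewrite eq_le; apply/andP; split; apply: (le_integral_ae_eq _ N0) => // x Nx;
  by rewrite ?funeposE ?funenegE fg.
Qed.

Lemma ae_eq_Rintegral (D : set T) f g :
  {ae m, forall x, D x -> f x = g x} ->
  \int[m]_(x in D) f x = \int[m]_(x in D) g x.
Proof.
move=> fg; rewrite /Rintegral; congr fine.
by apply: ae_eq_integral_nonmeasurable => //; apply: filterS fg => x + Dx => ->.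
Qed.

End Real_integrals.

Lemma geometric_increments (R : realType) (a : nat -> R) (C : R) :
  (forall k, `|a k.+1 - a k| <= C / 2 ^+ k) ->
  exists l, a @ \oo --> l /\ forall K, `|l - a K| <= 2 * C / 2 ^+ K.
Proof.
move=> inc.
have C0 : 0 <= C by have := inc 0%N; rewrite expr0 divr1; apply: le_trans.
(* The subtracted term makes the induction on n close: its change from n to n + 1 is the allowed
   increment C / 2 ^+ (K + n). *)
have tail K n : `|a (K + n)%N - a K| <= 2 * C / 2 ^+ K - 2 * C / 2 ^+ (K + n).
  elim: n => [|n IH]; first by rewrite addn0 !subrr normr0.
  rewrite addnS; apply: le_trans (_ : `|a (K + n).+1 - a (K + n)%N| +
    `|a (K + n)%N - a K| <= _).
    by rewrite (le_trans _ (ler_normD _ _))// addrA subrK.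
  apply: le_trans (lerD (inc _) IH) _.
  rewrite exprS; set p := 2 ^+ (K + n).
  have p0 : 0 < p by rewrite exprn_gt0.
  by rewrite invfM; move: (p^-1) => q; lra.
have tail' K n : (K <= n)%N -> `|a n - a K| <= 2 * C / 2 ^+ K.
  move=> Kn; rewrite -(subnKC Kn) (le_trans (tail _ _))// gerBl.
  by rewrite divr_ge0 ?mulr_ge0 ?exprn_ge0.
have small e : 0 < e -> exists K, 2 * C / 2 ^+ K < e.
  move=> e0.
  have : (fun K => 2 * C * (2^-1 : R) ^+ K) @ \oo --> 0.
    rewrite -[X in _ --> X](mulr0 (2 * C)); apply: cvgM; first exact: cvg_cst.
    by apply: cvg_expr; rewrite gtr0_norm ?invr_gt0// invf_lt1// ltr1n.
  move=> /cvgr0Pnorm_lt/(_ _ e0)[K _ /(_ K (leqnn K))] /=.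
  rewrite exprVn => h; exists K; apply: le_lt_trans h; exact: ler_norm.
have : cvgn a.
  apply/cauchy_cvgP/cauchy_exP => e e0.
  have [K Ke] := small _ e0; exists (a K).
  exists K => // n /= Kn.
  by rewrite /ball /= /ball_ distrC; have := tail' K n Kn; lra.
move=> /cvg_ex[l al]; exists l; split => // K.
apply/ler_addgt0Pr => e e0.
have /cvgrPdist_lt/(_ _ e0)[n _ /(_ (maxn n K))] := al.
rewrite /= leq_maxl => /(_ isT) ln.
have := ler_distD (a (maxn n K)) l (a K).
have := tail' K (maxn n K) (leq_maxr _ _); lra.
Unshelve. all: by end_near. Qed.

(** * Square integrable functions and their completeness *)

Section Square_integrable.
Context d (T : measurableType d) (R : realType).
Variable m : {measure set T -> \bar R}.
Variables (D : set T) (mD : measurable D) (Dfin : (m D < +oo)%E).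
Implicit Types f g : T -> R.

(** Functions rather than classes; since they vanish off [D], all integrals can run over the whole
    space. *)
Definition L2 f : Prop := [/\ measurable_fun setT f,
  forall x, ~ D x -> f x = 0 & itg m (fun x => f x ^+ 2)].

Lemma L2M f g : L2 f -> L2 g -> itg m (fun x => f x * g x).
Proof.
move=> [mf _ f2] [mg _ g2].
apply: (itg_le _ _ (itgD f2 g2)); first exact: measurable_funM.
move=> x; rewrite ler_norml; have := sqr_ge0 (f x + g x);
  have := sqr_ge0 (f x - g x); have := sqr_ge0 (f x); have := sqr_ge0 (g x).
lra.
Qed.

Lemma itg_indic : itg m (\1_D).
Proof.
apply/integrableP; split; first exact/measurable_EFinP/measurable_indic.
under eq_integral do rewrite /= ger0_norm//.
by rewrite integral_indic// setIT.
Qed.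

Lemma L2_itg f : L2 f -> itg m f.
Proof.
move=> [mf Df f2]; apply: (itg_le mf _ (itgD itg_indic f2)) => x.
rewrite indicE; case: (boolP (x \in D)) => [_|/negP xD].
  rewrite ler_norml /=; have := sqr_ge0 (f x + 1);
    have := sqr_ge0 (f x - 1); have := sqr_ge0 (f x).
  lra.
by rewrite Df ?normr0 ?expr0n//= ?addr0// => Dx; apply: xD; rewrite inE.
Qed.

Lemma L2_bounded f (K : R) : measurable_fun setT f ->
  (forall x, ~ D x -> f x = 0) -> (forall x, `|f x| <= K) -> L2 f.
Proof.
move=> mf Df fK; split => //.
apply: (itg_le _ _ (itgZ (K ^+ 2) itg_indic)); first exact: measurable_funX.
move=> x; rewrite indicE; case: (boolP (x \in D)) => [_|/negP xD].
  by rewrite mulr1 normrX lerXn2r// nnegrE// (le_trans _ (fK x)).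
by rewrite Df ?expr0n ?normr0 ?mulr0// => Dx; apply: xD; rewrite inE.
Qed.

Lemma L2D f g : L2 f -> L2 g -> L2 (fun x => f x + g x).
Proof.
move=> Lf Lg; have [mf Df f2] := Lf; have [mg Dg g2] := Lg.
split; [exact: measurable_funD|by move=> x xD; rewrite Df// Dg// addr0|].
have := itgD (itgD f2 (itgZ 2 (L2M Lf Lg))) g2.
by congr itg; apply/funext => x /=; rewrite sqrrD mulr_natl.
Qed.

Lemma L2Z (k : R) f : L2 f -> L2 (fun x => k * f x).
Proof.
move=> [mf Df f2]; split.
- exact: measurable_funM.
- by move=> x xD; rewrite Df// mulr0.
- have := itgZ (k ^+ 2) f2.
  by congr itg; apply/funext => x /=; rewrite exprMn.
Qed.

Lemma L2B f g : L2 f -> L2 g -> L2 (fun x => f x - g x).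
Proof.
move=> Lf Lg; have := L2D Lf (L2Z (-1) Lg).
by congr L2; apply/funext => x; rewrite mulN1r.
Qed.

Lemma L2_0 : L2 (fun=> 0).
Proof.
by apply: (@L2_bounded _ 0) => // x; rewrite normr0.
Qed.

(* Along a subsequence with [|g_(k+1) - g_k|^2 <= 8^-k] the function
   [s = sum_k 4^k (g_(k+1) - g_k)^2] is integrable, so that
   [|g_(k+1) - g_k| <= sqrt s / 2^k] wherever [s] is finite. *)
Lemma Riesz_Fischer (f_ : nat -> T -> R) : (forall n, L2 (f_ n)) ->
  (forall e, 0 < e -> exists N, forall n k, (N <= n)%N -> (N <= k)%N ->
     \int[m]_x ((f_ n x - f_ k x) ^+ 2) <= e) ->
  exists f, L2 f /\ \int[m]_x ((f_ n x - f x) ^+ 2) @[n --> \oo] --> 0.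
Proof.
move=> Lf cauchy.
have /choice[N NP] : forall k : nat, exists N, forall i j, (N <= i)%N ->
    (N <= j)%N -> \int[m]_x ((f_ i x - f_ j x) ^+ 2) <= (8^-1) ^+ k.
  by move=> k; apply: cauchy; rewrite exprn_gt0.
pose phi k := (\sum_(i < k.+1) N i)%N.
have phiN k : (N k <= phi k)%N by rewrite /phi big_ord_recr leq_addl.
have phiS k : (phi k <= phi k.+1)%N by rewrite /phi [leqRHS]big_ord_recr leq_addr.
have phimono : {homo phi : i j / (i <= j)%N}.
  by apply: homo_leq => // i j k; exact: leq_trans.
pose g k := f_ (phi k).
have mg k : measurable_fun setT (g k) by have [] := Lf (phi k).
pose h k x := (g k.+1 x - g k x) ^+ 2.
have ih k : itg m (h k) by have [] := L2B (Lf (phi k.+1)) (Lf (phi k)).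
have hle k : \int[m]_x h k x <= (8^-1) ^+ k.
  by apply: NP => //; exact: leq_trans (phiS k).
pose S x := (\sum_(k <oo) (4 ^+ k * h k x)%:E)%E.
have h0 k x : 0 <= h k x by exact: sqr_ge0.
have t0 k x : (0 <= (4 ^+ k * h k x)%:E)%E.
  by rewrite lee_fin mulr_ge0// exprn_ge0.
have mt k : measurable_fun setT (fun x => (4 ^+ k * h k x)%:E).
  by apply/measurable_EFinP/measurable_funM => //; exact: (itg_measurable (ih k)).
have mS : measurable_fun setT S.
  by apply: ge0_emeasurable_sum => // k x _ _; exact: t0.
have S0 x : (0 <= S x)%E by exact: nneseries_ge0.
have intS : (\int[m]_x S x <= 2%:E)%E.
  rewrite integral_nneseries//.
  apply: (@le_trans _ _ (\sum_(k <oo) (2 / (2 ^ (k + 1))%:R)%:E)%E); last first.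
    by have /cvg_lim -> := @cvg_geometric_eseries_half R 2 0; rewrite ?expr0 ?divr1.
  apply: lee_nneseries => [k _ _|k _]; first exact: integral_ge0.
  rewrite -EFin_Rint ?lee_fin; last exact: itgZ.
  rewrite RintZ//; apply: le_trans (ler_wpM2l _ (hle k)) _; first exact: exprn_ge0.
  rewrite -exprMn addn1 expnS natrM invfM mulrA mulfV ?pnatr_eq0// mul1r natrX.
  by rewrite -exprVn lerXn2r// ?nnegrE; lra.
have iS : m.-integrable setT S.
  apply/integrableP; split => //.
  under eq_integral => x _ do rewrite gee0_abs//.
  by apply: le_lt_trans intS _; rewrite ltry.
pose E := [set x | S x < +oo]%E.
have mE : measurable E.
  have -> : E = setT `&` [set x | (S x < +oo)%E] by rewrite setTI.
  exact: emeasurable_fun_infty_o.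
pose s x := fine (S x).
have s0 x : 0 <= s x by exact: fine_ge0.
have Efin x : E x -> S x = (s x)%:E by move=> Ex; rewrite fineK// ge0_fin_numE.
have aeE : {ae m, forall x, E x}.
  have := integrable_ae measurableT iS; apply: filterS => x /(_ I) /=.
  by rewrite /E /= ge0_fin_numE.
have is_ : itg m s.
  apply: (le_integrable measurableT _ _ iS).
    exact/measurable_EFinP/measurableT_comp.
  move=> x _ /=; rewrite ger0_norm// gee0_abs//.
  by rewrite /s; case: (S x) (S0 x) => //= r _; rewrite leey.
(* Cutting off the null set where the series [S] diverges makes the subsequence converge at every
   point, so that its limit is measurable. *)
pose G k x := g k x * \1_E x.
have mG k : measurable_fun setT (G k) by apply: measurable_funM => //; exact: measurable_indic.
have inc x k : `|G k.+1 x - G k x| <= Num.sqrt (s x) / 2 ^+ k.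
  rewrite /G indicE; have [Ex|Ex] := boolP (x \in E); last first.
    by rewrite !mulr0 subrr normr0 divr_ge0 ?sqrtr_ge0 ?exprn_ge0.
  rewrite !mulr1.
  have hs : 4 ^+ k * h k x <= s x.
    rewrite -lee_fin -Efin; last by rewrite inE in Ex.
    have := @nneseries_lim_ge R (fun k => (4 ^+ k * h k x)%:E) xpredT 0 k.+1
      (fun k _ _ => t0 k x).
    apply: le_trans; rewrite big_nat_recr//= leeDr//.
    by apply: sume_ge0 => i _; exact: t0.
  rewrite -sqrtr_sqr ler_pdivlMr ?exprn_gt0//.
  rewrite -[2 ^+ k](@ger0_norm _) ?exprn_ge0// -sqrtr_sqr -sqrtrM ?sqr_ge0//.
  by apply: ler_wsqrtr; rewrite mulrC -exprM mulnC exprM -natrX.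
have /choice[f fP] : forall x, exists l, (G ^~ x @ \oo --> l) /\
    forall K, `|l - G K x| <= 2 * Num.sqrt (s x) / 2 ^+ K.
  by move=> x; exact: geometric_increments (inc x).
have mf : measurable_fun setT f.
  by apply: (measurable_fun_cvg mG) => x _; have [] := fP x.
have fG K x : (f x - G K x) ^+ 2 <= 4 * (4^-1) ^+ K * s x.
  have [_ /(_ K) le] := fP x.
  have b0 : 0 <= 2 * Num.sqrt (s x) / 2 ^+ K.
    by rewrite divr_ge0 ?mulr_ge0 ?sqrtr_ge0 ?exprn_ge0.
  have := le; rewrite -(ler_sqr (normr_ge0 _) b0) real_normK ?num_real// => /le_trans; apply.
  rewrite !exprMn sqr_sqrtr// -exprVn -exprM mulnC exprM.
  have -> : (2^-1 : R) ^+ 2 = 4^-1 by rewrite exprVn -natrX.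
  by rewrite -natrX; nra.
have Df x : ~ D x -> f x = 0.
  move=> Dx; have [+ _] := fP x; have -> : G ^~ x = cst 0.
    by apply/funext => k; rewrite /G /g; have [_ -> //] := Lf (phi k); rewrite mul0r.
  by move=> /cvg_lim <- //; rewrite lim_cst.
have LG k : L2 (G k).
  split => //.
    by move=> x Dx; rewrite /G /g; have [_ -> //] := Lf (phi k); rewrite mul0r.
  apply: (@itg_le _ _ _ _ _ (fun x => g k x ^+ 2)) => //.
    exact: measurable_funX.
    move=> x; rewrite ger0_norm ?sqr_ge0// /G indicE.
    by case: (x \in E); rewrite ?mulr1// mulr0 expr0n/= sqr_ge0.
  by have [] := Lf (phi k).
have ifG K : itg m (fun x => (f x - G K x) ^+ 2).
  apply: (itg_le _ _ (itgZ (4 * 4^-1 ^+ K) is_)).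
    by apply: measurable_funX; exact: measurable_funB.
  by move=> x; rewrite ger0_norm ?sqr_ge0.
have Lf' : L2 f.
  have LfG : L2 (fun x => f x - G 0%N x).
    split => //; first exact: measurable_funB.
    by move=> x Dx; rewrite Df//; have [_ -> //] := LG 0%N; rewrite subrr.
  have := L2D LfG (LG 0%N); congr L2; apply/funext => x.
  by rewrite subrK.
exists f; split => //.
(* A term outside the subsequence is compared with [f] through [g K], by (a + b)^2 <= 2 a^2 + 2
   b^2. *)
have bound n K : \int[m]_x ((f_ n x - f x) ^+ 2) <=
    2 * \int[m]_x ((f_ n x - g K x) ^+ 2) + 8 * \int[m]_x s x * (4^-1) ^+ K.
  have -> : \int[m]_x ((f_ n x - g K x) ^+ 2) = \int[m]_x ((f_ n x - G K x) ^+ 2).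
    apply: ae_eq_Rintegral; apply: filterS aeE => x Ex _.
    by rewrite /G indicE mem_set// mulr1.
  have i1 : itg m (fun x => (f_ n x - G K x) ^+ 2) by have [] := L2B (Lf n) (LG K).
  have i2 : itg m (fun x => (f_ n x - f x) ^+ 2) by have [] := L2B (Lf n) Lf'.
  rewrite mulrAC -RintZ// -RintZ// -RintD; [|exact: itgZ|exact: itgZ].
  apply: Rint_le => [//||x]; first by apply: itgD; exact: itgZ.
  have := fG K x; have := sqr_ge0 ((f_ n x - G K x) + (f x - G K x)).
  set p := 4^-1 ^+ K * s x.
  have -> : 4 * 4^-1 ^+ K * s x = 4 * p by rewrite /p mulrA.
  have -> : 8 * 4^-1 ^+ K * s x = 8 * p by rewrite /p mulrA.
  move: (f_ n x) (f x) (G K x) p => a b c p; nra.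
apply/cvgr0Pnorm_le => e e0.
pose C := 2 + 8 * \int[m]_x s x.
have : (fun K => C * (4^-1 : R) ^+ K) @ \oo --> 0.
  rewrite -[X in _ --> X](mulr0 C); apply: cvgM; first exact: cvg_cst.
  by apply: cvg_expr; rewrite gtr0_norm ?invr_gt0// invf_lt1// ltr1n.
move=> /cvgr0Pnorm_lt/(_ _ e0)[K _ /(_ K (leqnn K))] /= Ke.
exists (N K) => // n /= Kn.
rewrite ger0_norm; last by apply: Rintegral_ge0 => x _; exact: sqr_ge0.
apply: le_trans (bound n K) _.
have h1 := NP K _ _ Kn (phiN K).
have h2 : (8^-1 : R) ^+ K <= 4^-1 ^+ K by rewrite lerXn2r// ?nnegrE; lra.
have h3 := le_lt_trans (ler_norm _) Ke.
move: h1 h2 h3; rewrite /C -/(g K); move: (8^-1 ^+ K) (4^-1 ^+ K) => p q; lra.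
Qed.

End Square_integrable.

(** * Gram-Schmidt orthogonalization *)

Lemma sum_triangle (V : zmodType) (f : nat -> nat -> V) (n : nat) :
  \sum_(k < n) \sum_(j < k.+1) f k j = \sum_(j < n) \sum_(j <= k < n) f k j.
Proof.
elim: n => [|n IH]; first by rewrite !big_ord0.
rewrite big_ord_recr /= IH [RHS]big_ord_recr /= big_nat1 big_ord_recr /= addrA.
rewrite -big_split /=; congr (_ + _); apply: eq_bigr => j _.
by rewrite big_nat_recr// ltnW.
Qed.

(** The form is only semidefinite, because functions that agree almost everywhere are not
    identified. It is linear only on [dom], because integrals are additive only on integrable
    functions. *)
Record is_preHilbert (R : realType) (V : lmodType R) (dom : V -> Prop)
    (ip : V -> V -> R) : Prop := IsPreHilbert {
  dom0 : dom 0;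
  domD : forall u v, dom u -> dom v -> dom (u + v);
  domZ : forall k u, dom u -> dom (k *: u);
  ipC : forall u v, ip u v = ip v u;
  ipDl : forall u v w, dom u -> dom v -> dom w -> ip (u + v) w = ip u w + ip v w;
  ipZl : forall k u v, dom u -> dom v -> ip (k *: u) v = k * ip u v;
  ip_ge0 : forall u, 0 <= ip u u
}.

Section PreHilbert.
Variables (R : realType) (V : lmodType R) (dom : V -> Prop) (ip : V -> V -> R).
Hypothesis H : is_preHilbert dom ip.
Local Notation dom0 := (dom0 H).
Local Notation domD := (domD H).
Local Notation domZ := (domZ H).
Local Notation ipC := (ipC H).
Local Notation ipDl := (ipDl H).
Local Notation ipZl := (ipZl H).
Local Notation ip_ge0 := (ip_ge0 H).

Lemma dom_sum (n : nat) (c : 'I_n -> R) (u : 'I_n -> V) :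
  (forall i, dom (u i)) -> dom (\sum_(i < n) c i *: u i).
Proof.
move=> du; elim/big_ind : _ => //; first exact: dom0.
  by move=> *; exact: domD.
by move=> i _; exact: domZ.
Qed.

Lemma domB u v : dom u -> dom v -> dom (u - v).
Proof. by move=> du dv; rewrite -scaleN1r; exact/domD/domZ. Qed.

Lemma ip0l u : dom u -> ip 0 u = 0.
Proof. by move=> du; rewrite -(scale0r 0) ipZl ?mul0r//; exact: dom0. Qed.

Lemma ip_suml (n : nat) (c : 'I_n -> R) (u : 'I_n -> V) v :
  (forall i, dom (u i)) -> dom v ->
  ip (\sum_(i < n) c i *: u i) v = \sum_(i < n) c i * ip (u i) v.
Proof.
move=> du dv; elim: n c u du => [|n IH] c u du; first by rewrite !big_ord0 ip0l.
rewrite !big_ord_recl ipDl ?ipZl ?IH//; first exact: domZ.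
exact: dom_sum.
Qed.

Lemma ip_sumr (n : nat) (c : 'I_n -> R) (u : 'I_n -> V) v :
  (forall i, dom (u i)) -> dom v ->
  ip v (\sum_(i < n) c i *: u i) = \sum_(i < n) c i * ip v (u i).
Proof.
by move=> du dv; rewrite ipC ip_suml//; apply: eq_bigr => i _; rewrite ipC.
Qed.

Lemma ipBl u v w : dom u -> dom v -> dom w -> ip (u - v) w = ip u w - ip v w.
Proof.
by move=> du dv dw; rewrite -scaleN1r ipDl ?ipZl ?mulN1r//; exact: domZ.
Qed.

Lemma ipBr u v w : dom u -> dom v -> dom w -> ip w (u - v) = ip w u - ip w v.
Proof. by move=> du dv dw; rewrite ipC ipBl// ipC (ipC v). Qed.

Lemma ipDr u v w : dom u -> dom v -> dom w -> ip w (u + v) = ip w u + ip w v.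
Proof. by move=> du dv dw; rewrite ipC ipDl// ipC (ipC v). Qed.

Lemma ipZr k u v : dom u -> dom v -> ip u (k *: v) = k * ip u v.
Proof. by move=> du dv; rewrite ipC ipZl// ipC. Qed.

(** Semidefiniteness makes [ip v v = 0] a case of its own: the quadratic polynomial [q] is then
    affine in t, and if [ip u v] were nonzero, the chosen t would give it the value -1. *)
Lemma cauchy_schwarz u v : dom u -> dom v -> ip u v ^+ 2 <= ip u u * ip v v.
Proof.
move=> du dv.
have q t : 0 <= ip u u + 2 * t * ip u v + t ^+ 2 * ip v v.
  have := ip_ge0 (u + t *: v); rewrite ipDl ?ipDr ?ipZl ?ipZr ?ipDr//;
    do ?[exact: domZ|exact: domD (domZ _ _)].
  by rewrite ?ipZr// (ipC v u) expr2; lra.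
have [v0|v0] := eqVneq (ip v v) 0.
  have [->|uv0] := eqVneq (ip u v) 0; first by rewrite v0 mulr0 expr0n.
  have := q (- (ip u u + 1) / (2 * ip u v)).
  have -> : 2 * (- (ip u u + 1) / (2 * ip u v)) * ip u v = - (ip u u + 1).
    by field.
  rewrite v0; lra.
have vp : 0 < ip v v by rewrite lt_def v0 ip_ge0.
have := q (- ip u v / ip v v).
have -> : ip u u + 2 * (- ip u v / ip v v) * ip u v +
  (- ip u v / ip v v) ^+ 2 * ip v v = (ip u u * ip v v - ip u v ^+ 2) / ip v v.
  by field.
by rewrite pmulr_lge0 ?invr_gt0// subr_ge0.
Qed.

Lemma ip_null u v : dom u -> dom v -> ip v v = 0 -> ip u v = 0.
Proof.
move=> du dv v0; have := cauchy_schwarz du dv; rewrite v0 mulr0 => le0.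
by apply/eqP; rewrite -sqrf_eq0 eq_le le0 sqr_ge0.
Qed.

Lemma ip_cvg (u_ : nat -> V) u v : (forall n, dom (u_ n)) -> dom u -> dom v ->
  ip (u_ n - u) (u_ n - u) @[n --> \oo] --> 0 -> ip (u_ n) v @[n --> \oo] --> ip u v.
Proof.
move=> du_ du dv cu; apply/subr_cvg0.
apply/(norm_cvg0P).
have : Num.sqrt (ip (u_ n - u) (u_ n - u)) * Num.sqrt (ip v v) @[n --> \oo] --> 0.
  rewrite -[X in _ --> X](mul0r (Num.sqrt (ip v v))).
  apply: cvgM; last exact: cvg_cst.
  rewrite -[X in _ --> X]sqrtr0; apply: (cvg_comp _ _ cu); exact: sqrt_continuous.
apply: (@squeeze_cvgr _ _ _ _ (cst 0)); last exact: cvg_cst.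
apply: nearW => n /=; rewrite normr_ge0/= -ipBl//.
rewrite -sqrtr_sqr -sqrtrM ?ip_ge0//; apply: ler_wsqrtr.
by apply: cauchy_schwarz => //; exact: domB.
Qed.

Section Gram_Schmidt.
Variables (D : nat -> V) (beta : nat -> nat -> R).
Hypothesis domDn : forall i, dom (D i).

Definition gs_basis i : V := \sum_(k < i.+1) beta i k *: D k.
Local Notation E := gs_basis.
Definition gs_rest i : V := D i - \sum_(k < i) ip (D i) (E k) *: E k.
Local Notation r := gs_rest.
Definition gs_norm i : R := Num.sqrt (ip (r i) (r i)).
Local Notation rho := gs_norm.

Hypothesis beta_diag : forall i, beta i i = (rho i)^-1.
Hypothesis beta_off : forall i j, (j < i)%N ->
  beta i j = - (\sum_(j <= k < i) ip (D i) (E k) * beta k j) / rho i.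

Lemma dom_gs_basis i : dom (E i).
Proof. exact: dom_sum. Qed.

Lemma dom_gs_rest i : dom (r i).
Proof. by apply: domB => //; apply: dom_sum => k; exact: dom_gs_basis. Qed.

(** Expanding the basis vectors and exchanging the triangular sums produces exactly the coefficients
    of [beta_off]; this links the recursion for [beta] to the residuals. *)
Lemma gs_rest_expand i : r i =
  D i - \sum_(j < i) (\sum_(j <= k < i) ip (D i) (E k) * beta k j) *: D j.
Proof.
congr (_ - _).
under eq_bigr => k _ do (rewrite /E scaler_sumr;
  under eq_bigr do rewrite scalerA).
rewrite (sum_triangle (fun k j => (ip (D i) (E k) * beta k j) *: D j)).
by apply: eq_bigr => j _; rewrite scaler_suml.
Qed.

Lemma gs_basisE i : E i = (rho i)^-1 *: r i.
Proof.
rewrite gs_rest_expand /E big_ord_recr /= beta_diag scalerBr addrC; congr (_ + _).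
rewrite scaler_sumr -sumrN; apply: eq_bigr => j _.
by rewrite beta_off// scalerA -scaleNr mulNr mulrC.
Qed.

Lemma gs_basis_skipped i : rho i = 0 -> E i = 0.
Proof. by move=> r0; rewrite gs_basisE r0 invr0 scale0r. Qed.

Lemma gs_orthonormal i :
  (forall j, (j < i)%N -> ip (E i) (E j) = 0) /\
  ip (E i) (E i) = (rho i != 0)%:R.
Proof.
elim/ltn_ind: i => i IH.
have dE := dom_gs_basis; have dr := dom_gs_rest.
have rE j : (j < i)%N -> ip (r i) (E j) = 0.
  move=> ji; rewrite /r ipBl//; last by apply: dom_sum.
  rewrite ip_suml// (bigD1 (Ordinal ji))//= big1 ?addr0.
    have [_ ->] := IH _ ji; have [/gs_basis_skipped ->|] := eqVneq (rho j) 0.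
      by rewrite mulr0 subr0 ipC ip0l.
    by rewrite mulr1 subrr.
  move=> k kj; have [kj'|jk|kj'] := ltngtP k j.
  - by rewrite (ipC (E k)) (IH _ ji).1// mulr0.
  - by rewrite (IH k _).1// mulr0.
  - by move: kj; rewrite -val_eqE /= kj' eqxx.
split=> [j ji|]; first by rewrite gs_basisE ipZl// rE// mulr0.
have [r0|r0] := eqVneq (rho i) 0; first by rewrite gs_basis_skipped// ip0l//; exact: dom0.
rewrite gs_basisE ipZl ?ipZr//; last exact: domZ.
have <- : rho i ^+ 2 = ip (r i) (r i) by rewrite sqr_sqrtr ?ip_ge0.
by rewrite expr2 mulKf// mulVf.
Qed.

Lemma gs_orthogonal i j : i != j -> ip (E i) (E j) = 0.
Proof.
move=> ij; have [h|h|h] := ltngtP i j.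
- by rewrite ipC (gs_orthonormal j).1.
- by rewrite (gs_orthonormal i).1.
- by rewrite h eqxx in ij.
Qed.

Lemma gs_beta_skipped_row i j : (j <= i)%N -> rho i = 0 -> beta i j = 0.
Proof.
rewrite leq_eqVlt => /predU1P[->|ji] r0; first by rewrite beta_diag r0 invr0.
by rewrite beta_off// r0 invr0 mulr0.
Qed.

(** Column j is generated by its own earlier entries, starting from [beta j j = 0^-1 = 0]. Hence a
    skipped vector enters no later basis vector, and the value prescribed at its index enters no
    coefficient. *)
Lemma gs_beta_skipped_col i j : (j <= i)%N -> rho j = 0 -> beta i j = 0.
Proof.
elim/ltn_ind: i => i IH; rewrite leq_eqVlt => /predU1P[->|ji] r0.
  by rewrite beta_diag r0 invr0.
rewrite beta_off// big_nat big1 ?oppr0 ?mul0r// => k /andP[jk ki].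
by rewrite IH// mulr0.
Qed.

(** A residual of norm 0 need not be 0, but by Cauchy-Schwarz it pairs to 0 with everything; this is
    why the linear relation is expressed by pairings. *)
Lemma gs_skipped_dependent j : rho j = 0 ->
  exists c : nat -> R, forall v, dom v -> ip v (D j) = \sum_(i < j) c i * ip v (D i).
Proof.
move=> r0; exists (fun i => \sum_(i <= k < j) ip (D j) (E k) * beta k i) => v dv.
have rr : ip (r j) (r j) = 0 by rewrite -(sqr_sqrtr (ip_ge0 _)) -/(rho j) r0 expr0n.
have := ip_null dv (dom_gs_rest j) rr.
rewrite gs_rest_expand ipBr//; last exact: dom_sum.
by rewrite ip_sumr// => /eqP; rewrite subr_eq0 => /eqP.
Qed.

Variables (F B : nat -> R).
Hypothesis BE : forall i, B i = \sum_(k < i.+1) beta i k * F k.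

Definition gs_partial n : V := \sum_(i < n) B i *: E i.
Local Notation S := gs_partial.

Lemma dom_gs_partial n : dom (S n).
Proof. by apply: dom_sum => i; exact: dom_gs_basis. Qed.

Lemma gs_coef_skipped i : rho i = 0 -> B i = 0.
Proof.
move=> r0; rewrite BE big1// => k _.
by rewrite gs_beta_skipped_row ?mul0r// -ltnS.
Qed.

Lemma ip_gs_partial n i : (i < n)%N -> ip (S n) (E i) = B i.
Proof.
move=> ni; have dE := dom_gs_basis.
rewrite /S ip_suml// (bigD1 (Ordinal ni))//= big1 ?addr0.
  have [_ ->] := gs_orthonormal i.
  by have [/gs_coef_skipped ->|] := eqVneq (rho i) 0; rewrite ?mul0r ?mulr1.
by move=> k kj; rewrite gs_orthogonal ?mulr0.
Qed.

Lemma gs_partial_norm n k :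
  ip (S (n + k) - S n) (S (n + k) - S n) = \sum_(n <= i < n + k) B i ^+ 2.
Proof.
have dE := dom_gs_basis.
have SE : S (n + k) - S n = \sum_(i < k) B (n + i)%N *: E (n + i)%N.
  by apply/eqP; rewrite subr_eq addrC /S big_split_ord.
rewrite SE ip_suml//; last by rewrite -SE; apply: domB; exact: dom_gs_partial.
have -> : \sum_(n <= i < n + k) B i ^+ 2 = \sum_(i < k) B (i + n)%N ^+ 2.
  by rewrite -{1}[n]add0n big_addn addKn big_mkord.
apply: eq_bigr => i _.
rewrite [(i + n)%N]addnC ip_sumr// (bigD1 i)//= big1 ?addr0.
  rewrite (gs_orthonormal _).2 expr2.
  have [/gs_coef_skipped ->|] := eqVneq (rho (n + i)) 0; first by rewrite !mul0r.
  by rewrite mulr1.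
move=> l li; rewrite gs_orthogonal ?mulr0// eqn_add2l.
by rewrite eq_sym.
Qed.

Hypothesis complete : forall u_ : nat -> V, (forall n, dom (u_ n)) ->
  (forall e, 0 < e -> exists N, forall n k, (N <= n)%N -> (N <= k)%N ->
     ip (u_ n - u_ k) (u_ n - u_ k) <= e) ->
  exists u, dom u /\ ip (u_ n - u) (u_ n - u) @[n --> \oo] --> 0.
Hypothesis bounded : exists M, forall n, Num.sqrt (ip (S n) (S n)) <= M.

(** By orthogonality the squared norms of the partial sums are the sums of [B i ^+ 2]. Being bounded
    and nondecreasing these converge, so the partial sums form a Cauchy sequence. *)
Lemma gs_partial_cvg :
  exists s, [/\ dom s, ip (S n - s) (S n - s) @[n --> \oo] --> 0 &
    forall j, rho j != 0 -> ip s (D j) = F j].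
Proof.
have [M MP] := bounded.
pose Q n := \sum_(i < n) B i ^+ 2.
have SQ n : ip (S n) (S n) = Q n.
  have := gs_partial_norm 0 n; rewrite add0n big_mkord.
  have S0 : S 0 = 0 by rewrite /S big_ord0.
  by rewrite S0 subr0.
have Qnd : nondecreasing_seq Q.
  by apply/nondecreasing_seqP => n; rewrite /Q big_ord_recr/= lerDl sqr_ge0.
have Qub n : Q n <= M ^+ 2.
  rewrite -SQ -[leLHS]sqr_sqrtr ?ip_ge0//.
  by rewrite lerXn2r ?nnegrE ?sqrtr_ge0// (le_trans _ (MP n)) ?sqrtr_ge0.
have cQ : cvgn Q.
  apply: nondecreasing_is_cvgn => //; exists (M ^+ 2) => _ [n _ <-]; exact: Qub.
have [] := @complete S dom_gs_partial.
  move=> e e0.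
  have e2 : 0 < e / 2 by rewrite divr_gt0.
  have /cvgrPdist_lt/(_ _ e2)[N _ NP] := cQ.
  have near_eq n k : (N <= n)%N -> ip (S (n + k)%N - S n) (S (n + k)%N - S n) <= e.
    move=> Nn; rewrite gs_partial_norm.
    have -> : \sum_(n <= i < n + k) B i ^+ 2 = Q (n + k)%N - Q n.
      apply/eqP; rewrite eq_sym subr_eq addrC; apply/eqP.
      rewrite /Q -!(big_mkord xpredT (fun i => B i ^+ 2)).
      by rewrite -big_cat_nat ?leq_addr.
    have := NP n Nn; have := NP (n + k)%N (leq_trans Nn (leq_addr _ _)) => /=.
    rewrite !ltr_norml; lra.
  have sym u v : dom u -> dom v -> ip (u - v) (u - v) = ip (v - u) (v - u).
    move=> du dv; have dvu := domB dv du.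
    have -> : u - v = -1 *: (v - u) by rewrite scaleN1r opprB.
    by rewrite ipZl ?ipZr ?mulrA ?mulrNN ?mul1r//; exact: domZ.
  exists N => n k Nn Nk; have [nk|/ltnW kn] := leqP n k.
    rewrite (sym _ _ (dom_gs_partial n) (dom_gs_partial k)) -(subnKC nk).
    exact: near_eq.
  by rewrite -(subnKC kn); exact: near_eq.
move=> s [ds cs]; exists s; split => //.
have sE i : ip s (E i) = B i.
  have : ip (S n) (E i) @[n --> \oo] --> ip s (E i).
    by apply: ip_cvg => //; [exact: dom_gs_partial|exact: dom_gs_basis].
  move=> /cvg_lim <-//; apply/cvg_lim => //; apply: cvg_near_cst.
  by exists i.+1 => // n /= ni; rewrite ip_gs_partial.
(* The equations [ip s (E j) = B j] form a triangular system for the values [ip s (D k)]: earlier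
   values are known by induction, skipped indices have coefficient 0, and [beta j j] is
   invertible. *)
elim/ltn_ind => j IH rj.
have := sE j; rewrite BE /E ip_sumr// big_ord_recr [in RHS]big_ord_recr /=.
rewrite (eq_bigr (fun k : 'I_j => beta j k * F k)).
  move=> /addrI; rewrite beta_diag; apply: mulfI.
  by rewrite invr_eq0.
move=> k _; have [r0|r0] := eqVneq (rho k) 0; last by rewrite IH.
by rewrite gs_beta_skipped_col ?mul0r// ltnW.
Qed.

End Gram_Schmidt.
End PreHilbert.

(** * The Hilbert space of data *)

Section Fubini_real.
Context d1 d2 (T1 : measurableType d1) (T2 : measurableType d2) (R : realType).
Variables (m1 : {sigma_finite_measure set T1 -> \bar R})
  (m2 : {sigma_finite_measure set T2 -> \bar R}).
Implicit Type f : T1 * T2 -> R.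
Local Notation m12 := (m1 \x m2)%E.

Lemma itg_section1 f : itg m12 f ->
  {ae m1, forall x, itg m2 (fun y => f (x, y))}.
Proof. by move=> F; exact: (ae_integrable1 F). Qed.

Lemma itg_section2 f : itg m12 f ->
  {ae m2, forall y, itg m1 (fun x => f (x, y))}.
Proof. by move=> F; exact: (ae_integrable2 F). Qed.

Lemma itg_Fubini2 f : itg m12 f -> itg m2 (fun y => \int[m1]_x f (x, y)).
Proof.
move=> F; have mF := measurable_int _ F.
have G0 : (forall z, 0 <= (abse \o (EFin \o f)) z)%E by move=> z; exact: abse_ge0.
have mA : measurable_fun setT (abse \o (EFin \o f)) by exact: measurableT_comp.
have iG : m2.-integrable setT (fun y => \int[m1]_x `|(f (x, y))%:E|)%E.
  apply/integrableP; split.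
    exact: (measurable_fun_fubini_tonelli_G (abse \o (EFin \o f))).
  under eq_integral do rewrite gee0_abs ?integral_ge0//.
  exact/(integrable21ltyP _ _ mF).
apply: (le_integrable measurableT _ _ iG).
  apply/measurable_EFinP; apply: measurableT_comp => //.
  exact: (measurable_fubini_G F).
move=> y _ /=; rewrite gee0_abs ?integral_ge0//.
have := @le_abse_integral _ _ _ m1 setT (fun x => (f (x, y))%:E) measurableT
  (measurableT_comp mF (pair2_measurable y)).
apply: le_trans; rewrite /Rintegral.
by case: (integral _ _ _) => //= [|]; rewrite ?normr0 leey.
Qed.

Lemma Rint_Fubini1 f : itg m12 f ->
  \int[m12]_z f z = \int[m1]_x \int[m2]_y f (x, y).
Proof.
move=> F; rewrite /Rintegral -integral12_prod_meas1//; congr fine.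
apply: ae_eq_integral_nonmeasurable; apply: filterS (itg_section1 F) => x ix _.
by rewrite /= -/(Rintegral m2 setT _) EFin_Rint.
Qed.

Lemma Rint_Fubini2 f : itg m12 f ->
  \int[m12]_z f z = \int[m2]_y \int[m1]_x f (x, y).
Proof.
move=> F; rewrite /Rintegral -integral21_prod_meas1//; congr fine.
apply: ae_eq_integral_nonmeasurable; apply: filterS (itg_section2 F) => x ix _.
by rewrite /= -/(Rintegral m1 setT _) EFin_Rint.
Qed.

Lemma itg_prod (a : T1 -> R) (b : T2 -> R) : itg m1 a -> itg m2 b ->
  itg m12 (fun z => a z.1 * b z.2).
Proof.
move=> A B; have mab : measurable_fun setT (fun z : T1 * T2 => a z.1 * b z.2).
  apply: measurable_funM; apply: measurableT_comp => //;
    exact: itg_measurable A || exact: itg_measurable B.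
apply/integrable12ltyP; first exact/measurable_EFinP.
have e x : (\int[m2]_y `|(a x * b y)%:E| = (`|a x| * \int[m2]_y `|b y|)%:E)%E.
  rewrite EFinM EFin_Rint; last exact: itg_abs.
  rewrite -integralZl//; last exact: (itg_abs B).
  by apply: eq_integral => y _; rewrite /= normrM EFinM.
under eq_integral do rewrite e.
rewrite -EFin_Rint ?ltry//; have := itgZ (\int[m2]_y `|b y|) (itg_abs A).
by congr itg; apply/funext => x; rewrite mulrC.
Qed.

Lemma Rint_prod (a : T1 -> R) (b : T2 -> R) : itg m1 a -> itg m2 b ->
  \int[m12]_z (a z.1 * b z.2) = \int[m1]_x a x * \int[m2]_y b y.
Proof.
move=> A B; rewrite Rint_Fubini1 /=; last exact: itg_prod.
under eq_Rintegral do rewrite RintZ//.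
by under eq_Rintegral do rewrite mulrC; rewrite RintZ// mulrC.
Qed.

Lemma ae_fst (P : T1 -> Prop) : {ae m1, forall x, P x} ->
  {ae m12, forall z, P z.1}.
Proof.
move=> [N [mN N0 PN]]; exists (N `*` setT); split.
- exact: measurableX.
- by transitivity (m1 N * m2 setT)%E; [exact: product_measure1E|rewrite N0 mul0e].
- by move=> z /= Pz; split => //; exact: PN.
Qed.

Lemma ae_snd (P : T2 -> Prop) : {ae m2, forall x, P x} ->
  {ae m12, forall z, P z.2}.
Proof.
move=> [N [mN N0 PN]]; exists (setT `*` N); split.
- exact: measurableX.
- by transitivity (m1 setT * m2 N)%E; [exact: product_measure1E|rewrite N0 mule0].
- by move=> z /= Pz; split => //; exact: PN.
Qed.

End Fubini_real.

(** * Data and their inner product *)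

Section Data_space.
Context {R : realType}.
Notation mu := (@lebesgue_measure R).
Notation mu2 := (mu \x mu)%E.

Lemma I01E (x : R) : I01 x = (0 <= x <= 1 :> bool) :> Prop.
Proof. by rewrite /I01 /= in_itv. Qed.

Lemma measurable_I01 : measurable (@I01 R : set (measurableTypeR R)).
Proof. exact: measurable_itv. Qed.

Lemma I01_lty : (mu I01 < +oo)%E.
Proof. by rewrite /I01 lebesgue_measure_itv/= lte01 sube0 ltry. Qed.

Lemma measurable_sqD : measurable (@sqD R : set (measurableTypeR R * measurableTypeR R)).
Proof. by apply: measurableX; exact: measurable_I01. Qed.

Lemma sqD_lty : (mu2 sqD < +oo)%E.
Proof.
rewrite product_measure1E; [|exact: measurable_I01|exact: measurable_I01].
by rewrite lte_mul_pinfty// ?ge0_fin_numE// I01_lty.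
Qed.

(* A function y in W32 is determined by c = y_(xi eta)(0, 0), the functions
   u = y_(xi xi xi eta)(., 0) and v = y_(xi eta eta)(0, .), and
   w = y_(xi xi xi eta eta); the W32 inner product is the l2 sum of their
   inner products.  Here [None] stands for the extra point that carries the
   boundary datum, so that W32 is the tensor product of two spaces of functions
   on [option R].  All functions vanish outside [0, 1]. *)
Definition data : lmodType R := (option R * option R -> R^o)%type.

Definition data_c (d : data) : R := d (None, None).
Definition data_u (d : data) : R -> R := fun x => d (Some x, None).
Definition data_v (d : data) : R -> R := fun r => d (None, Some r).
Definition data_w (d : data) : R * R -> R := fun z => d (Some z.1, Some z.2).

Definition data_L2 (d : data) : Prop :=
  [/\ L2 mu I01 (data_u d), L2 mu I01 (data_v d) & L2 mu2 sqD (data_w d)].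

Definition data_ip (d e : data) : R :=
  data_c d * data_c e + \int[mu]_x (data_u d x * data_u e x) +
  \int[mu]_x (data_v d x * data_v e x) + \int[mu2]_z (data_w d z * data_w e z).

Lemma data_uD d e : data_u (d + e) = (fun x => data_u d x + data_u e x).
Proof. by []. Qed.
Lemma data_vD d e : data_v (d + e) = (fun x => data_v d x + data_v e x).
Proof. by []. Qed.
Lemma data_wD d e : data_w (d + e) = (fun x => data_w d x + data_w e x).
Proof. by []. Qed.
Lemma data_cD d e : data_c (d + e) = data_c d + data_c e.
Proof. by []. Qed.
Lemma data_uZ k d : data_u (k *: d) = (fun x => k * data_u d x).
Proof. by []. Qed.
Lemma data_vZ k d : data_v (k *: d) = (fun x => k * data_v d x).
Proof. by []. Qed.
Lemma data_wZ k d : data_w (k *: d) = (fun x => k * data_w d x).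
Proof. by []. Qed.
Lemma data_cZ k d : data_c (k *: d) = k * data_c d.
Proof. by []. Qed.
Lemma data_uB d e : data_u (d - e) = (fun x => data_u d x - data_u e x).
Proof. by []. Qed.
Lemma data_vB d e : data_v (d - e) = (fun x => data_v d x - data_v e x).
Proof. by []. Qed.
Lemma data_wB d e : data_w (d - e) = (fun x => data_w d x - data_w e x).
Proof. by []. Qed.
Lemma data_cB d e : data_c (d - e) = data_c d - data_c e.
Proof. by []. Qed.

Lemma RintDMl d (T : measurableType d) (m : {measure set T -> \bar R}) (D : set T)
    (f g h : T -> R) : L2 m D f -> L2 m D g -> L2 m D h ->
  \int[m]_x ((f x + g x) * h x) = \int[m]_x (f x * h x) + \int[m]_x (g x * h x).
Proof.
move=> F G H; rewrite -RintD; [|exact: L2M F H|exact: L2M G H].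
by apply: eq_Rintegral => x _; rewrite -mulrDl.
Qed.

Lemma RintZMl d (T : measurableType d) (m : {measure set T -> \bar R}) (D : set T)
    (k : R) (f h : T -> R) : L2 m D f -> L2 m D h ->
  \int[m]_x (k * f x * h x) = k * \int[m]_x (f x * h x).
Proof.
move=> F H; rewrite -RintZ; last exact: L2M F H.
by apply: eq_Rintegral => x _; rewrite -mulrA.
Qed.

Lemma data_preHilbert : is_preHilbert data_L2 data_ip.
Proof.
have mI := measurable_I01; have mD := measurable_sqD.
have If := I01_lty; have Df := sqD_lty.
split.
- by split; exact: L2_0.
- move=> d e [du dv dw] [eu ev ew]; split.
  + by rewrite data_uD; exact: L2D du eu.
  + by rewrite data_vD; exact: L2D dv ev.
  + by rewrite data_wD; exact: L2D dw ew.
- move=> k d [du dv dw]; split.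
  + by rewrite data_uZ; exact: L2Z.
  + by rewrite data_vZ; exact: L2Z.
  + by rewrite data_wZ; exact: L2Z.
- move=> d e; rewrite /data_ip mulrC; congr (_ + _ + _ + _);
    by under eq_Rintegral do rewrite mulrC.
- move=> d e f [du dv dw] [eu ev ew] [fu fv fw]; rewrite /data_ip.
  rewrite data_uD data_vD data_wD data_cD (RintDMl du eu fu) (RintDMl dv ev fv).
  by rewrite (RintDMl dw ew fw); lra.
- move=> k d f [du dv dw] [fu fv fw]; rewrite /data_ip.
  rewrite data_uZ data_vZ data_wZ data_cZ (RintZMl k du fu) (RintZMl k dv fv).
  by rewrite (RintZMl k dw fw); lra.
- move=> d; rewrite /data_ip -expr2 !addr_ge0 ?sqr_ge0//;
    by apply: Rintegral_ge0 => x _; rewrite -expr2 sqr_ge0.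
Qed.

Lemma data_ip_sqr (d : data) : data_ip d d = data_c d ^+ 2 +
  \int[mu]_x (data_u d x ^+ 2) + \int[mu]_x (data_v d x ^+ 2) +
  \int[mu2]_z (data_w d z ^+ 2).
Proof.
by rewrite /data_ip expr2; congr (_ + _ + _ + _);
  apply: eq_Rintegral => x _; rewrite expr2.
Qed.

(** The squared norm is a sum of four nonnegative terms, so each component is a Cauchy sequence by
    itself and has a limit by completeness of the reals or by [Riesz_Fischer]. *)
Lemma data_complete (u_ : nat -> data) : (forall n, data_L2 (u_ n)) ->
  (forall e, 0 < e -> exists N, forall n k, (N <= n)%N -> (N <= k)%N ->
     data_ip (u_ n - u_ k) (u_ n - u_ k) <= e) ->
  exists u, data_L2 u /\ data_ip (u_ n - u) (u_ n - u) @[n --> \oo] --> 0.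
Proof.
move=> Lu cauchy.
have i0 d (T : measurableType d) (m : {measure set T -> \bar R}) (f : T -> R) :
  0 <= \int[m]_x (f x ^+ 2) by apply: Rintegral_ge0 => x _; exact: sqr_ge0.
have C0 e : 0 < e -> exists N, forall n k, (N <= n)%N -> (N <= k)%N ->
   (data_c (u_ n) - data_c (u_ k)) ^+ 2 <= e.
  move=> /cauchy[N NP]; exists N => n k Nn Nk; apply: le_trans (NP _ _ Nn Nk).
  by rewrite data_ip_sqr -!addrA lerDl !addr_ge0.
have [c cc] : exists c : R, (fun n => data_c (u_ n) : R) @ \oo --> c.
  suff : cvgn (fun n => data_c (u_ n) : R) by move=> /cvg_ex.
  apply/cauchy_cvgP/cauchy_exP => e e0.
  have [|N NP] := C0 ((e / 2) ^+ 2); first by rewrite exprn_gt0// divr_gt0.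
  exists (data_c (u_ N)); exists N => // n /= Nn.
  have h : `|data_c (u_ N) - data_c (u_ n)| <= e / 2.
    rewrite -ler_sqr ?nnegrE ?normr_ge0 ?(divr_ge0 (ltW e0))//.
    by rewrite real_normK ?num_real//; exact: NP.
  by rewrite /ball /= /ball_; apply: (le_lt_trans h); lra.
have [|e /cauchy[N NP]|u [Lu' cu]] := @Riesz_Fischer _ _ R mu I01
    (fun n => data_u (u_ n)).
- by move=> n; have [] := Lu n.
- exists N => n k Nn Nk; apply: le_trans (NP _ _ Nn Nk).
  by rewrite data_ip_sqr -!addrA addrCA lerDl !addr_ge0 ?sqr_ge0.
have [|e /cauchy[N NP]|v [Lv' cv]] := @Riesz_Fischer _ _ R mu I01
    (fun n => data_v (u_ n)).
- by move=> n; have [] := Lu n.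
- exists N => n k Nn Nk; apply: le_trans (NP _ _ Nn Nk).
  by rewrite data_ip_sqr -addrA addrCA lerDl !addr_ge0 ?sqr_ge0.
have [|e /cauchy[N NP]|w [Lw' cw]] := @Riesz_Fischer _ _ R mu2 sqD
    (fun n => data_w (u_ n)).
- by move=> n; have [] := Lu n.
- exists N => n k Nn Nk; apply: le_trans (NP _ _ Nn Nk).
  by rewrite data_ip_sqr lerDr !addr_ge0 ?sqr_ge0.
pose U : data := fun z => match z with
  | (None, None) => c
  | (Some x, None) => u x
  | (None, Some r) => v r
  | (Some x, Some r) => w (x, r) end.
have Uw : data_w U = w by apply/funext => -[].
exists U; split; first by split => //; rewrite Uw.
have -> : (fun n => data_ip (u_ n - U) (u_ n - U)) =
  (fun n => (data_c (u_ n) - c) ^+ 2 +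
    \int[mu]_x ((data_u (u_ n) x - u x) ^+ 2) +
    \int[mu]_x ((data_v (u_ n) x - v x) ^+ 2) +
    \int[mu2]_z ((data_w (u_ n) z - w z) ^+ 2)).
  by apply/funext => n; rewrite data_ip_sqr data_uB data_vB data_wB data_cB Uw.
rewrite -[X in _ --> X]addr0; apply: cvgD cw.
rewrite -[X in _ --> X]addr0; apply: cvgD cv.
rewrite -[X in _ --> X]addr0; apply: cvgD cu.
have : (fun n => (data_c (u_ n) - c : R) ^+ 2) @ \oo --> ((0 : R) * 0).
  under eq_fun do rewrite expr2.
  by apply: cvgM; apply/subr_cvg0; exact: cc.
by rewrite mulr0.
Qed.

End Data_space.

Lemma ae_imp d (T : measurableType d) (R : realType)
    (m : {measure set T -> \bar R}) (P Q : T -> Prop) :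
  (forall x, P x -> Q x) -> {ae m, forall x, P x} -> {ae m, forall x, Q x}.
Proof. by move=> PQ; apply: filterS. Qed.

Lemma ae_imp2 d (T : measurableType d) (R : realType)
    (m : {measure set T -> \bar R}) (P P' Q : T -> Prop) :
  (forall x, P x -> P' x -> Q x) -> {ae m, forall x, P x} ->
  {ae m, forall x, P' x} -> {ae m, forall x, Q x}.
Proof. by move=> PQ; apply: filterS2. Qed.

(** * One-sided derivatives on the unit interval *)

Section Derivatives_on_the_unit_interval.
Context {R : realType}.
Implicit Types g h : R -> R.

Definition is_deriv01 g (x l : R) : Prop :=
  quot01 g x z @[z --> within I01 x^'] --> l.

Lemma within_I01_proper (x : R) : I01 x -> ProperFilter (within I01 x^').
Proof.
rewrite I01E => /andP[x0 x1]; split; last exact: within_filter.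
move=> [e /= e0 He].
have [m [m0 me m2]] : exists m : R, [/\ 0 < m, m < e & m <= 2^-1].
  exists (Num.min (e / 2) (2^-1 : R)); split.
  - by rewrite lt_min divr_gt0//= invr_gt0.
  - by rewrite gt_min ltr_pdivrMr// ltr_pMr// ltr1n.
  - by rewrite ge_min lexx orbT.
(* The point is moved towards the farther end of the interval; since m <= 1/2 it stays inside. *)
pose z := if x < 2^-1 then x + m else x - m.
have ez : `|x - z| < e.
  rewrite /z; case: ifP => _.
    by rewrite (_ : x - (x + m) = - m); [rewrite normrN gtr0_norm|ring].
  by rewrite (_ : x - (x - m) = m); [rewrite gtr0_norm|ring].
apply: (He z) => //; rewrite ?I01E /z.
  case: ifP => _; rewrite -subr_eq0.
    by rewrite (_ : x + m - x = m); [rewrite gt_eqF|ring].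
  by rewrite (_ : x - m - x = - m); [rewrite oppr_eq0 gt_eqF|ring].
by case: ltP => h; apply/andP; split; lra.
Qed.

Lemma is_deriv01E g x l : I01 x -> is_deriv01 g x l -> deriv01 g x = l.
Proof.
by move=> xI gl; have P := within_I01_proper xI; apply/cvg_lim.
Qed.

Lemma is_deriv01_derivable g x l : is_deriv01 g x l -> derivable01 g x.
Proof. by move=> gl; apply/cvg_ex; exists l. Qed.

Lemma is_deriv01_ext g h x l : (forall z, I01 z -> g z = h z) -> I01 x ->
  is_deriv01 g x l -> is_deriv01 h x l.
Proof.
move=> gh xI; apply: cvg_trans; apply: near_eq_cvg.
by rewrite near_withinE; apply: nearW => z zI; rewrite /quot01 !gh.
Qed.

Lemma deriv01_ext g h x : (forall z, I01 z -> g z = h z) -> I01 x ->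
  deriv01 g x = deriv01 h x.
Proof.
move=> gh xI; rewrite /deriv01 /lim; congr (get _).
apply/funext => l; apply/propext; split; apply: is_deriv01_ext => // z zI.
by rewrite gh.
Qed.

Lemma is_deriv01_derive g (x l : R) : is_derive x 1 g l -> is_deriv01 g x l.
Proof.
move=> [dg gl].
have := dg; rewrite /derivable => /cvg_ex[l' gl'].
have ll' : l' = l by rewrite -gl; apply/esym/cvg_lim.
move: gl'; rewrite ll' => gl'.
apply/cvgrPdist_lt => e e0; have /cvgrPdist_lt/(_ _ e0)[r /= r0 H] := gl'.
exists r => // z /= xz zx _.
have := H (z - x); rewrite /= sub0r normrN distrC subr_eq0 => /(_ xz zx).
by rewrite /quot01 /GRing.scale /= mulr1 subrK mulrC.
Qed.

(** Reduction to sequences, for which dominated convergence is available; this is how derivatives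
    are taken under the integral sign. *)
Lemma is_deriv01_seq g x l :
  (forall u : nat -> R, (forall n, I01 (u n) /\ u n != x) -> u @ \oo --> x ->
     quot01 g x (u n) @[n --> \oo] --> l) -> is_deriv01 g x l.
Proof.
move=> H; apply/cvgrPdist_lt => e e0; apply: contrapT => notnear.
have /choice[u uP] : forall n : nat, exists z, [/\ I01 z, z != x, `|x - z| < n.+1%:R^-1 &
    ~ (`|l - quot01 g x z| < e)].
  move=> n; apply: contrapT => no; apply: notnear.
  exists (n.+1%:R^-1); first by rewrite /= invr_gt0.
  move=> z /= xz zx zI; apply: contrapT => nz; apply: no.
  by exists z.
have ux : u @ \oo --> x.
  apply/cvgrPdist_lt => r r0; near=> n.
  have [_ _ h _] := uP n; apply: lt_trans h _.
  by near: n; exact: near_infty_natSinv_lt (PosNum r0).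
have /cvgrPdist_lt/(_ _ e0)[N _ /(_ N (leqnn N))] := H u
  (fun n => let: And4 a b _ _ := uP n in conj a b) ux.
by have [] := uP N.
Unshelve. all: by end_near. Qed.

Lemma is_deriv01_seqE g x l (u : nat -> R) : is_deriv01 g x l ->
  (forall n, I01 (u n) /\ u n != x) -> u @ \oo --> x ->
  quot01 g x (u n) @[n --> \oo] --> l.
Proof.
move=> gl uP ux; apply: cvg_comp gl => A [e /= e0 He].
have /cvgrPdist_lt/(_ _ e0)[N _ NP] := ux.
exists N => // n Nn /=; have [? ?] := uP n.
by apply: He => //; exact: NP.
Qed.

End Derivatives_on_the_unit_interval.

(** * Tensors of one-variable representers *)

Section Tensors.
Context {R : realType}.
Notation mu := (@lebesgue_measure R).
Notation mu2 := (mu \x mu)%E.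

(** One factor of the tensor product: functions for the measure that adds a unit mass at [None] to
    Lebesgue measure. *)
Definition rep : lmodType R := (option R -> R^o)%type.

Definition rep_ok (e : rep) : Prop :=
  [/\ measurable_fun setT (fun x => e (Some x) : R),
    forall x, ~ I01 x -> e (Some x) = 0 &
    exists K, forall o, `|e o : R| <= K].

Definition tens (e f : rep) : data := fun z => e z.1 * f z.2.

Definition rep_ip (e f : rep) : R :=
  e None * f None + \int[mu]_x (e (Some x) * f (Some x)).

Lemma rep_scaleE k (e : rep) o : (k *: e) o = k * (e o : R).
Proof. by []. Qed.

Lemma rep_okD e f : rep_ok e -> rep_ok f -> rep_ok (e + f).
Proof.
move=> [me Ie [K eK]] [mf If [M fM]]; split.
- exact: measurable_funD.
- by move=> x xI; rewrite /GRing.add/= Ie// If// addr0.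
- by exists (K + M) => o; rewrite (le_trans (ler_normD _ _))// lerD.
Qed.

Lemma rep_okZ k e : rep_ok e -> rep_ok (k *: e).
Proof.
move=> [me Ie [K eK]]; split.
- exact: measurable_funM.
- by move=> x xI; rewrite rep_scaleE Ie// mulr0.
- by exists (`|k| * K) => o; rewrite rep_scaleE normrM ler_wpM2l.
Qed.

Lemma rep_ok_L2 e : rep_ok e -> L2 mu I01 (fun x => e (Some x)).
Proof.
move=> [me Ie [K eK]].
by apply: (@L2_bounded _ _ R mu _ measurable_I01 I01_lty _ K).
Qed.

Lemma rep_ok_itg e : rep_ok e -> itg mu (fun x => e (Some x)).
Proof.
move=> /rep_ok_L2; apply: L2_itg; [exact: measurable_I01|exact: I01_lty].
Qed.

Lemma tensDl e e' f : tens (e + e') f = tens e f + tens e' f.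
Proof. by apply/funext => z; rewrite /tens /GRing.add/= mulrDl. Qed.

Lemma tensZl k e f : tens (k *: e) f = k *: tens e f.
Proof. by apply/funext => z; exact: (esym (mulrA _ _ _)). Qed.

Lemma tensDr e f f' : tens e (f + f') = tens e f + tens e f'.
Proof. by apply/funext => z; rewrite /tens /GRing.add/= mulrDr. Qed.

Lemma tensZr k e f : tens e (k *: f) = k *: tens e f.
Proof. by apply/funext => z; exact: (mulrCA (e z.1 : R) k (f z.2)). Qed.

Lemma tens_L2 e f : rep_ok e -> rep_ok f -> data_L2 (tens e f).
Proof.
move=> [me Ie [K eK]] [mf If [M fM]].
have b z : `|tens e f z : R| <= K * M by rewrite normrM ler_pM.
split.
- apply: (@L2_bounded _ _ R mu _ measurable_I01 I01_lty (data_u (tens e f)) (K * M));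
    last by move=> x; exact: b.
    by rewrite /data_u /tens /=; apply: measurable_funM.
  by move=> x xI; rewrite /data_u /tens/= Ie// mul0r.
- apply: (@L2_bounded _ _ R mu _ measurable_I01 I01_lty (data_v (tens e f)) (K * M));
    last by move=> x; exact: b.
    by rewrite /data_v /tens /=; apply: measurable_funM.
  by move=> x xI; rewrite /data_v /tens/= If// mulr0.
- apply: (@L2_bounded _ _ R mu2 _ measurable_sqD sqD_lty (data_w (tens e f)) (K * M));
    last by move=> x; exact: b.
    rewrite /data_w /tens /=; apply: measurable_funM.
      exact: (measurableT_comp me measurable_fst).
    exact: (measurableT_comp mf measurable_snd).
  move=> [x r] /= xI; rewrite /data_w /tens/=.
  have [xI'|] := pselect (I01 x); last by move=> /Ie ->; rewrite mul0r.
  by rewrite If ?mulr0// => rI; apply: xI; split.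
Qed.

Lemma tens_ip e f e' f' : rep_ok e -> rep_ok f -> rep_ok e' -> rep_ok f' ->
  data_ip (tens e f) (tens e' f') = rep_ip e e' * rep_ip f f'.
Proof.
move=> eo fo eo' fo'; rewrite /data_ip /rep_ip /data_c /data_u /data_v /data_w /tens/=.
have ie := L2M (rep_ok_L2 eo) (rep_ok_L2 eo').
have if_ := L2M (rep_ok_L2 fo) (rep_ok_L2 fo').
have -> : \int[mu]_x (e (Some x) * f None * (e' (Some x) * f' None)) =
  (f None * f' None) * \int[mu]_x (e (Some x) * e' (Some x)).
  rewrite -RintZ//; apply: eq_Rintegral => x _.
  by move: (e _ : R) (f _ : R) (e' _ : R) (f' _ : R) => a b c d; ring.
have -> : \int[mu]_x (e None * f (Some x) * (e' None * f' (Some x))) =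
  (e None * e' None) * \int[mu]_x (f (Some x) * f' (Some x)).
  rewrite -RintZ//; apply: eq_Rintegral => x _.
  by move: (e _ : R) (f _ : R) (e' _ : R) (f' _ : R) => a b c d; ring.
have -> : \int[mu2]_z (e (Some z.1) * f (Some z.2) * (e' (Some z.1) * f' (Some z.2))) =
  \int[mu]_x (e (Some x) * e' (Some x)) * \int[mu]_x (f (Some x) * f' (Some x)).
  rewrite -Rint_prod//; apply: eq_Rintegral => x _.
  by move: (e _ : R) (f _ : R) (e' _ : R) (f' _ : R) => a b c d; ring.
move: (Rintegral _ _ _) (Rintegral _ _ _) => I J.
by move: (e _ : R) (f _ : R) (e' _ : R) (f' _ : R) => a b c d; ring.
Qed.

(** Representers of the highest derivatives are step functions that jump at the evaluation point, so
    pointwise convergence is asked off a null set only; the uniform bound is there for dominated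
    convergence. *)
Definition rep_cvg (e_ : nat -> rep) (e : rep) : Prop :=
  [/\ forall n, rep_ok (e_ n), rep_ok e,
    (fun n => e_ n None : R) @ \oo --> (e None : R),
    {ae mu, forall x, (fun n => e_ n (Some x) : R) @ \oo --> (e (Some x) : R)} &
    exists K, forall n o, `|e_ n o : R| <= K].

Lemma rep_cvg_cst e : rep_ok e -> rep_cvg (fun=> e) e.
Proof.
move=> eo; split => //; first exact: cvg_cst.
  by apply: aeW => x; exact: cvg_cst.
by have [_ _ [K eK]] := eo; exists K.
Qed.

(** Dominated convergence in each component, with majorant K * M times the absolute value of the
    data, which is integrable because the domain has finite measure. *)
Lemma data_ip_tens_cvg d e_ f_ e f : data_L2 d -> rep_cvg e_ e -> rep_cvg f_ f ->
  data_ip d (tens (e_ n) (f_ n)) @[n --> \oo] --> data_ip d (tens e f).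
Proof.
move=> [du dv dw] [eo_ eo ce ae_e [K eK]] [fo_ fo cf ae_f [M fM]].
have mI := @measurable_I01 R; have mD := @measurable_sqD R.
have If := @I01_lty R; have Df := @sqD_lty R.
have idu := L2_itg mI If du; have idv := L2_itg mI If dv; have idw := L2_itg mD Df dw.
have me_ n : measurable_fun setT (fun x => e_ n (Some x) : R) by have [] := eo_ n.
have mf_ n : measurable_fun setT (fun x => f_ n (Some x) : R) by have [] := fo_ n.
have me : measurable_fun setT (fun x => e (Some x) : R) by have [] := eo.
have mf : measurable_fun setT (fun x => f (Some x) : R) by have [] := fo.
have b n x y : `|e_ n x * f_ n y : R| <= K * M by rewrite normrM ler_pM.
rewrite /data_ip.
apply: cvgD; last first.
  apply: (@Rint_cvg _ _ R mu2 (fun n z => data_w d z * data_w (tens (e_ n) (f_ n)) z)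
     (fun z => data_w d z * data_w (tens e f) z) (fun z => K * M * `|data_w d z|)).
  - move=> n; apply: measurable_funM; first exact: itg_measurable idw.
    apply: measurable_funM.
      exact: (measurableT_comp (me_ n) measurable_fst).
    exact: (measurableT_comp (mf_ n) measurable_snd).
  - apply: measurable_funM; first exact: itg_measurable idw.
    apply: measurable_funM.
      exact: (measurableT_comp me measurable_fst).
    exact: (measurableT_comp mf measurable_snd).
  - have A := @ae_fst _ _ _ _ R mu mu _ ae_e.
    have B := @ae_snd _ _ _ _ R mu mu _ ae_f.
    apply: ae_imp2 A B => z ez fz.
    by apply: cvgM; [exact: cvg_cst|exact: cvgM].
  - exact/itgZ/itg_abs.
  - by move=> n z; rewrite normrM mulrC ler_wpM2r//; exact: b.
apply: cvgD; last first.
  apply: (@Rint_cvg _ _ R mu (fun n z => data_v d z * data_v (tens (e_ n) (f_ n)) z)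
     (fun z => data_v d z * data_v (tens e f) z) (fun z => K * M * `|data_v d z|)).
  - move=> n; apply: measurable_funM; first exact: itg_measurable idv.
    exact: (measurable_funM (measurable_cst (e_ n None : R)) (mf_ n)).
  - apply: measurable_funM; first exact: itg_measurable idv.
    exact: (measurable_funM (measurable_cst (e None : R)) mf).
  - apply: ae_imp ae_f => z fz.
    by apply: cvgM; [exact: cvg_cst|exact: cvgM].
  - exact/itgZ/itg_abs.
  - by move=> n z; rewrite normrM mulrC ler_wpM2r//; exact: b.
apply: cvgD; last first.
  apply: (@Rint_cvg _ _ R mu (fun n z => data_u d z * data_u (tens (e_ n) (f_ n)) z)
     (fun z => data_u d z * data_u (tens e f) z) (fun z => K * M * `|data_u d z|)).
  - move=> n; apply: measurable_funM; first exact: itg_measurable idu.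
    exact: (measurable_funM (me_ n) (measurable_cst (f_ n None : R))).
  - apply: measurable_funM; first exact: itg_measurable idu.
    exact: (measurable_funM me (measurable_cst (f None : R))).
  - apply: ae_imp ae_e => z fz.
    by apply: cvgM; [exact: cvg_cst|exact: cvgM].
  - exact/itgZ/itg_abs.
  - by move=> n z; rewrite normrM mulrC ler_wpM2r//; exact: b.
by apply: cvgM; [exact: cvg_cst|exact: cvgM].
Qed.

(** The Lipschitz condition bounds the difference quotients uniformly, so that they converge in the
    sense of [rep_cvg] along every sequence tending to x. *)
Definition rep_deriv (e : R -> rep) (x : R) (e' : rep) : Prop :=
  [/\ forall z, I01 z -> rep_ok (e z), rep_ok e',
    exists K, forall z o, I01 z -> `|e z o - e x o : R| <= K * `|z - x|,
    is_deriv01 (fun z => e z None) x (e' None) &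
    {ae mu, forall s, is_deriv01 (fun z => e z (Some s)) x (e' (Some s))}].

Lemma rep_deriv_cvg e x e' (u : nat -> R) : I01 x -> rep_deriv e x e' ->
  (forall n, I01 (u n) /\ u n != x) -> u @ \oo --> x ->
  rep_cvg (fun n => (u n - x)^-1 *: (e (u n) - e x)) e'.
Proof.
move=> xI [eo eo' [K eK] eN eS] uP ux; split => //.
- move=> n; have [uI _] := uP n; apply: rep_okZ; rewrite -scaleN1r.
  by apply: rep_okD; [exact: eo|exact/rep_okZ/eo].
- have := is_deriv01_seqE eN uP ux; apply: cvg_trans; apply: near_eq_cvg.
  by apply: nearW => n; rewrite /quot01 mulrC.
- apply: ae_imp eS => s es.
  have := is_deriv01_seqE es uP ux; apply: cvg_trans; apply: near_eq_cvg.
  by apply: nearW => n; rewrite /quot01 mulrC.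
- exists K => n o; have [uI ux'] := uP n.
  have nz : 0 < `|u n - x| by rewrite normr_gt0 subr_eq0.
  rewrite normrM normfV mulrC ler_pdivrMr//; exact: eK.
Qed.

Lemma is_deriv01_tens_l d e f x e' : data_L2 d -> I01 x -> rep_deriv e x e' ->
  rep_ok f -> is_deriv01 (fun z => data_ip d (tens (e z) f)) x (data_ip d (tens e' f)).
Proof.
move=> Ld xI de fo; apply: is_deriv01_seq => u uP ux.
have P := @data_preHilbert R.
have c := data_ip_tens_cvg Ld (rep_deriv_cvg xI de uP ux) (rep_cvg_cst fo).
apply: cvg_trans c; apply: near_eq_cvg; apply: nearW => n.
have [eo _ _ _ _] := de; have [uI _] := uP n.
have d1 := tens_L2 (eo _ uI) fo; have d2 := tens_L2 (eo _ xI) fo.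
rewrite /quot01 tensZl -scaleN1r tensDl tensZl (ipZr P)//; last first.
  by apply: (domD P) => //; exact: (domZ P).
by rewrite (ipDr P)// ?(ipZr P)//; [rewrite mulN1r mulrC|exact: (domZ P)].
Qed.

Lemma is_deriv01_tens_r d e f x e' : data_L2 d -> I01 x -> rep_deriv e x e' ->
  rep_ok f -> is_deriv01 (fun z => data_ip d (tens f (e z))) x (data_ip d (tens f e')).
Proof.
move=> Ld xI de fo; apply: is_deriv01_seq => u uP ux.
have P := @data_preHilbert R.
have c := data_ip_tens_cvg Ld (rep_cvg_cst fo) (rep_deriv_cvg xI de uP ux).
apply: cvg_trans c; apply: near_eq_cvg; apply: nearW => n.
have [eo _ _ _ _] := de; have [uI _] := uP n.
have d1 := tens_L2 fo (eo _ uI); have d2 := tens_L2 fo (eo _ xI).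
rewrite /quot01 tensZr -scaleN1r tensDr tensZr (ipZr P)//; last first.
  by apply: (domD P) => //; exact: (domZ P).
by rewrite (ipDr P)// ?(ipZr P)//; [rewrite mulN1r mulrC|exact: (domZ P)].
Qed.

(** Partial pairing in the first variable. The resulting density is integrable but in general
    unbounded, so [rep_ok] cannot be expected of it. *)
Definition contr (d : data) (e : rep) : rep := fun o => match o with
  | None => data_c d * e None + \int[mu]_x (data_u d x * e (Some x))
  | Some r => data_v d r * e None + \int[mu]_x (data_w d (x, r) * e (Some x))
  end.

Lemma itg_data_w_rep d e : data_L2 d -> rep_ok e ->
  itg mu2 (fun z => data_w d z * e (Some z.1)).
Proof.
move=> [_ _ dw] [me _ [K eK]].
apply: (@itg_bounded_mul _ _ _ _ _ _ K) => //.
  by apply: L2_itg dw; [exact: measurable_sqD|exact: sqD_lty].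
exact: (measurableT_comp me measurable_fst).
Qed.

Lemma itg_contr d e : data_L2 d -> rep_ok e ->
  itg mu (fun r => contr d e (Some r)).
Proof.
move=> Ld eo; have [_ dv _] := Ld; apply: itgD.
  have := itgZ (e None) (L2_itg measurable_I01 I01_lty dv).
  by congr itg; apply/funext => x; rewrite mulrC.
exact: itg_Fubini2 (itg_data_w_rep Ld eo).
Qed.

Lemma data_ip_contr d e f : data_L2 d -> rep_ok e -> rep_ok f ->
  data_ip d (tens e f) = rep_ip (contr d e) f.
Proof.
move=> Ld eo fo; have [du dv dw] := Ld.
have Le := rep_ok_L2 eo; have Lf := rep_ok_L2 fo.
have [mf _ [K fK]] := fo; have iwe := itg_data_w_rep Ld eo.
rewrite /data_ip /rep_ip /=.
have -> : \int[mu]_x (data_u d x * data_u (tens e f) x) =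
    f None * \int[mu]_x (data_u d x * e (Some x)).
  rewrite -RintZ; last exact: L2M du Le.
  by apply: eq_Rintegral => x _; rewrite /data_u /tens /=;
    move: (d _ : R) (e _ : R) (f _ : R) => a b c; ring.
have -> : \int[mu]_x (data_v d x * data_v (tens e f) x) =
    \int[mu]_x (data_v d x * e None * f (Some x)).
  by apply: eq_Rintegral => x _; rewrite /data_v /tens /= mulrA.
have -> : \int[mu2]_z (data_w d z * data_w (tens e f) z) =
    \int[mu]_r (\int[mu]_x (data_w d (x, r) * e (Some x)) * f (Some r)).
  transitivity (\int[mu2]_z (data_w d z * e (Some z.1) * f (Some z.2))).
    by apply: eq_Rintegral => x _; rewrite {2}/data_w /tens /= mulrA.
  rewrite Rint_Fubini2; last first.
    by apply: (@itg_bounded_mul _ _ _ _ _ _ K) => //;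
      exact: (measurableT_comp mf measurable_snd).
  apply: ae_eq_Rintegral; apply: ae_imp (itg_section2 iwe) => r ir _ /=.
  by rewrite mulrC -RintZ//; apply: eq_Rintegral => x _; rewrite mulrC.
have i1 : itg mu (fun r => data_v d r * e None * f (Some r)).
  have := itgZ (e None) (L2M dv Lf).
  by congr itg; apply/funext => x; rewrite mulrCA mulrA.
have i2 : itg mu (fun r => \int[mu]_x (data_w d (x, r) * e (Some x)) * f (Some r)).
  by apply: (@itg_bounded_mul _ _ _ _ _ _ K) => //; exact: itg_Fubini2 iwe.
have -> : \int[mu]_x ((data_v d x * e None +
     \int[mu]_x0 (data_w d (x0, x) * e (Some x0))) * f (Some x)) =
   \int[mu]_r (data_v d r * e None * f (Some r)) +
   \int[mu]_r (\int[mu]_x (data_w d (x, r) * e (Some x)) * f (Some r)).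
  by rewrite -RintD//; apply: eq_Rintegral => x _; rewrite mulrDl.
rewrite /data_c /tens /=; move: (Rintegral _ _ _) (Rintegral _ _ _) (Rintegral _ _ _).
by move: (d _ : R) (e _ : R) (f _ : R) => a b c I J L; ring.
Qed.

End Tensors.

(** * Representers of point evaluations *)

Section Kernel_sections.
Context {R : realType}.
Notation mu := (@lebesgue_measure R).

Lemma ae_neq (x : R) : {ae mu, forall s, s != x}.
Proof.
exists [set x]; split; [exact: measurable_set1|exact: lebesgue_measure_set1|].
by move=> s /= /negP; rewrite negbK => /eqP.
Qed.

(** For fixed s different from x, the densities of [rep_x0], [rep_x1] and [rep_t0] are, near x,
    polynomials of degree at most 2 in the evaluation point. *)
Lemma is_deriv01_quadratic (g : R -> R) (x a b c l : R) :
  (\forall z \near x, g z = a * z ^+ 2 + b * z + c) -> l = 2 * a * x + b ->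
  is_deriv01 g x l.
Proof.
move=> gq ->; have gx := nbhs_singleton gq.
have C : a * (z + x) + b @[z --> x] --> 2 * a * x + b.
  rewrite (_ : 2 * a * x + b = a * (x + x) + b); last by ring.
  apply: cvgD; last exact: cvg_cst.
  apply: cvgM; first exact: cvg_cst.
  by apply: cvgD; [exact: cvg_id|exact: cvg_cst].
have C' : a * (z + x) + b @[z --> within I01 x^'] --> 2 * a * x + b.
  apply: cvg_trans C; apply: cvg_app => A Ax.
  by rewrite /within /=; apply: filterS Ax => z Az _ _.
apply: cvg_trans C'; apply: near_eq_cvg; rewrite near_withinE near_withinE.
apply: filterS gq => z gz zx _; rewrite /quot01 gz gx.
by field; rewrite subr_eq0.
Qed.

Lemma is_deriv01_quadraticT (g : R -> R) (x a b c l : R) :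
  (forall z, g z = a * z ^+ 2 + b * z + c) -> l = 2 * a * x + b ->
  is_deriv01 g x l.
Proof.
by move=> gq; apply: (@is_deriv01_quadratic _ _ _ _ c); near=> z.
Unshelve. all: by end_near. Qed.

Definition step (x s : R) : R := (s < x)%R%:R.

Lemma measurable_step x : measurable_fun setT (step x).
Proof.
have -> : step x = \1_(`]-oo, x[) by apply/funext => s; rewrite indicE /step mem_setE in_itv.
exact: measurable_indic.
Qed.

Lemma step_near (x s : R) : s != x -> \forall z \near x, step z s = step x s.
Proof.
move=> sx; exists `|x - s|; first by rewrite /= normr_gt0 subr_eq0 eq_sym.
move=> z /=; rewrite /step; have [h1|h1] := ltP s x; have [h2|h2] := ltP s z => //.
  by rewrite ger0_norm ?gtr0_norm; lra.
by rewrite ltr0_norm ?ler0_norm; lra.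
Qed.

Definition mkrep (c : R) (g : R -> R) : rep :=
  fun o => if o is Some s then \1_I01 s * g s else c.

Lemma mkrep_bound (c : R) (g : R -> R) (K : R) : `|c| <= K ->
  (forall s, I01 s -> `|g s| <= K) -> forall o, `|mkrep c g o : R| <= K.
Proof.
move=> cK gK [s|] //=; rewrite indicE.
have [sI|sI] := boolP (s \in I01); first by rewrite mul1r gK//; rewrite inE in sI.
by rewrite mul0r normr0 (le_trans _ cK).
Qed.

Lemma mkrep_ok (c : R) (g : R -> R) (K : R) : measurable_fun setT g ->
  (forall s, I01 s -> `|g s| <= K) -> rep_ok (mkrep c g).
Proof.
move=> mg gK; split.
- by apply: measurable_funM => //; apply: measurable_indic; exact: measurable_I01.
- by move=> s sI; rewrite /= indicE memNset ?mul0r.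
- exists (Num.max `|c| K); apply: mkrep_bound; first by rewrite le_max lexx.
  by move=> s sI; rewrite le_max gK ?orbT.
Qed.

Lemma mkrep_cvg (c : R -> R) (g : R -> R -> R) (K x : R) (u : nat -> R) :
  I01 x -> (forall z, I01 z -> measurable_fun setT (g z)) ->
  (forall z, I01 z -> `|c z| <= K) ->
  (forall z s, I01 z -> I01 s -> `|g z s| <= K) ->
  (c (u n) @[n --> \oo] --> c x) ->
  (forall s, I01 s -> s != x -> g (u n) s @[n --> \oo] --> g x s) ->
  (forall n, I01 (u n)) ->
  rep_cvg (fun n => mkrep (c (u n)) (g (u n))) (mkrep (c x) (g x)).
Proof.
move=> xI mg cK gK cc cg uI; split => //.
- by move=> n; apply: (@mkrep_ok _ _ K) => *; [exact: mg|exact: gK].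
- by apply: (@mkrep_ok _ _ K) => *; [exact: mg|exact: gK].
- apply: ae_imp (ae_neq x) => s sx /=; rewrite indicE.
  have [sI|sI] := boolP (s \in I01).
    by rewrite inE in sI; apply: cvgM; [exact: cvg_cst|exact: cg].
  by rewrite mul0r; under eq_fun do rewrite mul0r; exact: cvg_cst.
- by exists K => n o; apply: mkrep_bound => *; [exact: cK|exact: gK].
Qed.

Lemma mkrep_deriv (c : R -> R) (g : R -> R -> R) (c' : R) (g' : R -> R) (K x : R) :
  I01 x -> (forall z, I01 z -> measurable_fun setT (g z)) -> measurable_fun setT g' ->
  (forall z s, I01 z -> I01 s -> `|g z s| <= K) ->
  (forall s, I01 s -> `|g' s| <= K) ->
  (forall z, I01 z -> `|c z - c x| <= K * `|z - x|) ->
  (forall z s, I01 z -> I01 s -> `|g z s - g x s| <= K * `|z - x|) ->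
  is_deriv01 c x c' ->
  (forall s, s != x -> is_deriv01 (g ^~ s) x (g' s)) ->
  rep_deriv (fun z => mkrep (c z) (g z)) x (mkrep c' g').
Proof.
move=> xI mg mg' gK gK' cL gL dc dg; split => //.
- by move=> z zI; apply: (@mkrep_ok _ _ K) => *; [exact: mg|exact: gK].
- exact: (@mkrep_ok _ _ K).
- exists K => z o zI.
  have -> : (mkrep (c z) (g z) o - mkrep (c x) (g x) o : R) =
    mkrep (c z - c x) (fun s => g z s - g x s) o by case: o => //= s; rewrite mulrBr.
  by apply: mkrep_bound => *; [exact: cL|exact: gL].
- apply: ae_imp (ae_neq x) => s sx /=.
  have := dg _ sx; rewrite /is_deriv01 => h.
  have : \1_I01 s * quot01 (g ^~ s) x z @[z --> within I01 x^'] --> \1_I01 s * g' s.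
    have F := within_I01_proper xI.
    by apply: cvgM; [exact: cvg_cst|exact: h].
  apply: cvg_trans; apply: near_eq_cvg; apply: nearW => z.
  by rewrite /quot01 mulrA mulrBr.
Qed.

(* If g vanishes at 0 and 1, then g(x) is the pairing of [rep_x0 x] with
   (g'(0), g''') by Taylor's formula, the term g''(0) x^2 / 2 being eliminated
   with g(1) = 0.  Likewise g(t) is the pairing of [rep_t0 t] with (g'(0), g'')
   if g(0) = 0.  The others are derivatives with respect to the point. *)
Definition rep_x0 (x : R) : rep := mkrep (x - x ^+ 2)
  (fun s => (x - s) ^+ 2 / 2 * step x s - x ^+ 2 * ((1 - s) ^+ 2 / 2)).
Definition rep_x1 (x : R) : rep := mkrep (1 - 2 * x)
  (fun s => (x - s) * step x s - x * (1 - s) ^+ 2).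
Definition rep_x2 (x : R) : rep := mkrep (- 2)
  (fun s => step x s - (1 - s) ^+ 2).
Definition rep_t0 (t : R) : rep := mkrep t (fun r => (t - r) * step t r).
Definition rep_t1 (t : R) : rep := mkrep 1 (step t).

Lemma measurable_truncated (k : nat) (a x : R) :
  measurable_fun setT (fun s : R => (x - s) ^+ k / a * step x s).
Proof.
apply: measurable_funM; last exact: measurable_step.
apply: measurable_funM => //; apply: measurable_funX.
exact: measurable_funB.
Qed.

Lemma step01 x s : 0 <= step x s <= 1.
Proof. by rewrite /step; case: ltP => _; rewrite ?lexx ?ler01. Qed.

Lemma truncated_lipschitz (x z s : R) :
  `|(z - s) * step z s - (x - s) * step x s| <= `|z - x|.
Proof.
rewrite /step; case: (ltP s z) => h1; case: (ltP s x) => h2;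
  rewrite ?mulr1 ?mulr0 ?subr0 ?sub0r ?normrN ?normr0 //.
- by rewrite opprB addrA subrK.
- by rewrite !ger0_norm; lra.
- by rewrite (ler0_norm (_ : z - x <= 0)) ?ger0_norm; lra.
Qed.

Lemma truncated_sqr_lipschitz (x z s : R) : I01 x -> I01 z -> I01 s ->
  `|(z - s) ^+ 2 * step z s - (x - s) ^+ 2 * step x s| <= 2 * `|z - x|.
Proof.
rewrite !I01E => /andP[x0 x1] /andP[z0 z1] /andP[s0 s1].
wlog zx : x z x0 x1 z0 z1 / x <= z.
  move=> H; have [/H|/ltW zx] := leP x z; first exact.
  by rewrite distrC (distrC z); exact: H.
rewrite (ger0_norm (_ : 0 <= z - x)) ?subr_ge0// ler_norml /step.
by case: (ltP s z) => h1; case: (ltP s x) => h2; rewrite ?mulr1 ?mulr0; nra.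
Qed.

Lemma truncated_sqr01 (z s : R) : I01 z -> I01 s ->
  0 <= (z - s) ^+ 2 * step z s <= 1.
Proof.
rewrite !I01E => /andP[z0 z1] /andP[s0 s1]; rewrite /step; case: ltP => h.
  by rewrite mulr1; apply/andP; split; nra.
by rewrite mulr0 lexx ler01.
Qed.

(** The truncated square contributes at most 1 and the correction term at most 2 to the Lipschitz
    constant; 4 serves as common constant for all estimates on [rep_x0] and [rep_x1]. *)
Lemma rep_x0_fun_lipschitz (x z s : R) : I01 x -> I01 z -> I01 s ->
  `|(z - s) ^+ 2 / 2 * step z s - z ^+ 2 * ((1 - s) ^+ 2 / 2) -
   ((x - s) ^+ 2 / 2 * step x s - x ^+ 2 * ((1 - s) ^+ 2 / 2))| <= 4 * `|z - x|.
Proof.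
move=> xI zI sI; have L := truncated_sqr_lipschitz xI zI sI.
  have -> : (z - s) ^+ 2 / 2 * step z s - z ^+ 2 * ((1 - s) ^+ 2 / 2) -
   ((x - s) ^+ 2 / 2 * step x s - x ^+ 2 * ((1 - s) ^+ 2 / 2)) =
   2^-1 * ((z - s) ^+ 2 * step z s - (x - s) ^+ 2 * step x s) +
   (x - z) * ((z + x) * (1 - s) ^+ 2 / 2) by field.
  apply: le_trans (ler_normD _ _) _; rewrite (normrM 2^-1) (normrM (x - z)) (distrC x z).
  have : `|(z + x) * (1 - s) ^+ 2 / 2| <= 2.
    move: xI zI sI; rewrite !I01E => /andP[x0 x1] /andP[z0 z1] /andP[s0 s1].
    by rewrite ler_norml; apply/andP; split; nra.
  rewrite (ger0_norm (_ : (0 : R) <= 2^-1)) ?invr_ge0//.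
  by move=> h; have := ler_wpM2l (normr_ge0 (z - x)) h; move: L (normr_ge0 (z - x)); lra.
Qed.

Lemma rep_x0_const_lipschitz (x z : R) : I01 x -> I01 z ->
  `|z - z ^+ 2 - (x - x ^+ 2)| <= 4 * `|z - x|.
Proof.
rewrite !I01E => /andP[z0 z1] /andP[s0 s1].
have -> : z - z ^+ 2 - (x - x ^+ 2) = (z - x) * (1 - z - x) by ring.
by rewrite normrM mulrC ler_wpM2r// ler_norml; lra.
Qed.

Lemma rep_x0_lipschitz (x z : R) o : I01 x -> I01 z ->
  `|rep_x0 z o - rep_x0 x o : R| <= 4 * `|z - x|.
Proof.
move=> xI zI; case: o => [s|] /=; last exact: rep_x0_const_lipschitz.
rewrite -mulrBr indicE; have [sI|_] := boolP (s \in I01).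
  by rewrite mul1r; apply: rep_x0_fun_lipschitz => //; rewrite inE in sI.
by rewrite mul0r normr0 mulr_ge0.
Qed.

Lemma rep_x0_deriv x : I01 x -> rep_deriv rep_x0 x (rep_x1 x).
Proof.
move=> xI; apply: (@mkrep_deriv _ _ _ _ 4) => //.
- move=> z _; apply: measurable_funB; first exact: measurable_truncated.
  apply: measurable_funM => //; apply: measurable_funM => //.
  by apply: measurable_funX; exact: measurable_funB.
- apply: measurable_funB.
    by apply: measurable_funM; [exact: measurable_funB|exact: measurable_step].
  apply: measurable_funM => //.
  by apply: measurable_funX; exact: measurable_funB.
- move=> z s zI sI; have /andP[A0 A1] := truncated_sqr01 zI sI.
  have /andP[B0 B1] : 0 <= z ^+ 2 * (1 - s) ^+ 2 <= 1.
    move: zI sI; rewrite !I01E => /andP[z0 z1] /andP[s0 s1].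
    by rewrite mulr_ge0 ?sqr_ge0//= mulr_ile1 ?sqr_ge0// exprn_ile1//; lra.
  by rewrite ler_norml; apply/andP; split; lra.
- move=> s; move: xI; rewrite !I01E => /andP[z0 z1] /andP[s0 s1].
  have := step01 x s.
  by rewrite ler_norml => /andP[a b]; apply/andP; split; nra.
- by move=> z zI; exact: rep_x0_const_lipschitz.
- by move=> z s zI sI; exact: rep_x0_fun_lipschitz.
- by apply: (@is_deriv01_quadraticT _ _ (-1) 1 0); [move=> z; ring|ring].
- move=> s sx.
  apply: (@is_deriv01_quadratic _ _ (step x s / 2 - (1 - s) ^+ 2 / 2)
    (- s * step x s) (s ^+ 2 / 2 * step x s)); last by field.
  by apply: filterS (step_near sx) => z ->; field.
Qed.

Lemma rep_x1_deriv x : I01 x -> rep_deriv rep_x1 x (rep_x2 x).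
Proof.
move=> xI; apply: (@mkrep_deriv _ _ _ _ 4) => //.
- move=> z _; apply: measurable_funB.
    by apply: measurable_funM; [exact: measurable_funB|exact: measurable_step].
  apply: measurable_funM => //.
  by apply: measurable_funX; exact: measurable_funB.
- apply: measurable_funB; first exact: measurable_step.
  by apply: measurable_funX; exact: measurable_funB.
- move=> z s; rewrite !I01E => /andP[z0 z1] /andP[s0 s1].
  have := step01 z s.
  by rewrite ler_norml => /andP[a b]; apply/andP; split; nra.
- move=> s; rewrite !I01E => /andP[s0 s1].
  have := step01 x s.
  by rewrite ler_norml => /andP[a b]; apply/andP; split; nra.
- move=> z _; have -> : 1 - 2 * z - (1 - 2 * x) = - 2 * (z - x) by ring.
  by rewrite normrM normrN ler_wpM2r// ger0_norm// ler_nat.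
- move=> z s zI sI; have L := truncated_lipschitz x z s.
  have -> : (z - s) * step z s - z * (1 - s) ^+ 2 -
   ((x - s) * step x s - x * (1 - s) ^+ 2) =
   ((z - s) * step z s - (x - s) * step x s) +
   (x - z) * (1 - s) ^+ 2 by ring.
  apply: le_trans (ler_normD _ _) _; rewrite (normrM (x - z)) (distrC x z).
  have : `|(1 - s) ^+ 2| <= 1.
    move: sI; rewrite !I01E => /andP[s0 s1].
    by rewrite ler_norml; apply/andP; split; nra.
  by move=> h; have := ler_wpM2l (normr_ge0 (z - x)) h; move: L (normr_ge0 (z - x)); lra.
- by apply: (@is_deriv01_quadraticT _ _ 0 (-2) 1); [move=> z; ring|ring].
- move=> s sx.
  apply: (@is_deriv01_quadratic _ _ 0 (step x s - (1 - s) ^+ 2)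
    (- s * step x s)); last by ring.
  by apply: filterS (step_near sx) => z ->; ring.
Qed.

Lemma rep_t0_deriv t : I01 t -> rep_deriv rep_t0 t (rep_t1 t).
Proof.
move=> tI; apply: (@mkrep_deriv _ _ _ _ 1) => //.
- move=> z _.
  by apply: measurable_funM; [exact: measurable_funB|exact: measurable_step].
- exact: measurable_step.
- move=> z s; rewrite !I01E => /andP[z0 z1] /andP[s0 s1].
  have := step01 z s.
  by rewrite ler_norml => /andP[a b]; apply/andP; split; nra.
- by move=> s _; have /andP[a b] := step01 t s; rewrite ger0_norm.
- by move=> z _; rewrite mul1r.
- by move=> z s _ _; rewrite mul1r; exact: truncated_lipschitz.
- by apply: (@is_deriv01_quadraticT _ _ 0 1 0); [move=> z; ring|ring].
- move=> s st.
  apply: (@is_deriv01_quadratic _ _ 0 (step t s) (- s * step t s)); last by ring.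
  by apply: filterS (step_near st) => z ->; ring.
Qed.

Lemma rep_x0_ok x : I01 x -> rep_ok (rep_x0 x).
Proof. by move=> xI; have [/(_ _ xI)] := rep_x0_deriv xI. Qed.

Lemma rep_x1_ok x : I01 x -> rep_ok (rep_x1 x).
Proof. by move=> xI; have [/(_ _ xI)] := rep_x1_deriv xI. Qed.

Lemma rep_x2_ok x : I01 x -> rep_ok (rep_x2 x).
Proof. by move=> xI; have [] := rep_x1_deriv xI. Qed.

Lemma rep_t0_ok t : I01 t -> rep_ok (rep_t0 t).
Proof. by move=> tI; have [/(_ _ tI)] := rep_t0_deriv tI. Qed.

Lemma rep_t1_ok t : I01 t -> rep_ok (rep_t1 t).
Proof. by move=> tI; have [] := rep_t0_deriv tI. Qed.

End Kernel_sections.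

(** Absolute continuity of the integral, applied to the union of the sets. In this form it yields
    absolute continuity both on the interval and, with rectangles as sets, on the square. *)
Lemma sum_Rint_small d (T : measurableType d) (R : realType)
    (m : {measure set T -> \bar R}) (f : T -> R) : itg m f ->
  forall e, 0 < e -> exists2 r : R, 0 < r &
  forall (n : nat) (A : 'I_n -> set T) (a : 'I_n -> R),
    (forall i, measurable (A i)) -> trivIset setT A ->
    (forall i, m (A i) = (a i)%:E) -> \sum_(i < n) a i < r ->
    \sum_(i < n) `|\int[m]_(x in A i) f x| < e.
Proof.
move=> F e e0; have [r [r0 rP]] := integral_normr_continuous F e0.
exists r => // n A a mA tA Aa ar.
pose D := \big[setU/set0]_(i <- index_enum 'I_n) A i.
have mD : measurable D by apply: bigsetU_measurable.
have := rP D mD; rewrite /D measure_bigsetU_ord//.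
rewrite (eq_bigr (fun i => (a i)%:E)); last by move=> i _; exact: Aa.
rewrite sumEFin lte_fin => /(_ ar); apply: le_lt_trans.
have iA i : m.-integrable (A i) (EFin \o f).
  exact: (integrableS measurableT).
have -> : \int[m]_(x in \big[setU/set0]_(i < n) A i) `|f x| =
    \sum_(i < n) \int[m]_(x in A i) `|f x|.
  rewrite /Rintegral integral_bigsetU_EFin//.
  - rewrite [in LHS](eq_bigr (fun i => (\int[m]_(x in A i) `|f x|)%:E)).
      by rewrite sumEFin.
    move=> i _; rewrite /Rintegral fineK//; apply: integrable_fin_num => //.
    exact: (integrable_abse (iA i)).
  - exact: index_enum_uniq.
  - by apply: sub_trivIset tA.
  - apply/measurable_funTS/measurable_EFinP; apply: measurableT_comp => //.
    exact: itg_measurable F.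
by apply: ler_sum => i _; exact: le_normr_Rintegral.
Qed.

(** * Differentiation of primitives almost everywhere *)

Section Boundary_and_sections.
Context {R : realType}.
Notation mu := (@lebesgue_measure R).
Notation mu2 := (mu \x mu)%E.

(** An enumeration of the rationals, with those outside [0, 1] replaced by 0. Countability lets the
    statements at these points share one null set. *)
Lemma dense_sequence_I01 : exists rho : nat -> R, (forall n, I01 (rho n)) /\
  forall x e, I01 x -> 0 < e -> exists n, `|x - rho n| < e.
Proof.
pose rho (n : nat) : R := match unpickle n with
  | Some q => if 0 <= (ratr q : R) <= 1 then (ratr q : R) else 0
  | None => 0 end.
exists rho; split => [n|x e].
  rewrite I01E /rho; case: (unpickle n) => [q|]; last by rewrite lexx ler01.
  by case: ifP => //; rewrite lexx ler01.
rewrite I01E => /andP[x0 x1] e0.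
have [|q] := @rat_in_itvoo _ (Num.max 0 (x - e)) (Num.min 1 (x + e)).
  by rewrite lt_min !gt_max ltr01/=; apply/andP; split; [|apply/andP; split]; lra.
rewrite in_itv/= gt_max lt_min => /andP[/andP[q0 qx] /andP[q1 xq]].
exists (pickle q); rewrite /rho pickleK (ltW q0) (ltW q1) /= ltr_norml; lra.
Qed.

(** Lebesgue's differentiation theorem: off s = t the factor [step t s] is the indicator of ]-oo,
    t]. *)
Lemma ae_derive_prim (q : R -> R) : itg mu q ->
  {ae mu, forall t : R, is_derive t 1 (fun t => \int[mu]_s (q s * step t s)) (q t)}.
Proof.
move=> Q; have FE : (fun x => \int[mu]_(t in `]-oo, x]) q t) =
    (fun t => \int[mu]_s (q s * step t s)).
  apply/funext => t; rewrite Rintegral_mkcond; apply: ae_eq_Rintegral.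
  apply: ae_imp (ae_neq t) => s st _; rewrite patchE /step mem_setE in_itv /= le_eqVlt (negbTE st).
  by case: ltP => _; rewrite ?mulr1 ?mulr0.
have := @FTC1Ny R q; rewrite FE => H.
have /H : forall y, mu.-integrable `]-oo, y] (EFin \o q).
  by move=> y; apply: (integrableS measurableT).
have : locally_integrable [set: R] q.
  by have := integrable_locally measurableT Q; rewrite patch_setT.
move=> + /(_ _) => L /(_ L); apply: ae_imp => t [dt <-].
by rewrite derive1E; exact: DeriveDef.
Qed.

Lemma itg_rep_bounded (k : rep) (g : R -> R) (K : R) :
  itg mu (fun s => k (Some s)) -> measurable_fun setT g ->
  (forall s, I01 s -> `|g s| <= K) ->
  itg mu (fun s => k (Some s) * (\1_I01 s * g s)).
Proof.
move=> ik mg gK; apply: (itg_bounded_mul (K := Num.max K 0)) => //.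
  by apply: measurable_funM => //; apply: measurable_indic; exact: measurable_I01.
move=> s; rewrite indicE; have [sI|_] := boolP (s \in I01).
  by rewrite mul1r le_max gK//; rewrite inE in sI.
by rewrite mul0r normr0 le_max lexx orbT.
Qed.

Lemma step_norm (x s : R) : `|step x s| <= 1.
Proof. by have /andP[a b] := @step01 R x s; rewrite ger0_norm. Qed.

Lemma is_deriv01_rep_t1 (k : rep) (t l : R) :
  is_derive t 1 (fun t => \int[mu]_s (k (Some s) * \1_I01 s * step t s)) l ->
  is_deriv01 (fun t => rep_ip k (rep_t1 t)) t l.
Proof.
move=> /is_deriv01_derive; apply: cvg_trans; apply: near_eq_cvg; apply: nearW => z.
rewrite /quot01 /rep_ip /rep_t1 /=; congr (_ / _).
rewrite opprD addrACA subrr add0r; by congr (_ - _); apply: eq_Rintegral => s _; exact: (esym (mulrA _ _ _)).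
Qed.

(** [rep_x2 z] and [rep_t1 z] differ by a representer independent of z, so their pairings have the
    same increments and derivatives. *)
Lemma rep_ip_x2_t1 (k : rep) : itg mu (fun s => k (Some s)) ->
  exists C, forall z, rep_ip k (rep_x2 z) = rep_ip k (rep_t1 z) + C.
Proof.
move=> ik.
exists (- 3 * k None - \int[mu]_s (k (Some s) * (\1_I01 s * (1 - s) ^+ 2))) => z.
rewrite /rep_ip /rep_x2 /rep_t1 /=.
have -> : \int[mu]_s (k (Some s) * (\1_I01 s * (step z s - (1 - s) ^+ 2))) =
  \int[mu]_s (k (Some s) * (\1_I01 s * step z s)) -
  \int[mu]_s (k (Some s) * (\1_I01 s * (1 - s) ^+ 2)).
  rewrite -RintB.
  - by apply: eq_Rintegral => s _; rewrite -mulrBr -mulrBr.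
  - apply: (itg_rep_bounded (K := 1)) => //; first exact: measurable_step.
    by move=> s _; exact: step_norm.
  - apply: (itg_rep_bounded (K := 1)) => //.
      by apply: measurable_funX; exact: measurable_funB.
    move=> s; rewrite I01E => /andP[s0 s1]; rewrite ger0_norm ?sqr_ge0//.
    by rewrite exprn_ile1//; lra.
by move: (Rintegral _ _ _) (Rintegral _ _ _) (k None : R) => a b c; ring.
Qed.

Lemma is_deriv01_rep_x2 (k : rep) (x l : R) : itg mu (fun s => k (Some s)) ->
  is_derive x 1 (fun x => \int[mu]_s (k (Some s) * \1_I01 s * step x s)) l ->
  is_deriv01 (fun x => rep_ip k (rep_x2 x)) x l.
Proof.
move=> ik /is_deriv01_rep_t1; have [C E] := rep_ip_x2_t1 ik.
apply: cvg_trans; apply: near_eq_cvg; apply: nearW => z.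
rewrite /quot01 !E; congr (_ / _).
by move: (rep_ip _ _) (rep_ip _ _) => a b; ring.
Qed.

Lemma ae_derive_rep (k : rep) : itg mu (fun s => k (Some s)) ->
  {ae mu, forall t : R, I01 t -> is_derive t 1
     (fun t => \int[mu]_s (k (Some s) * \1_I01 s * step t s)) (k (Some t))}.
Proof.
move=> ik; have iq : itg mu (fun s => k (Some s) * \1_I01 s).
  apply: (itg_bounded_mul (K := 1)) => //.
    by apply: measurable_indic; exact: measurable_I01.
  by move=> s; rewrite indicE; case: (_ \in _); rewrite ?normr1 ?normr0.
apply: ae_imp (ae_derive_prim iq) => t + tI.
by rewrite [in X in is_derive _ _ _ X]indicE mem_set// mulr1.
Qed.

Lemma ae_deriv_rep_t1 (k : rep) : itg mu (fun s => k (Some s)) ->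
  {ae mu, forall t, I01 t ->
     is_deriv01 (fun t => rep_ip k (rep_t1 t)) t (k (Some t))}.
Proof.
move=> ik; apply: ae_imp (ae_derive_rep ik) => t + tI => /(_ tI).
exact: is_deriv01_rep_t1.
Qed.

Lemma ae_deriv_rep_x2 (k : rep) : itg mu (fun s => k (Some s)) ->
  {ae mu, forall x, I01 x ->
     is_deriv01 (fun x => rep_ip k (rep_x2 x)) x (k (Some x))}.
Proof.
move=> ik; apply: ae_imp (ae_derive_rep ik) => x + xI => /(_ xI).
exact: is_deriv01_rep_x2.
Qed.

Lemma step_diff (a b s : R) : 0 <= a -> a <= b -> b <= 1 -> s != a ->
  \1_I01 s * (step b s - step a s) = \1_(`]a, b[) s.
Proof.
move=> a0 ab b1 sa.
have -> : \1_(`]a, b[) s = ((a < s) && (s < b))%:R :> R.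
  by rewrite indicE mem_setE in_itv.
rewrite indicE /step.
have [sI|sI] := boolP (s \in I01); last first.
  have nI : ~ I01 s by move=> h; move/negP: sI; apply; rewrite inE.
  rewrite mul0r; case: ltP => //= h1; case: ltP => //= h2.
  by exfalso; apply: nI; rewrite I01E; apply/andP; split; lra.
rewrite mul1r; have [h1|h1] := ltP s b; have [h2|h2] := ltP s a; have [h3|h3] := ltP a s;
  rewrite ?subrr ?subr0//=; try lra.
Qed.

Lemma rep_ip_t1_increment (k : rep) (a b : R) : itg mu (fun s => k (Some s)) ->
  0 <= a -> a <= b -> b <= 1 ->
  rep_ip k (rep_t1 b) - rep_ip k (rep_t1 a) = \int[mu]_(s in `]a, b[) k (Some s).
Proof.
move=> ik a0 ab b1; have itr z : itg mu (fun r => k (Some r) * (\1_I01 r * step z r)).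
  apply: (itg_rep_bounded (K := 1)) => //; first exact: measurable_step.
  by move=> s _; exact: step_norm.
rewrite /rep_ip /= opprD addrACA subrr add0r -RintB//.
rewrite [RHS]Rintegral_mkcond; apply: ae_eq_Rintegral.
apply: ae_imp (ae_neq a) => s sa _; rewrite -mulrBr -mulrBr step_diff//.
by rewrite patchE indicE; case: ifP => _; rewrite ?mulr1 ?mulr0.
Qed.

Lemma rep_ip_x2_increment (k : rep) (a b : R) : itg mu (fun s => k (Some s)) ->
  0 <= a -> a <= b -> b <= 1 ->
  rep_ip k (rep_x2 b) - rep_ip k (rep_x2 a) = \int[mu]_(s in `]a, b[) k (Some s).
Proof.
move=> ik a0 ab b1; have [C E] := rep_ip_x2_t1 ik.
rewrite -rep_ip_t1_increment// !E.
by move: (rep_ip _ _) (rep_ip _ _) => p q; ring.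
Qed.

(** Turns a one-variable pairing into a pairing of data, so that the differentiation rule for
    tensors also applies to [rep_ip k (e z)]. *)
Definition embed (k : rep) : data :=
  fun z => match z.2 with None => k z.1 | Some _ => (0 : R^o) end.

Lemma embed_L2 (k : rep) : L2 mu I01 (fun s => k (Some s)) -> data_L2 (embed k).
Proof.
move=> Lk; split; [exact: Lk| |].
  by apply: L2_0; [exact: measurable_I01|exact: I01_lty].
by apply: L2_0; [exact: measurable_sqD|exact: sqD_lty].
Qed.

Lemma embed_ip (k e f : rep) : L2 mu I01 (fun s => k (Some s)) -> rep_ok e ->
  data_ip (embed k) (tens e f) = rep_ip k e * f None.
Proof.
move=> Lk eo; rewrite /data_ip /rep_ip mulrDl.
have -> : \int[mu]_x (data_v (embed k) x * data_v (tens e f) x) = 0.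
  by rewrite -(Rintegral0 mu); apply: eq_Rintegral => x _; exact: mul0r.
have -> : \int[mu2]_x (data_w (embed k) x * data_w (tens e f) x) = 0.
  by rewrite -(Rintegral0 mu2); apply: eq_Rintegral => x _; exact: mul0r.
rewrite !addr0; congr (_ + _); first exact: mulrA.
rewrite [RHS]mulrC -RintZ; last exact: L2M Lk (rep_ok_L2 eo).
by apply: eq_Rintegral => x _; rewrite /data_u /embed /tens /=;
  move: (k _ : R) (e _ : R) (f _ : R) => a b c; ring.
Qed.

Lemma is_deriv01_rep_ip (k : rep) e x e' : L2 mu I01 (fun s => k (Some s)) ->
  I01 x -> rep_deriv e x e' ->
  is_deriv01 (fun z => rep_ip k (e z)) x (rep_ip k e').
Proof.
move=> Lk xI de; have o1 : rep_ok (mkrep (1 : R) (cst 0)).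
  by apply: (@mkrep_ok _ _ _ 0) => // s _; rewrite /= normr0.
have [eo eo' _ _ _] := de.
have := is_deriv01_tens_l (embed_L2 Lk) xI de o1.
rewrite embed_ip// mulr1; apply: is_deriv01_ext => // z zI.
by rewrite embed_ip ?mulr1//; exact: eo.
Qed.

End Boundary_and_sections.

Lemma Rint_abs_le_ae d (T : measurableType d) (R : realType)
    (m : {measure set T -> \bar R}) (f g : T -> R) : itg m f -> itg m g ->
  {ae m, forall x, `|f x| <= g x} -> `|\int[m]_x f x| <= \int[m]_x g x.
Proof.
move=> F G [N [mN N0 fgN]].
have out (h : T -> R) : \int[m]_x h x = \int[m]_x (h x * \1_(~` N) x).
  apply: ae_eq_Rintegral; exists N; split => // x /= /not_implyP[_ hx].
  by apply: contrapT => Nx; apply: hx; rewrite indicE mem_set// mulr1.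
have io (h : T -> R) : itg m h -> itg m (fun x => h x * \1_(~` N) x).
  move=> H; apply: (itg_bounded_mul (K := 1)) => //.
    by apply: measurable_indic; exact: measurableC.
  by move=> x; rewrite indicE; case: (_ \in _); rewrite ?normr1 ?normr0.
rewrite (out f) (out g); apply: Rint_abs_le => [||x]; [exact: io|exact: io|].
rewrite indicE; have [xN|_] := boolP (x \in ~` N); last by rewrite !mulr0 normr0.
rewrite !mulr1; apply: contrapT => nle; move: xN; rewrite inE; apply.
exact: fgN.
Qed.

Lemma opp_diff_diff (V : zmodType) (a b c d : V) :
  (a - b) - (c - d) = - ((b - a) - (d - c)).
Proof. by rewrite [RHS]opprD opprK !opprB. Qed.

Lemma le_norm_eq3 (R : realType) (a a' b b' c c' k : R) :
  a = a' -> b = b' -> c = c' -> `|a' - b'| <= k * `|c'| -> `|a - b| <= k * `|c|.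
Proof. by move=> -> -> ->. Qed.

Lemma le_norm_scaled (R : realType) (a b k q s : R) :
  0 <= s -> `|a - b| <= k * q -> `|a * s - b * s| <= k * (q * s).
Proof. by move=> s0 h; rewrite -mulrBl normrM (ger0_norm s0) mulrA ler_wpM2r. Qed.

(** Here a and b are the expected derivatives at x and at a nearby point of the dense sequence, p
    and q the corresponding difference quotients, k is proportional to the distance of the points,
    and g is the quotient of a primitive of the majorant with value Q. The errors are k Q, e / 2 and
    k (Q + 1). *)
Lemma four_term_estimate (R : realType) (a b p q g k Q e : R) :
  `|a - b| <= k * Q -> `|b - q| < e / 2 -> `|p - q| <= k * `|g| ->
  `|Q - g| < 1 -> k * (2 * Q + 1) < e / 2 -> 0 <= k -> 0 <= Q -> `|a - p| < e.
Proof.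
move=> ab bq pq Qg kQ k0 Q0.
have g1 : `|g| <= Q + 1.
  move: Qg; rewrite ltr_norml ler_norml => /andP[? ?]; apply/andP; split; lra.
have kg := ler_wpM2l k0 g1.
have -> : a - p = (a - b) + (b - q) - (p - q) by ring.
apply: le_lt_trans (ler_normB _ _) _; have := ler_normD (a - b) (b - q).
lra.
Qed.

(** * Second time derivatives outside one null set of times *)

Section Second_time_derivative.
Context {R : realType}.
Notation mu := (@lebesgue_measure R).
Notation mu2 := (mu \x mu)%E.
Variable d : @data R.
Hypothesis Ld : data_L2 d.

Let absd : @data R := fun z => `|d z : R|.
Let one : @rep R := mkrep (1 : R) (fun=> 1).

Let absd_L2 : data_L2 absd.
Proof.
have [[mu_ du du2] [mv dv dv2] [mw dw dw2]] := Ld.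
split; split.
- by apply: measurableT_comp.
- by move=> x xI; rewrite /data_u /absd; have := du x xI; rewrite /data_u => ->; rewrite normr0.
- by have := du2; congr itg; apply/funext => x; rewrite real_normK ?num_real.
- by apply: measurableT_comp.
- by move=> x xI; rewrite /data_v /absd; have := dv x xI; rewrite /data_v => ->; rewrite normr0.
- by have := dv2; congr itg; apply/funext => x; rewrite real_normK ?num_real.
- by apply: measurableT_comp.
- by move=> x xI; rewrite /data_w /absd; have := dw x xI; rewrite /data_w => ->; rewrite normr0.
- by have := dw2; congr itg; apply/funext => x; rewrite real_normK ?num_real.
Qed.

Let one_ok : rep_ok one.
Proof. by apply: (@mkrep_ok _ _ _ 1) => // s _; rewrite normr1. Qed.

(** Q(r) = |v(r)| + int_0^1 |w(s, r)| ds; up to the factor 4 it is a Lipschitz constant in x for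
    [contr d (rep_x0 x) (Some r)]. *)
Let Q (r : R) : R := contr absd one (Some r).

Let iQ : itg mu Q.
Proof. exact: itg_contr. Qed.

Let Q_ge0 r : 0 <= Q r.
Proof.
apply: addr_ge0; first by apply: mulr_ge0; [exact: normr_ge0|exact: ler01].
apply: Rintegral_ge0 => s _; apply: mulr_ge0; first exact: normr_ge0.
by rewrite /= mulr1 indicE.
Qed.

Lemma itg_data_w : itg mu2 (data_w d).
Proof. by have [_ _ dw] := Ld; apply: L2_itg dw; [exact: measurable_sqD|exact: sqD_lty]. Qed.

Let contr_lipschitz (x y r : R) : I01 x -> I01 y ->
  itg mu (fun s => data_w d (s, r)) ->
  `|contr d (rep_x0 x) (Some r) - contr d (rep_x0 y) (Some r) : R| <=
    4 * `|x - y| * Q r.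
Proof.
move=> xI yI iw; set K := 4 * `|x - y|.
have i z : I01 z -> itg mu (fun s => data_w d (s, r) * rep_x0 z (Some s)).
  move=> zI; have [m _ [M zM]] := rep_x0_ok zI.
  exact: (itg_bounded_mul (K := M)).
have D : itg mu (fun s => data_w d (s, r) * (rep_x0 x (Some s) - rep_x0 y (Some s))).
  by have := itgB (i _ xI) (i _ yI); congr itg; apply/funext => s; rewrite mulrBr.
have -> : (contr d (rep_x0 x) (Some r) - contr d (rep_x0 y) (Some r) : R) =
   data_v d r * (rep_x0 x None - rep_x0 y None) +
   \int[mu]_s (data_w d (s, r) * (rep_x0 x (Some s) - rep_x0 y (Some s))).
  have -> : \int[mu]_s (data_w d (s, r) * (rep_x0 x (Some s) - rep_x0 y (Some s))) =
     \int[mu]_s (data_w d (s, r) * rep_x0 x (Some s)) -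
     \int[mu]_s (data_w d (s, r) * rep_x0 y (Some s)).
    by rewrite -RintB; [|exact: i|exact: i]; apply: eq_Rintegral => s _; rewrite mulrBr.
  rewrite /contr; move: (Rintegral _ _ _) (Rintegral _ _ _) => a b.
  by move: (data_v _ _ : R) (rep_x0 _ _ : R) (rep_x0 _ _ : R) => p q1 q2; ring.
apply: le_trans (ler_normD _ _) _; rewrite /Q /contr [leRHS]mulrDr; apply: lerD.
  rewrite normrM mulr1 mulrC ler_wpM2r//; exact: rep_x0_lipschitz.
have iabs : itg mu (fun s => data_w absd (s, r) * one (Some s)).
  apply: (itg_bounded_mul (K := 1)); first exact: (itg_abs iw).
    by have [] := one_ok.
  by move=> s; rewrite /= indicE mulr1; case: (_ \in _); rewrite ?normr1 ?normr0.
rewrite -RintZ//; apply: Rint_abs_le => //; first exact: itgZ.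
have oneE s : one (Some s) = \1_I01 s by rewrite /one /= mulr1.
move=> s; rewrite normrM oneE; have [sI|sI] := boolP (s \in I01).
  by rewrite [\1_I01 s]indicE sI mulr1 mulrC ler_wpM2r//; exact: rep_x0_lipschitz.
rewrite [\1_I01 s]indicE (negbTE sI).
have nI : ~ I01 s by move=> h; move/negP: sI; apply; rewrite inE.
have [_ z1 _] := rep_x0_ok xI; have [_ z2 _] := rep_x0_ok yI.
by rewrite z1// z2// subrr normr0 !mulr0.
Qed.

Let F (x t : R) : R := rep_ip (contr d (rep_x0 x)) (rep_t1 t).
Let G (t : R) : R := rep_ip (contr absd one) (rep_t1 t).

(* The null set of times must not depend on x: it is chosen for a dense sequence
   of points, and the difference quotients in t depend on x in a Lipschitz way,
   up to the quotients of [G]. *)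
Let increment_bound (x y z t : R) : I01 x -> I01 y ->
  `|(F x z - F x t) - (F y z - F y t)| <= 4 * `|x - y| * `|G z - G t|.
Proof.
move=> xI yI; wlog tz : z t / t <= z.
  move=> H; have [/H//|/ltW zt] := leP t z.
  rewrite (opp_diff_diff (F x z)) normrN (distrC (G z)); exact: H.
have itr (k : rep) z' : itg mu (fun r => k (Some r)) ->
  itg mu (fun r => k (Some r) * (\1_I01 r * step z' r)).
  move=> ik; apply: (itg_rep_bounded (K := 1)) => //; first exact: measurable_step.
  by move=> s _; exact: step_norm.
have inc (k : rep) : itg mu (fun r => k (Some r)) ->
  rep_ip k (rep_t1 z) - rep_ip k (rep_t1 t) =
  \int[mu]_r (k (Some r) * (\1_I01 r * (step z r - step t r))).
  move=> ik; rewrite /rep_ip /= opprD addrACA subrr add0r -RintB; [|exact: itr|exact: itr].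
  by apply: eq_Rintegral => s _; rewrite -mulrBr -mulrBr.
have itr2 (k : rep) : itg mu (fun r => k (Some r)) ->
  itg mu (fun r => k (Some r) * (\1_I01 r * (step z r - step t r))).
  move=> ik; have := itgB (itr k z ik) (itr k t ik).
  by congr itg; apply/funext => r; rewrite -mulrBr -mulrBr.
have ix := itg_contr Ld (rep_x0_ok xI); have iy := itg_contr Ld (rep_x0_ok yI).
apply: (le_norm_eq3 (inc _ ix) (inc _ iy) (inc (contr absd one) iQ)).
have st r : 0 <= \1_I01 r * (step z r - step t r).
  rewrite mulr_ge0// subr_ge0 /step; case: ltP => // rt; case: ltP => // zr.
  by have := lt_le_trans rt tz; rewrite ltNge zr.
have Q0 := Q_ge0.
rewrite [`|\int[mu]_r _|]ger0_norm; last first.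
  by apply: Rintegral_ge0 => r _; apply: mulr_ge0; [exact: Q_ge0|exact: st].
rewrite -RintB; [|exact: itr2|exact: itr2].
rewrite -RintZ; last exact: itr2 iQ.
apply: Rint_abs_le_ae; first by apply: itgB; exact: itr2.
  by apply: itgZ; exact: itr2 iQ.
apply: ae_imp (itg_section2 itg_data_w) => r ir.
by apply: le_norm_scaled; [exact: st|exact: contr_lipschitz].
Qed.

Lemma ae_deriv_data_t1 : {ae mu, forall t, I01 t -> forall x, I01 x ->
  is_deriv01 (fun t => data_ip d (tens (rep_x0 x) (rep_t1 t))) t
    (rep_ip (fun o => d (o, Some t)) (rep_x0 x))}.
Proof.
have [rho [rhoI rhoP]] := @dense_sequence_I01 R.
have A : {ae mu, forall t, forall n, I01 t ->
    is_deriv01 (F (rho n)) t (contr d (rep_x0 (rho n)) (Some t))}.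
  by apply: ae_foralln => n; exact: ae_deriv_rep_t1 (itg_contr Ld (rep_x0_ok (rhoI n))).
have B := ae_deriv_rep_t1 iQ; have C := itg_section2 itg_data_w.
apply: ae_imp2 (ae_imp2 (fun t a b => conj a b) A B) C => t [At Bt] Ct tI x xI.
have {}Bt := Bt tI.
apply: (@is_deriv01_ext _ (F x)) => //.
  by move=> z zI; rewrite data_ip_contr//; [exact: rep_x0_ok|exact: rep_t1_ok].
rewrite -/(contr d (rep_x0 x) (Some t)).
apply/cvgrPdist_lt => e e0.
have Q0 := Q_ge0 t.
(* With k = 4 * |x - rho n|, the error terms k * Q t and k * (Q t + 1) then add up to less than e /
   2. *)
have [n xn] : exists n, `|x - rho n| < e / (8 * (2 * Q t + 1)).
  by apply: rhoP => //; rewrite divr_gt0// mulr_gt0//; lra.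
have xn' : 4 * `|x - rho n| * (2 * Q t + 1) < e / 2.
  move: xn; rewrite ltr_pdivlMr; [|rewrite mulr_gt0//; lra]; lra.
have e2 : 0 < e / 2 by rewrite divr_gt0.
have /cvgrPdist_lt/(_ _ e2) N1 := At n tI.
have /cvgrPdist_lt/(_ _ ltr01) N2 := Bt.
near=> z.
have h1 : `|contr d (rep_x0 (rho n)) (Some t) - quot01 (F (rho n)) t z| < e / 2.
  by near: z.
have h2 : `|Q t - quot01 G t z| < 1 by near: z.
have h3 : `|quot01 (F x) t z - quot01 (F (rho n)) t z| <=
    4 * `|x - rho n| * `|quot01 G t z|.
  rewrite /quot01 -mulrBl !normrM mulrA ler_wpM2r//; exact: increment_bound.
have h4 := contr_lipschitz xI (rhoI n) Ct.
have K0 : 0 <= 4 * `|x - rho n| by rewrite mulr_ge0.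
exact: (four_term_estimate h4 h1 h3 h2 xn' K0 Q0).
Unshelve. all: by end_near. Qed.

End Second_time_derivative.

(** Without division and with a weak inequality, the condition is preserved when rational increments
    tend to a real one. *)
Lemma is_derive_increment (R : realType) (g : R -> R) (x l : R) :
  (forall e, 0 < e -> exists2 r, 0 < r & forall h, h != 0 -> `|h| < r ->
     `|g (x + h) - g x - h * l| <= e * `|h|) <-> is_derive x 1 g l.
Proof.
have quotE h : h != 0 -> `|l - h^-1 *: (g (h *: (1 : R) + x) - g x)| =
    `|g (x + h) - g x - h * l| / `|h|.
  move=> h0; rewrite -normfV -normrM -[RHS]normrN; congr `|_|.
  by rewrite /GRing.scale /= mulr1 (addrC h) mulrBl mulrAC mulfV// mul1r opprB mulrC.
split=> [H|[dg gl] e e0].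
  have C : h^-1 *: (g (h *: (1 : R) + x) - g x) @[h --> 0^'] --> l.
    apply/cvgrPdist_le => e e0; have [r r0 rP] := H e e0.
    exists r => // h /=; rewrite sub0r normrN => hr h0.
    by rewrite quotE// ler_pdivrMr ?normr_gt0//; exact: rP.
  apply: DeriveDef; first by apply/cvg_ex; exists l.
  by apply/cvg_lim.
have := dg; rewrite /derivable => /cvg_ex[l' C].
have ll' : l' = l by rewrite -gl; apply/esym/cvg_lim.
move: C; rewrite ll' => /cvgrPdist_le/(_ _ e0)[r /= r0 rP].
exists r => // h h0 hr; have := rP h; rewrite /= sub0r normrN => /(_ hr h0).
by rewrite quotE// ler_pdivrMr ?normr_gt0.
Qed.

Lemma null_sections d1 d2 (T1 : measurableType d1) (T2 : measurableType d2)
    (R : realType) (m1 : {sigma_finite_measure set T1 -> \bar R})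
    (m2 : {sigma_finite_measure set T2 -> \bar R}) (N : set (T1 * T2)) :
  measurable N -> {ae m2, forall y, {ae m1, forall x, ~ N (x, y)}} ->
  ((m1 \x m2) N = 0)%E.
Proof.
move=> mN aeN; transitivity (\int[m1 \x m2]_z (EFin \o (\1_N : T1 * T2 -> R)) z)%E.
  by rewrite integral_indic// setIT.
have mI : measurable_fun setT (EFin \o (\1_N : T1 * T2 -> R)).
  by apply/measurable_EFinP; exact: measurable_indic.
rewrite (fubini_tonelli2 _ mI); last by move=> z; rewrite /= lee_fin.
transitivity (\int[m2]_y (0 : \bar R))%E; last exact: integral0.
apply: ae_eq_integral_nonmeasurable; apply: ae_imp aeN => y aey _.
transitivity (\int[m1]_x (0 : \bar R))%E; last exact: integral0.
apply: ae_eq_integral_nonmeasurable; apply: ae_imp aey => x xy _.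
by rewrite /= indicE memNset.
Qed.

(** * Differentiability of sections at almost every point of the square *)

Section Derivative_of_sections.
Context {R : realType}.
Notation mu := (@lebesgue_measure R).
Notation mu2 := (mu \x mu)%E.
Variable w : R * R -> R.
Hypothesis iw : itg mu2 w.

Let W (x y : R) : R := \int[mu]_s (w (s, y) * step x s).

Let mw : measurable_fun setT w.
Proof. exact: itg_measurable iw. Qed.

(** The integrand is jointly measurable in the two parameters and s; Tonelli's theorem applies to
    its positive and negative parts. *)
Let measurable_W : measurable_fun setT (fun z => W z.1 z.2).
Proof.
pose f (p : R * R * R) := w (p.2, p.1.2) * step p.1.1 p.2.
have mf : measurable_fun setT f.
  apply: measurable_funM.
    apply: (measurableT_comp mw); apply: measurable_fun_pair => //.
    exact: (measurableT_comp measurable_snd measurable_fst).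
  have -> : (fun p : R * R * R => step p.1.1 p.2) = \1_[set p | p.2 < p.1.1].
    apply/funext => p; rewrite indicE /step; case: ltP => h.
      by rewrite mem_set.
    by rewrite memNset//= => /(le_lt_trans h); rewrite ltxx.
  apply: measurable_indic.
  have m1 : measurable_fun setT (fun p : R * R * R => p.2 < p.1.1).
    apply: measurable_fun_ltr => //.
    exact: (measurableT_comp measurable_fst measurable_fst).
  have := m1 measurableT [set true] I; rewrite setTI.
  by congr measurable; apply/seteqP; split => p /=.
have -> : (fun z => W z.1 z.2) = (fun z => fine
   (\int[mu]_s ((EFin \o f)^\+ (z, s)) - \int[mu]_s ((EFin \o f)^\- (z, s)))%E).
  apply/funext => z; rewrite /W /Rintegral integralE; congr (fine (_ - _)%E);
    by apply: eq_integral => s _; rewrite ?funeposE ?funenegE.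
apply: measurableT_comp => //; apply: emeasurable_funB.
  apply: (@measurable_fun_fubini_tonelli_F _ _ _ _ _ mu ((EFin \o f)^\+)%E) => //.
  by apply: measurable_funepos; exact/measurable_EFinP.
apply: (@measurable_fun_fubini_tonelli_F _ _ _ _ _ mu ((EFin \o f)^\-)%E) => //.
by apply: measurable_funeneg; exact/measurable_EFinP.
Qed.

Let W_cvg (y x : R) (u : nat -> R) : itg mu (fun s => w (s, y)) ->
  u @ \oo --> x -> W (u n) y @[n --> \oo] --> W x y.
Proof.
move=> iy ux; apply: (@Rint_cvg _ _ R mu (fun n s => w (s, y) * step (u n) s)
  (fun s => w (s, y) * step x s) (fun s => `|w (s, y)|)).
- by move=> n; apply: measurable_funM; [exact: itg_measurable iy|exact: measurable_step].
- by apply: measurable_funM; [exact: itg_measurable iy|exact: measurable_step].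
- apply: ae_imp (ae_neq x) => s sx; apply: cvgM; first exact: cvg_cst.
  have := ux _ (step_near sx) => N.
  by apply: cvg_near_cst; exact: N.
- exact: itg_abs.
- by move=> n s; rewrite normrM ler_piMr//; exact: step_norm.
Qed.

(* Differentiability at [z], tested on rational increments only so that the set
   of good points is visibly measurable. *)
Let good (z : R * R) : Prop := forall k : nat, exists m : nat, forall q : rat,
  ratr q != 0 :> R -> `|ratr q| < m.+1%:R^-1 :> R ->
  `|W (z.1 + ratr q) z.2 - W z.1 z.2 - ratr q * w z| <= k.+1%:R^-1 * `|ratr q|.

Let measurable_good : measurable [set z | good z].
Proof.
pose A k q := [set z : R * R |
  `|W (z.1 + ratr q) z.2 - W z.1 z.2 - ratr q * w z| <= k.+1%:R^-1 * `|ratr q|].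
pose Q n : rat := odflt 0 (unpickle n).
have mA k q : measurable (A k q).
  have mg : measurable_fun setT (fun z : R * R =>
      `|W (z.1 + ratr q) z.2 - W z.1 z.2 - ratr q * w z|).
    apply: measurableT_comp => //; apply: measurable_funB.
      apply: measurable_funB; last exact: measurable_W.
      have mp : measurable_fun setT (fun z : R * R => (z.1 + ratr q : R, z.2)).
        by apply: measurable_fun_pair => //; exact: measurable_funD.
      exact: (measurableT_comp measurable_W mp).
    exact: measurable_funM.
  have := mg measurableT `]-oo, k.+1%:R^-1 * `|ratr q|]%classic (measurable_itv _).
  by rewrite setTI; congr measurable; apply/seteqP; split => z; rewrite /A /= in_itv.
have -> : [set z | good z] = \bigcap_k \bigcup_m \bigcap_n
    (if (ratr (Q n) != 0 :> R) && (`|ratr (Q n)| < m.+1%:R^-1 :> R)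
     then A k (Q n) else setT).
  apply/seteqP; split => z /= gz.
    move=> k _; have [m mP] := gz k; exists m => // n _.
    by case: ifP => // /andP[q0 qm]; exact: mP.
  move=> k; have [m _ mP] := gz k I; exists m => q q0 qm.
  by have := mP (pickle q) I; rewrite /Q pickleK /= q0 qm.
apply: bigcap_measurable => // k _; apply: bigcup_measurable => m _.
by apply: bigcap_measurable => // n _; case: ifP.
Qed.

(** The section of [W] is continuous, so the estimate on rational increments extends to every real
    increment by approximation. *)
Let good_derive (z : R * R) : itg mu (fun s => w (s, z.2)) -> good z ->
  is_derive z.1 1 (W ^~ z.2) (w z).
Proof.
move=> iy gz; apply/is_derive_increment => e e0.
have [k ke] : exists k, k.+1%:R^-1 < e :> R.
  have /cvgrPdist_lt/(_ _ e0)[k _ /(_ k (leqnn k))] := @cvg_harmonic R.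
  by rewrite /= sub0r normrN ger0_norm//; exists k.
have [m mP] := gz k; exists (m.+1%:R^-1); first by rewrite invr_gt0.
move=> h h0 hm.
apply: (@le_trans _ _ (k.+1%:R^-1 * `|h|)); last by rewrite ler_wpM2r// ltW.
have /choice[q qP] : forall n : nat, exists q : rat, [/\ ratr q != 0 :> R,
    `|ratr q| < m.+1%:R^-1 :> R & `|h - ratr q| < n.+1%:R^-1 :> R].
  move=> n.
  pose r := Num.min (n.+1%:R^-1) (Num.min `|h| (m.+1%:R^-1 - `|h|)) : R.
  have r0 : 0 < r by rewrite !lt_min invr_gt0 ltr0n normr_gt0 h0 subr_gt0 hm.
  have [|q] := @rat_in_itvoo _ (h - r) (h + r); first by lra.
  rewrite in_itv/= => /andP[q1 q2]; exists q.
  have hq : `|h - ratr q| < r by rewrite ltr_norml; lra.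
  have : r <= n.+1%:R^-1 /\ r <= `|h| /\ r <= m.+1%:R^-1 - `|h|.
    by rewrite /r !ge_min !lexx !orbT.
  move=> [rn [rh rm]]; split.
  - by apply/eqP => q0; move: hq; rewrite q0 subr0; lra.
  - have := ler_normB h (h - ratr q); rewrite subKr => /le_lt_trans; apply.
    by rewrite -ltrBrDl; exact: lt_le_trans hq rm.
  - exact: lt_le_trans hq rn.
have qh : ratr (q n) @[n --> \oo] --> h.
  apply/cvgrPdist_lt => r r0; near=> n.
  have [_ _ hq] := qP n; apply: lt_trans hq _.
  by near: n; exact: near_infty_natSinv_lt (PosNum r0).
have c1 : `|W (z.1 + ratr (q n)) z.2 - W z.1 z.2 - ratr (q n) * w z| @[n --> \oo]
   --> `|W (z.1 + h) z.2 - W z.1 z.2 - h * w z|.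
  apply: cvg_norm; apply: cvgB; last by apply: cvgM => //; exact: cvg_cst.
  apply: cvgB; last exact: cvg_cst.
  by apply: W_cvg => //; apply: cvgD => //; exact: cvg_cst.
have c2 : k.+1%:R^-1 * `|ratr (q n) : R| @[n --> \oo] --> k.+1%:R^-1 * `|h|.
  by apply: cvgM; [exact: cvg_cst|exact: cvg_norm].
apply: (ler_cvg_to c1 c2); apply: nearW => n.
by have [q0 qm _] := qP n; exact: mP.
Unshelve. all: by end_near. Qed.

Let derive_good (x y : R) : is_derive x 1 (W ^~ y) (w (x, y)) -> good (x, y).
Proof.
move=> /is_derive_increment H k.
have k0 : 0 < k.+1%:R^-1 :> R by rewrite invr_gt0.
have [r r0 rP] := H _ k0.
have [m mr] : exists m, m.+1%:R^-1 < r :> R.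
  have /cvgrPdist_lt/(_ _ r0)[m _ /(_ m (leqnn m))] := @cvg_harmonic R.
  by rewrite /= sub0r normrN ger0_norm//; exists m.
exists m => q q0 qm; apply: rP => //; exact: lt_trans mr.
Qed.

(** Lebesgue's theorem on almost every horizontal line shows that almost all its points are [good];
    as the set of good points is measurable, its complement is a null set of the plane. *)
Lemma ae_derive_section : {ae mu2, forall z : R * R,
  is_derive z.1 1 (fun x => \int[mu]_s (w (s, z.2) * step x s)) (w z)}.
Proof.
have sec := itg_section2 iw.
have null : (mu2 (~` [set z | good z]) = 0)%E.
  apply: (@null_sections _ _ _ _ R mu mu _ (measurableC measurable_good)).
  apply: ae_imp sec => y iy; apply: ae_imp (ae_derive_prim iy) => x xy ng.
  by apply: ng; exact: derive_good.
have aeg : {ae mu2, forall z, good z}.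
  by exists (~` [set z | good z]); split => //; exact: measurableC measurable_good.
apply: ae_imp2 aeg (@ae_snd _ _ _ _ R mu mu _ sec) => z gz iz.
exact: good_derive.
Qed.

End Derivative_of_sections.

(** * Data as functions in W32 *)

Lemma in_L2_intro d0 (T : measurableType d0) (R : realType) (m : {measure set T -> \bar R})
    (A D : set T) (g w : T -> R) : measurable A -> L2 m D w ->
  {ae m, forall x, A x -> g x = w x} -> in_L2 m A g.
Proof.
move=> mA [mw _ iw] gw; exists w; split => //; first exact: measurable_funTS.
exact: (integrableS measurableT).
Qed.

Lemma add0_eq (V : nmodType) (a b c : V) : a = 0 -> b = c -> a + b = c.
Proof. by move=> -> ->; rewrite add0r. Qed.

Lemma mul0_eq (R : pzRingType) (a b : R) : a = 0 -> a * b = 0.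
Proof. by move=> ->; rewrite mul0r. Qed.

Lemma mul_eq (R : pzRingType) (a b c d : R) : a = c -> b = d -> a * b = c * d.
Proof. by move=> -> ->. Qed.

Lemma sum4_eq (V : nmodType) (a b c d a' b' c' d' r : V) :
  a = a' -> b = b' -> c = c' -> d = d' -> a' + b' + c' + d' = r ->
  a + b + c + d = r.
Proof. by move=> -> -> -> ->. Qed.

(** * Boundary values of the representers *)

Section Special_values.
Context {R : realType}.
Notation mu := (@lebesgue_measure R).
Notation mu2 := (mu \x mu)%E.

Lemma mkrep_eq (c c' : R) (g g' : R -> R) : c = c' ->
  (forall s, I01 s -> g s = g' s) -> mkrep c g = mkrep c' g'.
Proof.
move=> -> gg; apply/funext => -[s|] //=; rewrite indicE.
have [sI|_] := boolP (s \in I01); last by rewrite !mul0r.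
by rewrite gg//; rewrite inE in sI.
Qed.

Definition rep_unit : @rep R := mkrep (1 : R) (fun=> 0).

Lemma mkrep0 : mkrep (0 : R) (fun=> 0) = 0.
Proof. by apply/funext => -[s|] //=; rewrite mulr0. Qed.

Lemma step_ge (x s : R) : x <= s -> step x s = 0.
Proof. by rewrite /step leNgt => /negbTE ->. Qed.

Lemma rep_x0_at0 : rep_x0 (0 : R) = 0.
Proof.
rewrite -mkrep0; apply: mkrep_eq; first by rewrite expr0n/= subr0.
move=> s; rewrite I01E => /andP[s0 _].
by rewrite (step_ge s0) mulr0 expr0n/= mul0r subr0.
Qed.

Lemma rep_x0_at1 : rep_x0 (1 : R) = 0.
Proof.
rewrite -mkrep0; apply: mkrep_eq; first by rewrite expr1n subrr.
move=> s; rewrite I01E => /andP[_ s1]; rewrite expr1n mul1r /step.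
have [h|h] := ltP s 1; first by rewrite mulr1 subrr.
have -> : s = 1 by apply/eqP; rewrite eq_le s1 h.
by rewrite subrr expr0n/= mul0r mul0r subrr.
Qed.

Lemma rep_t0_at0 : rep_t0 (0 : R) = 0.
Proof.
rewrite -mkrep0; apply: mkrep_eq => // s; rewrite I01E => /andP[s0 _].
by rewrite (step_ge s0) mulr0.
Qed.

Lemma rep_x1_at0 : rep_x1 (0 : R) = rep_unit.
Proof.
apply: mkrep_eq; first by rewrite mulr0 subr0.
by move=> s; rewrite I01E => /andP[s0 _]; rewrite (step_ge s0) mulr0 mul0r subr0.
Qed.

Lemma rep_t1_at0 : rep_t1 (0 : R) = rep_unit.
Proof.
by apply: mkrep_eq => // s; rewrite I01E => /andP[s0 _]; rewrite (step_ge s0).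
Qed.

Lemma rep_unit_Some s : rep_unit (Some s) = 0.
Proof. by rewrite /= mulr0. Qed.

Lemma tens0l (f : @rep R) : tens 0 f = 0.
Proof. by apply/funext => z; exact: mul0r. Qed.

Lemma tens0r (e : @rep R) : tens e 0 = 0.
Proof. by apply/funext => z; exact: mulr0. Qed.

Lemma data_ip0 (d : @data R) : data_ip d 0 = 0.
Proof.
rewrite /data_ip; have Z (a : R) : a * (0 : R) = 0 by rewrite mulr0.
have -> : \int[mu]_x (data_u d x * data_u 0 x) = 0.
  by rewrite -(Rintegral0 mu); apply: eq_Rintegral => x _; exact: Z.
have -> : \int[mu]_x (data_v d x * data_v 0 x) = 0.
  by rewrite -(Rintegral0 mu); apply: eq_Rintegral => x _; exact: Z.
have -> : \int[mu2]_x (data_w d x * data_w 0 x) = 0.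
  by rewrite -(Rintegral0 mu2); apply: eq_Rintegral => x _; exact: Z.
by rewrite !addr0; exact: Z.
Qed.

Lemma data_ip_unitr (d : data) (e : rep) :
  data_ip d (tens e rep_unit) = rep_ip (fun o => d (o, None)) e.
Proof.
rewrite /data_ip /rep_ip.
have -> : \int[mu]_x (data_v d x * data_v (tens e rep_unit) x) = 0.
  rewrite -(Rintegral0 mu); apply: eq_Rintegral => x _.
  by rewrite /data_v /tens rep_unit_Some /= !mulr0.
have -> : \int[mu2]_x (data_w d x * data_w (tens e rep_unit) x) = 0.
  rewrite -(Rintegral0 mu2); apply: eq_Rintegral => x _.
  by rewrite /data_w /tens rep_unit_Some /= !mulr0.
rewrite !addr0 /data_c /data_u /tens /= mulr1; congr (_ + _).
by apply: eq_Rintegral => x _; rewrite mulr1.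
Qed.

Lemma data_ip_unitl (d : data) (f : rep) :
  data_ip d (tens rep_unit f) = rep_ip (fun o => d (None, o)) f.
Proof.
rewrite /data_ip /rep_ip.
have -> : \int[mu]_x (data_u d x * data_u (tens rep_unit f) x) = 0.
  rewrite -(Rintegral0 mu); apply: eq_Rintegral => x _.
  by rewrite /data_u /tens rep_unit_Some /= mul0r mulr0.
have -> : \int[mu2]_x (data_w d x * data_w (tens rep_unit f) x) = 0.
  rewrite -(Rintegral0 mu2); apply: eq_Rintegral => x _.
  by rewrite /data_w /tens rep_unit_Some /= mul0r mulr0.
rewrite !addr0 /data_c /data_v /tens /= mul1r; congr (_ + _).
by apply: eq_Rintegral => x _; rewrite mul1r.
Qed.

Lemma data_ip_tensBl (d : @data R) (e e' f : rep) : data_L2 d -> rep_ok e ->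
  rep_ok e' -> rep_ok f ->
  data_ip d (tens (e - e') f) = data_ip d (tens e f) - data_ip d (tens e' f).
Proof.
move=> Ld eo eo' fo; have P := @data_preHilbert R.
have L1 := tens_L2 eo fo; have L2 := tens_L2 eo' fo.
rewrite -scaleN1r tensDl tensZl (ipDr P)//; last exact: (domZ P).
by rewrite (ipZr P)// mulN1r.
Qed.

Lemma data_ip_tensBr (d : @data R) (e f f' : rep) : data_L2 d -> rep_ok e ->
  rep_ok f -> rep_ok f' ->
  data_ip d (tens e (f - f')) = data_ip d (tens e f) - data_ip d (tens e f').
Proof.
move=> Ld eo fo fo'; have P := @data_preHilbert R.
have L1 := tens_L2 eo fo; have L2 := tens_L2 eo fo'.
rewrite -scaleN1r tensDr tensZr (ipDr P)//; last exact: (domZ P).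
by rewrite (ipZr P)// mulN1r.
Qed.

Lemma rep_okB (e e' : @rep R) : rep_ok e -> rep_ok e' -> rep_ok (e - e').
Proof. by move=> eo eo'; rewrite -scaleN1r; apply: rep_okD => //; exact: rep_okZ. Qed.

Lemma deriv01_zero (g : R -> R) (x : R) : (forall z, I01 z -> g z = 0) ->
  I01 x -> deriv01 g x = 0.
Proof.
move=> g0 xI; apply: (is_deriv01E xI).
apply: (@is_deriv01_ext _ (fun=> 0)) => // [z zI|]; first by rewrite g0.
by apply: (@is_deriv01_quadraticT _ _ _ 0 0 0) => [z|]; ring.
Qed.

(* Derivatives of the function attached to data *)
End Special_values.

Section Reconstruction.
Context {R : realType}.
Notation mu := (@lebesgue_measure R).
Notation mu2 := (mu \x mu)%E.

Definition of_data (d : @data R) (x t : R) : R :=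
  data_ip d (tens (rep_x0 x) (rep_t0 t)).

Variable d : @data R.
Hypothesis Ld : data_L2 d.
Implicit Types x t : R.
Local Notation J := (of_data d).

Lemma is_deriv01_dxi (y P Q : R -> R -> R) x t : I01 x -> I01 t ->
  (forall x t, I01 x -> I01 t -> y x t = P x t) ->
  is_deriv01 (P ^~ t) x (Q x t) -> dxi y x t = Q x t.
Proof.
move=> xI tI yP /(is_deriv01E xI) <-; apply: deriv01_ext => // z zI; exact: yP.
Qed.

Lemma is_deriv01_deta (y P Q : R -> R -> R) x t : I01 x -> I01 t ->
  (forall x t, I01 x -> I01 t -> y x t = P x t) ->
  is_deriv01 (P x) t (Q x t) -> deta y x t = Q x t.
Proof.
move=> xI tI yP /(is_deriv01E tI) <-; apply: deriv01_ext => // z zI; exact: yP.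
Qed.

Definition of_data_x x t := data_ip d (tens (rep_x1 x) (rep_t0 t)).
Definition of_data_xx x t := data_ip d (tens (rep_x2 x) (rep_t0 t)).
Definition of_data_t x t := data_ip d (tens (rep_x0 x) (rep_t1 t)).
Definition of_data_xt x t := data_ip d (tens (rep_x1 x) (rep_t1 t)).
Definition of_data_xxt x t := data_ip d (tens (rep_x2 x) (rep_t1 t)).

Lemma dxi_of_data x t : I01 x -> I01 t -> dxi J x t = of_data_x x t.
Proof.
move=> xI tI; apply: (@is_deriv01_dxi _ J) => //.
exact: is_deriv01_tens_l Ld xI (rep_x0_deriv xI) (rep_t0_ok tI).
Qed.

Lemma dxi2_of_data x t : I01 x -> I01 t -> dxi (dxi J) x t = of_data_xx x t.
Proof.
move=> xI tI; apply: (@is_deriv01_dxi _ of_data_x) => //; first exact: dxi_of_data.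
exact: is_deriv01_tens_l Ld xI (rep_x1_deriv xI) (rep_t0_ok tI).
Qed.

Lemma is_deriv01_of_data_t x t : I01 x -> I01 t -> is_deriv01 (J x) t (of_data_t x t).
Proof.
by move=> xI tI; exact: is_deriv01_tens_r Ld tI (rep_t0_deriv tI) (rep_x0_ok xI).
Qed.

Lemma deta_of_data x t : I01 x -> I01 t -> deta J x t = of_data_t x t.
Proof.
move=> xI tI; apply: (@is_deriv01_deta _ J) => //.
exact: is_deriv01_of_data_t.
Qed.

Lemma is_deriv01_deta_of_data x t : I01 x -> I01 t ->
  is_deriv01 (deta J ^~ t) x (of_data_xt x t).
Proof.
move=> xI tI; apply: (@is_deriv01_ext _ (of_data_t ^~ t)) => //.
  by move=> z zI; rewrite deta_of_data.
exact: is_deriv01_tens_l Ld xI (rep_x0_deriv xI) (rep_t1_ok tI).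
Qed.

Lemma dxi_deta_of_data x t : I01 x -> I01 t -> dxi (deta J) x t = of_data_xt x t.
Proof. by move=> xI tI; apply: (is_deriv01E xI); exact: is_deriv01_deta_of_data. Qed.

Lemma is_deriv01_dxi_deta_of_data x t : I01 x -> I01 t ->
  is_deriv01 (dxi (deta J) ^~ t) x (of_data_xxt x t).
Proof.
move=> xI tI; apply: (@is_deriv01_ext _ (of_data_xt ^~ t)) => //.
  by move=> z zI; rewrite dxi_deta_of_data.
exact: is_deriv01_tens_l Ld xI (rep_x1_deriv xI) (rep_t1_ok tI).
Qed.

Lemma dxi2_deta_of_data x t : I01 x -> I01 t ->
  dxi (dxi (deta J)) x t = of_data_xxt x t.
Proof. by move=> xI tI; apply: (is_deriv01E xI); exact: is_deriv01_dxi_deta_of_data. Qed.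

Lemma deta_dxi_of_data x t : I01 x -> I01 t -> deta (dxi J) x t = of_data_xt x t.
Proof.
move=> xI tI; apply: (@is_deriv01_deta _ of_data_x) => //; first exact: dxi_of_data.
exact: is_deriv01_tens_r Ld tI (rep_t0_deriv tI) (rep_x1_ok xI).
Qed.

Lemma of_data_boundary x : I01 x -> [/\ J x 0 = 0, J 0 x = 0 & J 1 x = 0].
Proof.
by move=> xI; rewrite /of_data rep_t0_at0 rep_x0_at0 rep_x0_at1 tens0r !tens0l data_ip0.
Qed.

Lemma deta2_of_data_0 t : I01 t -> deta (deta J) 0 t = 0.
Proof.
move=> tI; apply: deriv01_zero => // z zI; rewrite deta_of_data//; last first.
  by rewrite I01E lexx ler01.
by rewrite /of_data_t rep_x0_at0 tens0l data_ip0.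
Qed.

Lemma deta2_of_data_1 t : I01 t -> deta (deta J) 1 t = 0.
Proof.
move=> tI; apply: deriv01_zero => // z zI; rewrite deta_of_data//; last first.
  by rewrite I01E lexx ler01.
by rewrite /of_data_t rep_x0_at1 tens0l data_ip0.
Qed.

Lemma I01_0 : I01 (0 : R). Proof. by rewrite I01E lexx ler01. Qed.
Lemma I01_1 : I01 (1 : R). Proof. by rewrite I01E lexx ler01. Qed.

(** [rep_x1 0] carries only the weight at [None], so at x = 0 the mixed first derivative is the
    pairing of the slice [d (None, .)] with [rep_t1 t], a primitive of [data_v d] up to a
    constant. *)
Lemma deta2_dxi_of_data : {ae mu, forall t, I01 t ->
  deta (deta (dxi J)) 0 t = data_v d t}.
Proof.
have [_ dv _] := Ld.
have iv : itg mu (fun r => d (None, Some r)).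
  by apply: L2_itg dv; [exact: measurable_I01|exact: I01_lty].
apply: ae_imp (@ae_deriv_rep_t1 R (fun o => d (None, o)) iv) => t + tI => /(_ tI) H.
apply: (is_deriv01E tI); apply: is_deriv01_ext H => // z zI.
by rewrite deta_dxi_of_data//; [rewrite /of_data_xt rep_x1_at0 data_ip_unitl|exact: I01_0].
Qed.

Lemma deriv01_3_of_data_0 x : I01 x -> iter 3 deriv01 (J ^~ 0) x = 0.
Proof.
move=> xI; apply: deriv01_zero => // z1 z1I; apply: deriv01_zero => // z2 z2I.
by apply: deriv01_zero => // z3 z3I; have [] := of_data_boundary z3I.
Qed.

Lemma slice_u_L2 : L2 mu I01 (fun s => d (Some s, None)).
Proof. by have [] := Ld. Qed.

Lemma deriv01_3_deta_of_data : {ae mu, forall x, I01 x ->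
  iter 3 deriv01 (deta J ^~ 0) x = data_u d x}.
Proof.
pose k : @rep R := fun o => d (o, None).
have iu : itg mu (fun r => k (Some r)).
  by apply: L2_itg slice_u_L2; [exact: measurable_I01|exact: I01_lty].
have E e : data_ip d (tens e (rep_t1 0)) = rep_ip k e.
  by rewrite rep_t1_at0 data_ip_unitr.
have D2 x : I01 x -> iter 2 deriv01 (deta J ^~ 0) x = rep_ip k (rep_x2 x).
  by move=> xI; rewrite -E -/(of_data_xxt x 0) -dxi2_deta_of_data//; exact: I01_0.
apply: ae_imp (ae_deriv_rep_x2 iu) => x + xI => /(_ xI) H.
by apply: (is_deriv01E xI); apply: is_deriv01_ext H => // z zI; symmetry; exact: D2.
Qed.

Lemma slice_w_L2 : {ae mu, forall r, L2 mu I01 (fun s => d (Some s, Some r))}.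
Proof.
have [_ _ [mw dw dw2]] := Ld.
apply: ae_imp (itg_section2 dw2) => r ir; split => //.
  exact: (measurableT_comp mw (pair2_measurable r)).
by move=> s sI; apply: (dw (s, r)) => -[].
Qed.

(** For almost every t the second time derivative is, for all x at once, the pairing of the slice
    [d (., Some t)] with [rep_x0 x]. It can therefore be differentiated in x at fixed t: twice by
    [is_deriv01_rep_ip], and a third time by [ae_derive_section]. *)
Lemma dxi3_deta2_of_data : {ae mu2, forall z, sqD z ->
  iter 3 dxi (iter 2 deta J) z.1 z.2 = data_w d z}.
Proof.
have iw := itg_data_w Ld; have [_ _ [mw dw _]] := Ld.
have A := @ae_snd _ _ _ _ R mu mu _ (ae_deriv_data_t1 Ld).
have B := @ae_snd _ _ _ _ R mu mu _ slice_w_L2.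
apply: ae_imp2 (ae_imp2 (fun z a b => conj a b) A B) (ae_derive_section iw).
move=> [x t] [/= At Lk] /= Dw [/= xI tI].
pose k : @rep R := fun o => d (o, Some t).
have D0 z : I01 z -> deta (deta J) z t = rep_ip k (rep_x0 z).
  move=> zI; apply: (is_deriv01E tI); apply: is_deriv01_ext (At tI z zI) => // s sI.
  by rewrite deta_of_data.
have D1 z : I01 z -> dxi (deta (deta J)) z t = rep_ip k (rep_x1 z).
  move=> zI; apply: (is_deriv01E zI).
  apply: is_deriv01_ext (is_deriv01_rep_ip Lk zI (rep_x0_deriv zI)) => // s sI.
  by rewrite D0.
have D2 z : I01 z -> dxi (dxi (deta (deta J))) z t = rep_ip k (rep_x2 z).
  move=> zI; apply: (is_deriv01E zI).
  apply: is_deriv01_ext (is_deriv01_rep_ip Lk zI (rep_x1_deriv zI)) => // s sI.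
  by rewrite D1.
have ik : itg mu (fun s => k (Some s)).
  by apply: L2_itg Lk; [exact: measurable_I01|exact: I01_lty].
have kE : (fun x => \int[mu]_s (k (Some s) * \1_I01 s * step x s)) =
    (fun x => \int[mu]_s (data_w d (s, t) * step x s)).
  apply/funext => z; apply: eq_Rintegral => s _; congr (_ * _).
  rewrite indicE; have [sI|sI] := boolP (s \in I01); first exact: mulr1.
  rewrite mulr0; symmetry; apply: (dw (s, t)) => -[h _].
  by move/negP: sI; apply; rewrite inE.
apply: (is_deriv01E xI).
have := @is_deriv01_rep_x2 R k x (data_w d (x, t)) ik; rewrite kE => /(_ Dw).
by apply: is_deriv01_ext => // z zI; rewrite D2.
Qed.

(** The increment is the pairing with the tensor of two differences of representers. Their weights
    at [None] cancel, so only [data_w d] contributes, and their densities are indicators of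
    intervals up to null sets. *)
Lemma rectangle_increment (a b a' b' : R) : 0 <= a -> a <= b -> b <= 1 ->
  0 <= a' -> a' <= b' -> b' <= 1 ->
  of_data_xxt b b' - of_data_xxt a b' - of_data_xxt b a' + of_data_xxt a a' =
  \int[mu2]_(z in [set` `]a, b[] `*` [set` `]a', b'[]) data_w d z.
Proof.
move=> a0 ab b1 a'0 ab' b'1.
have aI : I01 a by rewrite I01E a0 (le_trans ab).
have bI : I01 b by rewrite I01E b1 (le_trans a0).
have a'I : I01 a' by rewrite I01E a'0 (le_trans ab').
have b'I : I01 b' by rewrite I01E b'1 (le_trans a'0).
pose E := rep_x2 b - rep_x2 a; pose F := rep_t1 b' - rep_t1 a'.
have Eo : rep_ok E by apply: rep_okB; exact: rep_x2_ok.
have -> : of_data_xxt b b' - of_data_xxt a b' - of_data_xxt b a' + of_data_xxt a a' =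
    data_ip d (tens E F).
  rewrite data_ip_tensBr//; [|exact: rep_t1_ok|exact: rep_t1_ok].
  rewrite !data_ip_tensBl//; try exact: rep_x2_ok; try exact: rep_t1_ok.
  rewrite /of_data_xxt; move: (data_ip _ _) (data_ip _ _) (data_ip _ _) (data_ip _ _).
  by move=> p q r s; ring.
have EN : E None = 0 by exact: subrr.
have FN : F None = 0 by exact: subrr.
have ES s : E (Some s) = \1_I01 s * (step b s - step a s).
  rewrite mulrBr [LHS](_ : _ = rep_x2 b (Some s) - rep_x2 a (Some s) :> R)//=.
  by rewrite -mulrBr -mulrBr; congr (_ * _); ring.
have FS s : F (Some s) = \1_I01 s * (step b' s - step a' s).
  by rewrite mulrBr.
rewrite /data_ip.
have -> : \int[mu]_x (data_u d x * data_u (tens E F) x) = 0.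
  by rewrite -(Rintegral0 mu); apply: eq_Rintegral => x _;
    rewrite /data_u /tens FN /= !mulr0.
have -> : \int[mu]_x (data_v d x * data_v (tens E F) x) = 0.
  by rewrite -(Rintegral0 mu); apply: eq_Rintegral => x _;
    rewrite /data_v /tens EN /= mul0r mulr0.
have -> : data_c (tens E F) = 0 by rewrite /data_c /tens EN /= mul0r.
rewrite mulr0 !add0r.
rewrite [RHS]Rintegral_mkcond; apply: ae_eq_Rintegral.
have A := @ae_fst _ _ _ _ R mu mu _ (ae_neq a).
have B := @ae_snd _ _ _ _ R mu mu _ (ae_neq a').
apply: ae_imp2 A B => -[s r] /= sa ra _.
rewrite {2}/data_w /tens /= ES FS step_diff// step_diff// patchE !indicE.
have -> : ((s, r) \in [set` `]a, b[] `*` [set` `]a', b'[]) =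
    (s \in `]a, b[%classic) && (r \in `]a', b'[%classic).
  by apply/idP/andP; rewrite !inE.
by case: (s \in _); case: (r \in _); rewrite ?mulr1 ?mulr0.
Qed.

(** All increments are integrals: of [data_w d] over rectangles, of [data_u d] along t = 0, and of
    the contraction with [rep_x2 0] along x = 0. *)
Lemma abs_cont_sq_of_data : abs_cont_sq (iter 2 dxi (deta J)).
Proof.
have E x t : I01 x -> I01 t -> iter 2 dxi (deta J) x t = of_data_xxt x t.
  exact: dxi2_deta_of_data.
have ab_I (a b : R) : [/\ 0 <= a, a <= b & b <= 1] -> I01 a /\ I01 b.
  by move=> [a0 ab b1]; rewrite !I01E a0 b1 (le_trans ab) ?(le_trans a0).
have len (a b : R) : a <= b -> (mu [set` `]a, b[] = (b - a)%:E)%E.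
  rewrite le_eqVlt => /predU1P[->|ab]; last by rewrite lebesgue_measure_itv/= lte_fin ab.
  by rewrite lebesgue_measure_itv/= lte_fin ltxx subrr.
have ac (k : rep) (g : R -> R) : itg mu (fun s => k (Some s)) ->
    (forall a b, 0 <= a -> a <= b -> b <= 1 ->
       g b - g a = \int[mu]_(s in `]a, b[) k (Some s)) -> abs_cont01 g.
  move=> ik gk e e0; have [r r0 rP] := sum_Rint_small ik e0.
  exists r => // n a b ab tr sr.
  rewrite (eq_bigr (fun i => `|\int[mu]_(s in `]a i, b i[) k (Some s)|)); last first.
    by move=> i _; have [a0 ab' b1] := ab i; rewrite gk.
  apply: (rP n (fun i => [set` `]a i, b i[]) (fun i => b i - a i)) => // i.
  by have [_ ab' _] := ab i; exact: len.
split.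
- move=> e e0; have [r r0 rP] := sum_Rint_small (itg_data_w Ld) e0.
  exists r => // n a b a' b' ab ab' tr sr.
  rewrite (eq_bigr (fun i => `|\int[mu2]_(z in [set` `]a i, b i[] `*`
      [set` `]a' i, b' i[]) data_w d z|)); last first.
    move=> i _; have [aI bI] := ab_I _ _ (ab i); have [a'I b'I] := ab_I _ _ (ab' i).
    have [a0 abi b1] := ab i; have [a'0 abi' b'1] := ab' i.
    by rewrite !E// rectangle_increment.
  apply: (rP n (fun i => [set` `]a i, b i[] `*` [set` `]a' i, b' i[])
    (fun i => (b i - a i) * (b' i - a' i))) => // i.
    by apply: measurableX; exact: measurable_itv.
  have [_ abi _] := ab i; have [_ abi' _] := ab' i.
  transitivity (mu [set` `]a i, b i[] * mu [set` `]a' i, b' i[])%E.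
    by apply: product_measure1E; exact: measurable_itv.
  by rewrite !len.
- pose k : @rep R := fun o => d (o, None).
  have ik : itg mu (fun s => k (Some s)).
    by apply: L2_itg slice_u_L2; [exact: measurable_I01|exact: I01_lty].
  apply: (ac k) => // a b a0 ab b1; have [aI bI] : I01 a /\ I01 b by exact: ab_I.
  rewrite !E//; try exact: I01_0.
  by rewrite /of_data_xxt rep_t1_at0 !data_ip_unitr rep_ip_x2_increment.
- pose k := contr d (rep_x2 0); have I0 := I01_0.
  have ik : itg mu (fun s => k (Some s)) by apply: itg_contr => //; exact: rep_x2_ok.
  apply: (ac k) => // a b a0 ab b1; have [aI bI] : I01 a /\ I01 b by exact: ab_I.
  rewrite !E// /of_data_xxt !data_ip_contr//; try exact: rep_x2_ok; try exact: rep_t1_ok.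
  by rewrite rep_ip_t1_increment.
Qed.

Lemma W32_of_data : W32 J.
Proof.
have [du dv dw] := Ld; have mI := @measurable_I01 R.
split.
- move=> x t xI tI; split.
  + exact: is_deriv01_derivable (is_deriv01_of_data_t xI tI).
  + exact: is_deriv01_derivable (is_deriv01_deta_of_data xI tI).
  + exact: is_deriv01_derivable (is_deriv01_dxi_deta_of_data xI tI).
- exact: abs_cont_sq_of_data.
- exact: in_L2_intro measurable_sqD dw dxi3_deta2_of_data.
- exact: of_data_boundary.
- have Z : L2 mu I01 (fun=> 0 : R) by apply: L2_0; [exact: mI|exact: I01_lty].
  split.
  + move=> [[|[|//]] i2] /=; last exact: in_L2_intro mI dv deta2_dxi_of_data.
    by apply: (in_L2_intro mI Z); apply: aeW => t tI; exact: deta2_of_data_0.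
  + by apply: (in_L2_intro mI Z); apply: aeW => t tI; exact: deta2_of_data_1.
  + move=> [[|[|//]] i2] /=; last exact: in_L2_intro mI du deriv01_3_deta_of_data.
    by apply: (in_L2_intro mI Z); apply: aeW => t tI; exact: deriv01_3_of_data_0.
Qed.

Lemma deriv01_deta_of_data_00 : deriv01 (deta J ^~ 0) 0 = data_c d.
Proof.
have I0 := I01_0; rewrite (is_deriv01E I0 (is_deriv01_deta_of_data I0 I0)).
rewrite /of_data_xt rep_t1_at0 data_ip_unitr rep_x1_at0 /rep_ip.
have -> : \int[mu]_x (d (Some x, None) * rep_unit (Some x)) = 0.
  by rewrite -(Rintegral0 mu); apply: eq_Rintegral => x _; rewrite rep_unit_Some mulr0.
by rewrite addr0; exact: mulr1.
Qed.

End Reconstruction.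

(** * Isometry between data and functions *)

Section Isometry.
Context {R : realType}.
Notation mu := (@lebesgue_measure R).
Notation mu2 := (mu \x mu)%E.

Lemma Rint_supported d (T : measurableType d) (m : {measure set T -> \bar R})
    (D : set T) (h f : T -> R) : (forall x, ~ D x -> f x = 0) ->
  {ae m, forall x, D x -> h x = f x} ->
  \int[m]_(x in D) h x = \int[m]_x f x.
Proof.
move=> Df hf; rewrite [RHS](_ : _ = \int[m]_(x in D) f x).
  exact: ae_eq_Rintegral.
rewrite [RHS]Rintegral_mkcond; apply: eq_Rintegral => x _; rewrite patchE.
by case: ifPn => // /negP xD; apply: Df => Dx; apply: xD; rewrite inE.
Qed.

(** The boundary conditions kill the terms i = 0, x = 1 and j = 0, as well as the point values at 0
    and 1 in the term j = 1. What remains is v from i = 1, c and u from j = 1, and w. *)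
Lemma W32_inner_of_data (d d' : @data R) : data_L2 d -> data_L2 d' ->
  W32_inner (of_data d) (of_data d') = data_ip d d'.
Proof.
move=> Ld Ld'; have [[_ du _] [_ dv _] [_ dw _]] := Ld.
have z0 (g : R -> R) (A : set R) : (forall x, A x -> g x = 0) -> \int[mu]_(x in A) g x = 0.
  move=> gA; rewrite -(Rintegral0 mu) [RHS](_ : _ = \int[mu]_(x in A) (0:R)).
    by apply: eq_Rintegral => x; rewrite inE => /gA.
  rewrite [RHS]Rintegral_mkcond; apply: eq_Rintegral => x _; rewrite patchE.
  by case: ifP.
have I0 := @I01_0 R; have I1 := @I01_1 R.
apply: (@sum4_eq _ _ _ _ _ (\int[mu]_x (data_v d x * data_v d' x)) 0
  (data_c d * data_c d' + \int[mu]_x (data_u d x * data_u d' x))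
  (\int[mu2]_z (data_w d z * data_w d' z))).
- rewrite big_ord_recl big_ord1; apply: add0_eq.
    by apply: z0 => t tI; apply: mul0_eq; exact: deta2_of_data_0.
  apply: Rint_supported; first by move=> x xI; rewrite dv// mul0r.
  apply: ae_imp2 (deta2_dxi_of_data Ld) (deta2_dxi_of_data Ld') => x a b xI.
  by apply: mul_eq; [exact: a|exact: b].
- by apply: z0 => t tI; apply: mul0_eq; exact: deta2_of_data_1.
- rewrite big_ord_recl big_ord1; apply: add0_eq.
    apply: (@sum4_eq _ _ _ _ _ 0 0 0 0); last by rewrite !addr0.
    + by apply: mul0_eq; have [] := of_data_boundary d I0.
    + by apply: mul0_eq; apply: deriv01_zero => // z zI; have [] := of_data_boundary d zI.
    + by apply: mul0_eq; have [] := of_data_boundary d I1.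
    + by apply: z0 => x xI; apply: mul0_eq; exact: deriv01_3_of_data_0.
  apply: (@sum4_eq _ _ _ _ _ 0 (data_c d * data_c d') 0
    (\int[mu]_x (data_u d x * data_u d' x))); last by rewrite add0r addr0.
  + by apply: mul0_eq; rewrite /= (deta_of_data Ld I0 I0) /of_data_t rep_x0_at0 tens0l data_ip0.
  + by apply: mul_eq; exact: deriv01_deta_of_data_00.
  + by apply: mul0_eq; rewrite /= (deta_of_data Ld I1 I0) /of_data_t rep_x0_at1 tens0l data_ip0.
  + apply: Rint_supported; first by move=> x xI; rewrite du// mul0r.
    apply: ae_imp2 (deriv01_3_deta_of_data Ld) (deriv01_3_deta_of_data Ld') => x a b xI.
    by apply: mul_eq; [exact: a|exact: b].
- apply: Rint_supported; first by move=> x xI; rewrite dw// mul0r.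
  apply: ae_imp2 (dxi3_deta2_of_data Ld) (dxi3_deta2_of_data Ld') => x a b xI.
  by apply: mul_eq; [exact: a|exact: b].
- rewrite /data_ip; move: (data_c d * _) (Rintegral _ _ _) (Rintegral _ _ _) (Rintegral _ _ _).
  by move=> p q r s; ring.
Qed.

End Isometry.

(** * The Caputo derivative *)

Section Power_integrals.
Context {R : realType}.
Notation mu := (@lebesgue_measure R).

Lemma is_derive_FTC2 (f F : R -> R) (a b : R) : a < b ->
  (forall x, a <= x <= b -> is_derive x 1 F (f x)) ->
  (forall x, a <= x <= b -> {for x, continuous f}) ->
  (\int[mu]_(x in `[a, b]) (f x)%:E = (F b - F a)%:E)%E.
Proof.
move=> ab dF cf.
have cF x : a <= x <= b -> {for x, continuous F}.
  move=> xab; apply/differentiable_continuous/derivable1_diffP.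
  by have [] := dF x xab.
have xab x : x \in `]a, b[ -> a <= x <= b.
  by rewrite in_itv/= => /andP[? ?]; apply/andP; split; exact: ltW.
rewrite EFinB; apply: continuous_FTC2 => //.
- apply/continuous_in_subspaceT => x; rewrite inE/= in_itv/=; exact: cf.
- split.
  + by move=> x /xab/dF[].
  + by apply: cvg_at_right_filter; apply: cF; rewrite lexx ltW.
  + by apply: cvg_at_left_filter; apply: cF; rewrite lexx ltW.
- by move=> x /xab/dF[_ Fx]; rewrite derive1E.
Qed.

Lemma is_derive_powR_sub (g t x : R) : x < t ->
  is_derive x 1 (fun r => (t - r) `^ g) (- (g * (t - x) `^ (g - 1))).
Proof.
move=> xt; have tx : 0 < t - x by rewrite subr_gt0.
have D : is_derive x 1 (fun r : R => t - r) (-1).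
  have := @is_deriveB _ _ _ (cst t) id x (1 : R) _ _ (is_derive_cst t x 1) (is_derive_id x 1).
  by rewrite sub0r.
have := @is_derive1_comp R (fun z : R => z `^ g) (fun r => t - r) x _ _ (is_derive1_powR g tx) D.
by rewrite mulrN1.
Qed.

(** For b < 0 the integrand is singular at t. The fundamental theorem is applied on [s, u n] with u
    n increasing to t, and monotone convergence gives integrability and the value. *)
Lemma Rint_powR (b s t : R) : -1 < b -> s <= t ->
  itg mu (fun r => \1_(`[s, t[) r * (t - r) `^ b) /\
  \int[mu]_r (\1_(`[s, t[) r * (t - r) `^ b) = (t - s) `^ (b + 1) / (b + 1).
Proof.
move=> b1; have g0 : 0 < b + 1 by lra.
rewrite le_eqVlt => /predU1P[->|st].
  have E : (fun r => \1_(`[t, t[) r * (t - r) `^ b) = (fun=> 0).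
    by apply/funext => r; rewrite set_itvco0 indicE in_set0 mul0r.
  rewrite E; split; first exact: itg0.
  by rewrite Rintegral0 subrr powR0 ?mul0r// gt_eqF.
pose f r := (t - r) `^ b; pose F r := - ((t - r) `^ (b + 1) / (b + 1)).
have mf : measurable_fun setT f.
  by apply: (measurableT_comp (measurable_powR b)); exact: measurable_funB.
have dF r : r < t -> is_derive r 1 F (f r).
  move=> rt; have H := is_derive_powR_sub (b + 1) rt.
  have -> : F = (fun r => (- (b + 1)^-1) *: ((t - r) `^ (b + 1))).
    by apply/funext => z; rewrite /F /GRing.scale /= mulNr mulrC.
  apply: is_derive_eq; rewrite /f addrK /GRing.scale /=.
  by rewrite mulrN mulNr opprK mulrA mulVf ?mul1r// gt_eqF.
have cf r : r < t -> {for r, continuous f}.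
  move=> rt; apply/differentiable_continuous/derivable1_diffP.
  by have [] := is_derive_powR_sub b rt.
(* The index shift to [n.+2] keeps [u n] strictly between s and t. *)
pose u (n : nat) := t - (t - s) * n.+2%:R^-1.
have n2 (n : nat) : 0 < (n.+2%:R^-1 : R) < 1.
  apply/andP; split; first by rewrite invr_gt0 ltr0n.
  by rewrite invf_lt1 ?ltr0n// ltr1n.
have su n : s < u n.
  have /andP[_ n1] := n2 n.
  by rewrite /u ltrBrDr -ltrBrDl gtr_pMr ?subr_gt0.
have ut n : u n < t.
  have /andP[n0 _] := n2 n.
  by rewrite /u ltrBlDr ltrDl mulr_gt0 ?subr_gt0.
have Iu n : (\int[mu]_(x in `[s, u n]) (f x)%:E = (F (u n) - F s)%:E)%E.
  apply: is_derive_FTC2; [exact: su| |].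
    by move=> x /andP[_ xu]; apply: dF; exact: le_lt_trans (ut n).
  by move=> x /andP[_ xu]; apply: cf; exact: le_lt_trans (ut n).
have cup : \bigcup_n `[s, u n]%classic = `[s, t[%classic.
  apply/seteqP; split => x /=.
    by move=> [n _] /=; rewrite !in_itv/= => /andP[-> xu]; exact: le_lt_trans (ut n).
  rewrite in_itv/= => /andP[sx xt].
  have xt' : 0 < (t - x) / (t - s) by rewrite divr_gt0// subr_gt0.
  have /cvgrPdist_lt/(_ _ xt')[n _ /(_ n (leqnn n))] := @cvg_harmonic R.
  rewrite /= sub0r normrN ger0_norm// => h; exists n => //=.
  rewrite in_itv/= sx/= /u.
  have : n.+2%:R^-1 < (t - x) / (t - s) by apply: le_lt_trans h; rewrite lef_pV2// ?posrE// ler_nat.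
  by rewrite ltr_pdivlMr ?subr_gt0//; move: (n.+2%:R^-1) => q; lra.
have nd : nondecreasing_seq (fun n => `[s, u n]%classic).
  move=> n k nk; apply/subsetPset; apply: subset_itvl; rewrite bnd_simp /u.
  have : k.+2%:R^-1 <= n.+2%:R^-1 :> R by rewrite lef_pV2// ?posrE// ler_nat ltnS.
  by move=> h; rewrite lerD2l lerN2 ler_wpM2l// subr_ge0 ltW.
have cvg1 : (F (u n) - F s)%:E @[n --> \oo] --> (\int[mu]_(x in `[s, t[) (f x)%:E)%E.
  have C : (\int[mu]_(x in `[s, u n]) (f x)%:E)%E @[n --> \oo] -->
      (\int[mu]_(x in \bigcup_n `[s, u n]%classic) (f x)%:E)%E.
    apply: ge0_nondecreasing_set_cvg_integral => //.
    - by move=> n; apply: measurable_funTS; exact/measurable_EFinP.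
    - by move=> n x _; rewrite lee_fin powR_ge0.
  rewrite cup in C.
  by apply: cvg_trans C; apply: near_eq_cvg; apply: nearW => n; rewrite Iu.
have cvg2 : (F (u n) - F s)%:E @[n --> \oo] --> (0 - F s)%:E.
  apply: cvg_EFin; first exact: nearW.
  apply: cvgB; last exact: cvg_cst.
  have /cvg_at_rightP H := @powR_cvg0 R (b + 1) g0.
  have ux : (t - s) * n.+2%:R^-1 @[n --> \oo] --> (0 : R).
    rewrite -[X in _ --> X](mulr0 (t - s)); apply: cvgM; first exact: cvg_cst.
    by have := @cvg_harmonic R; rewrite -cvg_shiftS.
  have P0 : ((t - s) * n.+2%:R^-1) `^ (b + 1) @[n --> \oo] --> (0 : R).
    apply: H; split => // n; rewrite mulr_gt0 ?subr_gt0//.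
  have -> : (0 : R) = - (0 / (b + 1)) by rewrite mul0r oppr0.
  apply: cvgN; apply: cvgM; last exact: cvg_cst.
  apply: cvg_trans P0; apply: near_eq_cvg; apply: nearW => n.
  by rewrite /u subKr.
have E : (\int[mu]_(x in `[s, t[) (f x)%:E)%E = (0 - F s)%:E.
  exact: (cvg_unique _ cvg1 cvg2).
have Ei : (\int[mu]_r (\1_(`[s, t[) r * f r)%:E)%E = (0 - F s)%:E.
  rewrite -E [in RHS]integral_mkcond; apply: eq_integral => r _.
  by rewrite patchE indicE; case: ifP => _; rewrite ?mul1r ?mul0r.
split; last by rewrite /Rintegral -/(f _) Ei /= sub0r opprK.
apply/integrableP; split.
  apply/measurable_EFinP; apply: measurable_funM; last exact: mf.
  exact: measurable_indic.
under eq_integral => r _.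
  rewrite /= ger0_norm; last by rewrite mulr_ge0// powR_ge0.
  over.
by rewrite Ei ltry.
Qed.

Lemma Rint_powR_step (b s t : R) : -1 < b -> 0 <= s ->
  itg mu (fun r => \1_(`]0, t[) r * (t - r) `^ b * step r s) /\
  \int[mu]_r (\1_(`]0, t[) r * (t - r) `^ b * step r s) =
    (t - s) `^ (b + 1) / (b + 1) * step t s.
Proof.
move=> b1 s0; have [st|ts] := ltP s t; last first.
  have E : (fun r => \1_(`]0, t[) r * (t - r) `^ b * step r s) = (fun=> 0).
    apply/funext => r; rewrite indicE mem_setE in_itv /= /step.
    have [sr|_] := ltP s r; last by rewrite mulr0.
    by rewrite [r < t]ltNge (le_trans ts (ltW sr)) andbF !mul0r.
  by rewrite E (step_ge ts) mulr0; split; [exact: itg0|exact: Rintegral0].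
have [i1 e1] := Rint_powR b1 (ltW st).
have ae_eq : {ae mu, forall r, (\1_(`[s, t[) r * (t - r) `^ b =
    \1_(`]0, t[) r * (t - r) `^ b * step r s)}.
  apply: ae_imp (ae_neq s) => r rs; rewrite !indicE !mem_setE !in_itv /= /step.
  have [sr|sr] := ltP s r.
    by rewrite (ltW sr) (le_lt_trans s0 sr) mulr1.
  have rs' : r < s by rewrite lt_neqAle rs sr.
  by rewrite [s <= r]leNgt rs' /= mul0r mulr0.
have m2 : measurable_fun setT (fun r => \1_(`]0, t[) r * (t - r) `^ b * step r s).
  apply: measurable_funM; last first.
    have -> : (fun r => step r s) = \1_(`]s, +oo[).
      by apply/funext => r; rewrite indicE mem_setE in_itv /= andbT.
    exact: measurable_indic.
  apply: measurable_funM; first exact: measurable_indic.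
  by apply: (measurableT_comp (measurable_powR b)); exact: measurable_funB.
split.
  apply/integrableP; split; first exact/measurable_EFinP.
  rewrite [X in (X < _)%E](_ : _ =
      (\int[mu]_r `|(\1_(`[s, t[) r * (t - r) `^ b)%:E|)%E).
    by have /integrableP[] := i1.
  by apply: ae_eq_integral_nonmeasurable; apply: ae_imp ae_eq => r /= -> _.
rewrite -[in RHS]e1; have -> : step t s = 1 by rewrite /step st.
rewrite mulr1; apply: ae_eq_Rintegral; apply: ae_imp ae_eq => r -> _ //.
Qed.

End Power_integrals.

(** * Fractional integrals under the pairing *)

Section Caputo.
Context {R : realType}.
Notation mu := (@lebesgue_measure R).
Notation mu2 := (mu \x mu)%E.
Variable alpha : R.
Hypothesis alpha1 : alpha < 1.

(** The integral of [rep_t1 r] against (t - r)^(- alpha) over 0 < r < t, component by component;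
    [Rint_frac] justifies the exchange with the pairing by Fubini's theorem. *)
Definition rep_frac (t : R) : rep := mkrep (t `^ (1 - alpha) / (1 - alpha))
  (fun s => (t - s) `^ (1 - alpha) / (1 - alpha) * step t s).

Lemma Rint_frac (k : rep) (t : R) : 0 <= t -> itg mu (fun s => k (Some s)) ->
  \int[mu]_(r in `]0, t[) (rep_ip k (rep_t1 r) / (t - r) `^ alpha) =
  rep_ip k (rep_frac t).
Proof.
move=> t0 ik; have a1 : - 1 < - alpha by rewrite ltrN2.
have E1 : - alpha + 1 = 1 - alpha by ring.
pose phi r := \1_(`]0, t[) r * (t - r) `^ (- alpha).
have P s := @Rint_powR_step R (- alpha) s t a1.
have phi_step s : 0 <= s -> itg mu (fun r => phi r * step r s) /\
   \int[mu]_r (phi r * step r s) = (t - s) `^ (1 - alpha) / (1 - alpha) * step t s.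
  by move=> /P; rewrite E1.
have phi1 r : phi r * step r 0 = phi r.
  rewrite /phi indicE mem_setE in_itv /= /step.
  by case: ltP => //= _; rewrite ?mulr1// !mul0r.
have iphi : itg mu phi.
  by have [+ _] := phi_step 0 (lexx _); congr itg; apply/funext => r; exact: phi1.
have ephi : \int[mu]_r phi r = t `^ (1 - alpha) / (1 - alpha).
  have [_] := phi_step 0 (lexx _); rewrite subr0.
  rewrite (_ : \int[mu]_r (phi r * step r 0) = \int[mu]_r phi r); last first.
    by apply: eq_Rintegral => r _; exact: phi1.
  move=> ->; rewrite /step; case: ltP => [_|]; first by rewrite mulr1.
  move=> t0'; have -> : t = 0 by apply/eqP; rewrite eq_le t0 t0'.
  by rewrite powR0 ?mul0r// gt_eqF// subr_gt0.
have m_step : measurable_fun setT (fun z : R * R => step z.2 z.1).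
  have -> : (fun z : R * R => step z.2 z.1) = \1_[set z | z.1 < z.2].
    apply/funext => z; rewrite indicE /step; case: ltP => h.
      by rewrite mem_set.
    by rewrite memNset//= => /(le_lt_trans h); rewrite ltxx.
  apply: measurable_indic.
  have m1 : measurable_fun setT (fun z : R * R => z.1 < z.2).
    by apply: measurable_fun_ltr.
  have := m1 measurableT [set true] I; rewrite setTI.
  by congr measurable; apply/seteqP; split => z /=.
pose g (z : R * R) := k (Some z.1) * \1_I01 z.1 * phi z.2 * step z.2 z.1 : R.
have ikx : itg mu (fun s => k (Some s) * \1_I01 s).
  apply: (itg_bounded_mul (K := 1)) => //.
    by apply: measurable_indic; exact: measurable_I01.
  by move=> s; rewrite indicE; case: (_ \in _); rewrite ?normr1 ?normr0.
have ig : itg mu2 g.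
  have ip := @itg_prod _ _ _ _ R mu mu (fun s => k (Some s) * \1_I01 s) phi ikx iphi.
  by apply: (itg_bounded_mul (K := 1) ip m_step) => z; exact: step_norm.
transitivity (\int[mu]_r (k None * phi r + \int[mu]_s g (s, r))).
  rewrite Rintegral_mkcond; apply: eq_Rintegral => r _.
  rewrite patchE /g /phi indicE; case: ifP => _; last first.
    rewrite mul0r mulr0 add0r -[LHS](Rintegral0 mu).
    by apply: eq_Rintegral => s _; rewrite mulr0 mul0r.
  rewrite mul1r powRN /rep_ip mulrDl /= mulr1; congr (_ + _).
  rewrite mulrC -RintZ.
    by apply: eq_Rintegral => s _; 
      move: (k _ : R) (\1_I01 s) (step r s) => p q u; ring.
  apply: (itg_rep_bounded (K := 1)) => //; first exact: measurable_step.
  by move=> s _; exact: step_norm.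
rewrite RintD; [|exact: itgZ|exact: (@itg_Fubini2 _ _ _ _ R mu mu)].
rewrite RintZ// ephi -(@Rint_Fubini2 _ _ _ _ R mu mu)// (@Rint_Fubini1 _ _ _ _ R mu mu)//.
rewrite /rep_ip /rep_frac /=; congr (_ + _).
apply: eq_Rintegral => s _; rewrite /g /= indicE.
have [sI|sI] := boolP (s \in I01); last first.
  transitivity (0 : R); last by rewrite mul0r mulr0.
  apply: (eq_trans _ (Rintegral0 mu)).
  by apply: eq_Rintegral => r _; rewrite mulr0 !mul0r.
rewrite inE I01E in sI; have /andP[s0 _] := sI.
have [i2 e2] := phi_step s s0.
rewrite mul1r -e2 -RintZ//; apply: eq_Rintegral => r _.
by rewrite mulr1 -mulrA.
Qed.

End Caputo.

(** * Positivity of the Gamma function *)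

Section Gamma_positive.
Context {R : realType}.
Notation mu := (@lebesgue_measure R).

Lemma powR_le1D (s g : R) : 0 <= s -> 0 < g -> g <= 1 -> s `^ g <= 1 + s.
Proof.
move=> s0 g0 g1; have [s1|/ltW s1] := leP s 1.
  apply: (@le_trans _ _ 1); last by rewrite lerDl.
  have e1 : (1 : R) `^ g = 1 by rewrite powR1.
  by rewrite -[leRHS]e1; apply: ge0_ler_powR; rewrite ?nnegrE// ltW.
apply: (@le_trans _ _ s); last by rewrite lerDr.
by apply: ler1_powR.
Qed.

(* [(1 - a) s^(- a) e^(- s) = (s^(1 - a) e^(- s))' + s^(1 - a) e^(- s)], and the
   last term is at most [(1 + s) e^(- s) = - ((2 + s) e^(- s))']. *)
Lemma Gamma_gt0 (a : R) : 0 < a -> a < 1 -> 0 < Gamma (1 - a).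
Proof.
move=> a0 a1; have g0 : 0 < 1 - a by rewrite subr_gt0.
have g1 : 1 - a <= 1 by rewrite gerBl ltW.
have gE : 1 - a - 1 = - a by ring.
rewrite /Gamma gE.
pose f (s : R) := s `^ (- a) * expR (- s).
pose h (s : R) := f s + ((1 + s) - s `^ (1 - a)) * expR (- s) / (1 - a).
pose P (s : R) := (s `^ (1 - a) * expR (- s) - (2 + s) * expR (- s)) / (1 - a).
have mf : measurable_fun setT f.
  apply: measurable_funM; first exact: measurable_powR.
  by apply: (measurableT_comp (@measurable_expR R)); exact: measurable_funN.
have f0 s : 0 <= f s by rewrite mulr_ge0 ?powR_ge0 ?expR_ge0.
have fh (s : R) : 0 < s -> f s <= h s.
  move=> s0; rewrite lerDl divr_ge0 ?(ltW g0)// mulr_ge0 ?expR_ge0//.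
  by rewrite subr_ge0; apply: powR_le1D => //; exact: ltW.
have dE (s : R) : is_derive s 1 (fun s => expR (- s)) (- expR (- s)).
  have N := @is_deriveN _ _ _ id s (1 : R) 1 (is_derive_id s 1).
  have := @is_derive1_comp R expR (fun s => - s) s _ _ (is_derive_expR (- s)) N.
  by rewrite mulrN1.
have dP (s : R) : 0 < s -> is_derive s 1 P (h s).
  move=> s0; have D1 := is_derive1_powR (1 - a) s0.
  have D2 := @is_deriveM R _ _ _ s (1 : R) _ _ D1 (dE s).
  have D0 : is_derive s (1 : R) (fun s : R => 2 + s) (1 : R).
    apply: is_derive_eq (is_deriveD (is_derive_cst (2 : R) s 1) (is_derive_id s 1)) _.
    by rewrite add0r.
  have D3 := @is_deriveM R _ (fun s : R => 2 + s) _ s (1 : R) _ _ D0 (dE s).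
  have D4 := is_deriveZ ((1 - a)^-1) (is_deriveB D2 D3).
  have -> : P = (1 - a)^-1 *: ((fun s : R => s `^ (1 - a)) * (fun s => expR (- s)) -
      (fun s : R => 2 + s) * (fun s => expR (- s))).
    by apply/funext => z; rewrite /P mulrC.
  apply: is_derive_eq D4 _; rewrite /h /f gE /GRing.scale /=.
  by field; rewrite gt_eqF.
have cpow (b s : R) : 0 < s -> {for s, continuous (fun s : R => s `^ b)}.
  move=> s0; apply/differentiable_continuous/derivable1_diffP.
  by have [] := is_derive1_powR b s0.
have cexp (s : R) : {for s, continuous (fun s : R => expR (- s))}.
  by apply/differentiable_continuous/derivable1_diffP; have [] := dE s.
have ch (s : R) : 0 < s -> {for s, continuous h}.
  move=> s0; apply: cvgD; first by apply: cvgM; [exact: cpow|exact: cexp].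
  apply: cvgM; last exact: cvg_cst.
  apply: cvgM; last exact: cexp.
  apply: cvgB; last exact: cpow.
  by apply: cvgD; [exact: cvg_cst|exact: cvg_id].
have P_le0 (s : R) : 0 < s -> P s <= 0.
  move=> s0; rewrite /P -mulrBl pmulr_lle0 ?invr_gt0// pmulr_lle0 ?expR_gt0//.
  by have := powR_le1D (ltW s0) g0 g1; lra.
have P_ge (s : R) : 0 < s -> - (2 / (1 - a)) <= P s.
  move=> s0; rewrite -mulNr ler_pM2r ?invr_gt0//.
  have e0 := expR_ge0 (- s); have p0 := powR_ge0 s (1 - a).
  have : (2 + s) * expR (- s) <= 2.
    rewrite expRN ler_pdivrMr ?expR_gt0//; have := @expR_ge1Dx R s; lra.
  by have := mulr_ge0 p0 e0; lra.
pose A n := `[(n.+1%:R^-1 : R), n.+1%:R]%classic.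
have mA n : measurable (A n : set (measurableTypeR R)) by exact: measurable_itv.
have IA n : (\int[mu]_(s in A n) (f s)%:E <= (2 / (1 - a))%:E)%E.
  have [n0|n0] := eqVneq n 0%N.
    by rewrite /A n0 invr1 set_itv1 integral_set1 lee_fin divr_ge0// ltW.
  have pos (s : R) : (n.+1%:R^-1 : R) <= s -> 0 < s.
    by apply: lt_le_trans; rewrite invr_gt0.
  have lt : (n.+1%:R^-1 : R) < n.+1%:R.
    apply: (@lt_trans _ _ 1); first by rewrite invf_lt1// ltr1n ltnS lt0n.
    by rewrite ltr1n ltnS lt0n.
  apply: (@le_trans _ _ (\int[mu]_(s in A n) (h s)%:E)%E).
    apply: ge0_le_integral => //.
    - by move=> s _; rewrite /= lee_fin.
    - by apply: measurable_funTS; exact/measurable_EFinP.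
    - apply/measurable_EFinP.
      apply: subspace_continuous_measurable_fun; first exact: mA.
      apply: continuous_in_subspaceT => s; rewrite inE /A /= in_itv/= => /andP[s0 _].
      exact/ch/pos.
    - by move=> s; rewrite /A /= in_itv/= => /andP[s0 _]; rewrite lee_fin fh//; exact: pos.
  have hD (s : R) : n.+1%:R^-1 <= s <= n.+1%:R -> is_derive s 1 P (h s).
    by move=> /andP[s0 _]; apply: dP; exact: pos.
  have hC (s : R) : n.+1%:R^-1 <= s <= n.+1%:R -> {for s, continuous h}.
    by move=> /andP[s0 _]; apply: ch; exact: pos.
  rewrite (is_derive_FTC2 lt hD hC) lee_fin.
  have := P_le0 _ (pos _ (ltW lt)); have := P_ge _ (pos _ (lexx _)); lra.
have cup : \bigcup_n A n = `]0, +oo[%classic.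
  apply/seteqP; split => s /=.
    move=> [n _]; rewrite /A /= !in_itv/= andbT => /andP[+ _].
    by apply: lt_le_trans; rewrite invr_gt0.
  rewrite in_itv/= andbT => s0.
  have /cvgrPdist_lt/(_ _ s0)[n _ /(_ n (leqnn n))] := @cvg_harmonic R.
  rewrite /= sub0r normrN ger0_norm// => h1.
  have [m sm] : exists m : nat, s <= m%:R.
    by exists (Num.truncn s).+1; rewrite ltW// truncnS_gt.
  exists (maxn n m) => //; rewrite /A /= in_itv/=; apply/andP; split.
    apply: le_trans (ltW h1); rewrite lef_pV2 ?posrE// ler_nat ltnS; exact: leq_maxl.
  apply: le_trans sm _; rewrite ler_nat; apply: leq_trans (leqnSn _); exact: leq_maxr.
have nd : nondecreasing_seq A.
  move=> n k nk; apply/subsetPset => s; rewrite /A /= !in_itv/= => /andP[s1 s2].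
  apply/andP; split.
    by apply: le_trans s1; rewrite lef_pV2 ?posrE// ler_nat ltnS.
  by apply: le_trans s2 _; rewrite ler_nat ltnS.
(* An upper bound is required for positivity, since [Rintegral] returns 0 on an infinite
   integral. *)
have up : (\int[mu]_(s in `]0%R, +oo[) (f s)%:E <= (2 / (1 - a))%:E)%E.
  rewrite -cup; have C : (\int[mu]_(x in A n) (f x)%:E)%E @[n --> \oo] -->
      (\int[mu]_(x in \bigcup_n A n) (f x)%:E)%E.
    apply: ge0_nondecreasing_set_cvg_integral => //.
    - by move=> n; apply: measurable_funTS; exact/measurable_EFinP.
    - by move=> n x _; rewrite /= lee_fin.
  rewrite -(cvg_lim _ C)//; apply: lime_le; first by apply/cvg_ex; eexists; exact: C.
  exact: nearW.
have lo : ((expR (-1))%:E <= \int[mu]_(s in `]0%R, +oo[) (f s)%:E)%E.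
  apply: (@le_trans _ _ (\int[mu]_(s in `]0%R, 1%R[) (expR (- 1))%:E)%E).
    rewrite integral_cst//= lebesgue_measure_itv/= lte01 sube0 mule1//.
  apply: (@le_trans _ _ (\int[mu]_(s in `]0%R, 1%R[) (f s)%:E)%E).
    apply: ge0_le_integral => //.
    - by apply: measurable_funTS; exact/measurable_EFinP.
    - move=> s /=; rewrite in_itv/= => /andP[s0 s1]; rewrite lee_fin /f.
      rewrite -[leLHS]mul1r ler_pM ?expR_ge0//; last by rewrite ler_expR lerN2 ltW.
      rewrite powRN -[leLHS]invr1 lef_pV2 ?posrE ?powR_gt0//.
      have e1 : (1 : R) `^ a = 1 by rewrite powR1.
      by rewrite -[leRHS]e1; apply: ge0_ler_powR; rewrite ?nnegrE// ltW.
  apply: ge0_subset_integral => //.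
  - by apply: measurable_funTS; exact/measurable_EFinP.
  - by move=> s _; rewrite /= lee_fin.
  - by move=> s /=; rewrite !in_itv/= andbT => /andP[].
rewrite /Rintegral -/(f _).
have fin : (\int[mu]_(s in `]0%R, +oo[) (f s)%:E)%E \is a fin_num.
  rewrite ge0_fin_numE; first by apply: le_lt_trans up _; rewrite ltry.
  by apply: integral_ge0 => s _; rewrite lee_fin.
by rewrite -lte_fin fineK//; apply: lt_le_trans lo; rewrite lte_fin expR_gt0.
Qed.

End Gamma_positive.

(** * Continuity of the representers in the point *)

Section Rep_continuity.
Context {R : realType}.

Lemma rep_deriv_continuous (e : R -> rep) (x : R) (e' : rep) (u : nat -> R) :
  I01 x -> rep_deriv e x e' -> (forall n, I01 (u n)) -> u @ \oo --> x ->
  rep_cvg (fun n => e (u n)) (e x).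
Proof.
move=> xI [eo _ [K eK] _ _] uI ux.
have C o : (fun n => e (u n) o : R) @ \oo --> (e x o : R).
  apply/subr_cvg0/norm_cvg0P.
  have : K * `|u n - x| @[n --> \oo] --> 0.
    rewrite -[X in _ --> X](mulr0 K); apply: cvgM; first exact: cvg_cst.
    by apply/norm_cvg0P/subr_cvg0.
  apply: (@squeeze_cvgr _ _ _ _ (cst 0)); last exact: cvg_cst.
  by apply: nearW => n /=; rewrite normr_ge0 eK.
split.
- by move=> n; exact: eo.
- exact: eo.
- exact: C.
- by apply: aeW => s; exact: C.
- have [_ _ [M xM]] := eo x xI; exists (`|K| + M) => n o.
  have -> : e (u n) o = (e (u n) o - e x o) + e x o by rewrite subrK.
  apply: le_trans (ler_normD _ _) _; apply: lerD (xM o).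
  apply: le_trans (eK _ _ (uI n)) _.
  have ux1 : `|u n - x| <= 1.
    have := uI n; move: xI; rewrite !I01E ler_norml => /andP[? ?] /andP[? ?].
    by apply/andP; split; lra.
  apply: (@le_trans _ _ (`|K| * `|u n - x|)); first by rewrite ler_wpM2r// ler_norm.
  by rewrite ler_piMr.
Qed.

Lemma step_cvg (x s : R) (u : nat -> R) : u @ \oo --> x -> s != x ->
  step (u n) s @[n --> \oo] --> step x s.
Proof.
move=> ux sx; have N := ux _ (step_near sx).
by apply: cvg_near_cst; exact: N.
Qed.

Lemma rep_x2_continuous (x : R) (u : nat -> R) : I01 x ->
  (forall n, I01 (u n)) -> u @ \oo --> x ->
  rep_cvg (fun n => rep_x2 (u n)) (rep_x2 x).
Proof.
move=> xI uI ux.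
apply: (@mkrep_cvg _ (fun=> - 2) (fun z s => step z s - (1 - s) ^+ 2) 2) => //.
- move=> z _; apply: measurable_funB; first exact: measurable_step.
  by apply: measurable_funX; exact: measurable_funB.
- by move=> z _; rewrite normrN ger0_norm.
- move=> z s zI; rewrite I01E => /andP[s0 s1]; have /andP[a b] := step01 z s.
  by rewrite ler_norml; apply/andP; split; nra.
- exact: cvg_cst.
- by move=> s _ sx; apply: cvgB; [exact: step_cvg|exact: cvg_cst].
Qed.

Lemma rep_t1_continuous (t : R) (u : nat -> R) : I01 t ->
  (forall n, I01 (u n)) -> u @ \oo --> t ->
  rep_cvg (fun n => rep_t1 (u n)) (rep_t1 t).
Proof.
move=> tI uI ut; apply: (@mkrep_cvg _ (fun=> 1) step 1) => //.
- by move=> z _; exact: measurable_step.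
- by move=> z _; rewrite normr1.
- by move=> z s _ _; exact: step_norm.
- exact: cvg_cst.
- by move=> s _ st; exact: step_cvg.
Qed.

Lemma continuous_powR (g t : R) : 0 < t -> {for t, continuous (fun z => z `^ g)}.
Proof.
move=> t0; apply/differentiable_continuous/derivable1_diffP.
by have [] := is_derive1_powR g t0.
Qed.

(** Differentiability of the power gives the case t > 0; at t = 0, u n <= e^(1/g) implies (u n)^g <=
    e. *)
Lemma powR_cvg_ge0 (g t : R) (u : nat -> R) : 0 < g -> 0 <= t ->
  (forall n, 0 <= u n) -> u @ \oo --> t -> u n `^ g @[n --> \oo] --> t `^ g.
Proof.
move=> g0; rewrite le_eqVlt => /predU1P[<-|t0] u0 ut; last first.
  exact: (continuous_cvg _ (continuous_powR (g := g) t0) ut).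
rewrite powR0 ?gt_eqF//; apply/cvgr0Pnorm_le => e e0.
have r0 : 0 < e `^ g^-1 by rewrite powR_gt0.
have /cvgr0Pnorm_le/(_ _ r0) := ut; apply: filterS => n.
rewrite !ger0_norm ?powR_ge0// => h.
apply: (@le_trans _ _ ((e `^ g^-1) `^ g)).
  by apply: ge0_ler_powR; rewrite ?nnegrE ?powR_ge0// ltW.
by rewrite -powRrM mulVf ?gt_eqF// powRr1// ltW.
Qed.

Section Fractional.
Variable alpha : R.
Hypothesis alpha1 : alpha < 1.

Let g0 : 0 < 1 - alpha. Proof. by rewrite subr_gt0. Qed.

Lemma measurable_frac (z : R) : measurable_fun setT
  (fun s : R => (z - s) `^ (1 - alpha) / (1 - alpha) * step z s).
Proof.
apply: measurable_funM; last exact: measurable_step.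
apply: measurable_funM => //; apply: (measurableT_comp (measurable_powR _)).
exact: measurable_funB.
Qed.

Lemma powR_le1 (x : R) : 0 <= x -> x <= 1 -> x `^ (1 - alpha) <= 1.
Proof.
move=> x0 x1; have e1 : (1 : R) `^ (1 - alpha) = 1 by rewrite powR1.
rewrite -[leRHS]e1.
by apply: ge0_ler_powR; rewrite ?nnegrE// ltW.
Qed.

Lemma frac_bound (z s : R) : I01 z -> I01 s ->
  `|(z - s) `^ (1 - alpha) / (1 - alpha) * step z s| <= (1 - alpha)^-1.
Proof.
rewrite !I01E => /andP[z0 z1] /andP[s0 s1]; rewrite /step; case: ltP => h; last first.
  by rewrite mulr0 normr0 invr_ge0 ltW.
rewrite mulr1 ger0_norm; last by rewrite divr_ge0 ?powR_ge0 ?ltW.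
by rewrite ler_piMl ?invr_ge0 ?(ltW g0)//; apply: powR_le1; lra.
Qed.

Lemma rep_frac_ok (t : R) : I01 t -> rep_ok (rep_frac alpha t).
Proof.
move=> tI; apply: (@mkrep_ok _ _ _ (1 - alpha)^-1); first exact: measurable_frac.
by move=> s sI; exact: frac_bound.
Qed.

Lemma rep_frac_continuous (t : R) (u : nat -> R) : I01 t ->
  (forall n, I01 (u n)) -> u @ \oo --> t ->
  rep_cvg (fun n => rep_frac alpha (u n)) (rep_frac alpha t).
Proof.
move=> tI uI ut.
apply: (@mkrep_cvg _ (fun t => t `^ (1 - alpha) / (1 - alpha))
  (fun t s => (t - s) `^ (1 - alpha) / (1 - alpha) * step t s) (1 - alpha)^-1) => //.
- by move=> z _; exact: measurable_frac.
- move=> z; rewrite I01E => /andP[z0 z1].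
  rewrite ger0_norm; last by rewrite divr_ge0 ?powR_ge0 ?ltW.
  by rewrite ler_piMl ?invr_ge0 ?(ltW g0)//; exact: powR_le1.
- by move=> z s zI sI; exact: frac_bound.
- apply: cvgM; last exact: cvg_cst.
  apply: powR_cvg_ge0 => //; first by move: tI; rewrite I01E => /andP[].
  by move=> n; have := uI n; rewrite I01E => /andP[].
- move=> s sI st.
  have [ts|ts] := ltP s t.
    apply: cvgM; last exact: step_cvg.
    apply: cvgM; last exact: cvg_cst.
    have ts0 : 0 < t - s by rewrite subr_gt0.
    have us : (u n - s) @[n --> \oo] --> t - s by apply: cvgB => //; exact: cvg_cst.
    exact: (continuous_cvg _ (continuous_powR (g := 1 - alpha) ts0) us).
  rewrite (step_ge ts) mulr0; have N := ut _ (step_near st).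
  apply: cvg_near_cst; move: N; rewrite /nbhs /=; apply: filterS => n /= ->.
  by rewrite (step_ge ts) mulr0.
Qed.

End Fractional.

End Rep_continuity.

(** * Caputo derivatives of data functions *)

Section Caputo_of_data.
Context {R : realType}.
Variable alpha : R.
Hypothesis alpha1 : alpha <= 1.

Definition rep_caputo (t : R) : rep :=
  if alpha == 1 then rep_t1 t else (Gamma (1 - alpha))^-1 *: rep_frac alpha t.

Lemma rep_caputo_ok t : I01 t -> rep_ok (rep_caputo t).
Proof.
move=> tI; rewrite /rep_caputo; case: eqVneq => [_|a1]; first exact: rep_t1_ok.
by apply: rep_okZ; apply: rep_frac_ok => //; rewrite lt_neqAle a1.
Qed.

Lemma rep_cvgZ (k : R) (e_ : nat -> @rep R) e : rep_cvg e_ e ->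
  rep_cvg (fun n => k *: e_ n) (k *: e).
Proof.
move=> [eo_ eo eN eS [K eK]]; split.
- by move=> n; exact: rep_okZ.
- exact: rep_okZ.
- by apply: cvgM; [exact: cvg_cst|exact: eN].
- by apply: ae_imp eS => s es; apply: cvgM; [exact: cvg_cst|exact: es].
- by exists (`|k| * K) => n o; rewrite rep_scaleE normrM ler_wpM2l.
Qed.

Lemma rep_caputo_continuous (t : R) (u : nat -> R) : I01 t ->
  (forall n, I01 (u n)) -> u @ \oo --> t ->
  rep_cvg (fun n => rep_caputo (u n)) (rep_caputo t).
Proof.
move=> tI uI ut; rewrite /rep_caputo; case: eqVneq => [_|a1].
  exact: rep_t1_continuous.
by apply: rep_cvgZ; apply: rep_frac_continuous => //; rewrite lt_neqAle a1.
Qed.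

Lemma caputo_of_data (d : data) (x t : R) : data_L2 d -> I01 x -> I01 t ->
  caputo alpha (of_data d) x t = data_ip d (tens (rep_x0 x) (rep_caputo t)).
Proof.
move=> Ld xI tI; rewrite /caputo /rep_caputo.
have [_|a1] := eqVneq alpha 1; first exact: deta_of_data.
have lt1 : alpha < 1 by rewrite lt_neqAle a1.
have fo := rep_frac_ok lt1 tI; have xo := rep_x0_ok xI.
rewrite tensZr (ipZr (@data_preHilbert R))//; last exact: tens_L2.
rewrite data_ip_contr// -Rint_frac//; last 2 first.
- by move: tI; rewrite I01E => /andP[].
- exact: itg_contr.
congr (_ * _); apply: eq_Rintegral => r; rewrite inE/= in_itv/= => /andP[r0 rt].
have rI : I01 r.
  by move: tI; rewrite !I01E (ltW r0) => /andP[_ t1]; rewrite (le_trans (ltW rt)).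
by rewrite deta_of_data// /of_data_t data_ip_contr//; exact: rep_t1_ok.
Qed.

End Caputo_of_data.

(** * The reproducing kernel *)

Section Kernel.
Context {R : realType}.
Notation mu := (@lebesgue_measure R).

Lemma itg_step_bounded (a K : R) (g : R -> R) : measurable_fun setT g ->
  (forall s, I01 s -> `|g s| <= K) -> itg mu (fun s => \1_I01 s * (step a s * g s)).
Proof.
move=> mg gK; apply: (rep_ok_itg (e := mkrep 0 (fun s => step a s * g s))).
apply: (@mkrep_ok _ _ _ K); first by apply: measurable_funM => //; exact: measurable_step.
move=> s sI; apply: le_trans (gK _ sI); rewrite normrM ler_piMl//.
exact: step_norm.
Qed.

(** Products of two polynomial representers have degree at most 4 in s between the knots, so one
    integration formula serves the kernel and all pairings with [rep_cut] but the fractional one. *)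
Definition quartic (c0 c1 c2 c3 c4 s : R) : R :=
  c0 + c1 * s + c2 * s ^+ 2 + c3 * s ^+ 3 + c4 * s ^+ 4.

Lemma quartic_bound c0 c1 c2 c3 c4 s : I01 s ->
  `|quartic c0 c1 c2 c3 c4 s| <= `|c0| + `|c1| + `|c2| + `|c3| + `|c4|.
Proof.
rewrite I01E => /andP[s0 s1]; rewrite /quartic.
have b c n : `|c * s ^+ n| <= `|c|.
  by rewrite normrM ler_piMr// ger0_norm ?exprn_ge0// exprn_ile1.
do 4 (apply: le_trans (ler_normD _ _) _; apply: lerD; last by (exact: b || exact: (b _ 1%N))).
by [].
Qed.

Lemma measurable_quartic c0 c1 c2 c3 c4 :
  measurable_fun setT (quartic c0 c1 c2 c3 c4).
Proof.
rewrite /quartic; do 4 (apply: measurable_funD;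
  last by apply: measurable_funM => //; exact: measurable_funX).
by [].
Qed.

Lemma Rint_step_quartic (a c0 c1 c2 c3 c4 : R) : I01 a ->
  itg mu (fun s => \1_I01 s * (step a s * quartic c0 c1 c2 c3 c4 s)) /\
  \int[mu]_s (\1_I01 s * (step a s * quartic c0 c1 c2 c3 c4 s)) =
    c0 * a + c1 / 2 * a ^+ 2 + c2 / 3 * a ^+ 3 + c3 / 4 * a ^+ 4 + c4 / 5 * a ^+ 5.
Proof.
rewrite I01E => /andP[a0 a1]; split.
  apply: itg_step_bounded; first exact: measurable_quartic.
  by move=> s sI; exact: quartic_bound.
set q := quartic c0 c1 c2 c3 c4.
pose p : {poly R} := c0 *: 'X + (c1 / 2) *: 'X^2 + (c2 / 3) *: 'X^3 +
  (c3 / 4) *: 'X^4 + (c4 / 5) *: 'X^5.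
have pE s : p.[s] = c0 * s + c1 / 2 * s ^+ 2 + c2 / 3 * s ^+ 3 + c3 / 4 * s ^+ 4 + c4 / 5 * s ^+ 5.
  by rewrite /p !hornerE.
have pD s : (deriv p).[s] = q s.
  by rewrite /p !(derivD, derivZ, derivX, derivXn) !(hornerD, hornerZ, hornerMn, hornerXn, hornerX, hornerC) /q /quartic; field.
rewrite -pE; move: a0; rewrite le_eqVlt => /predU1P[<-|a0].
  rewrite pE !expr0n/= !mulr0 !addr0 -[RHS](Rintegral0 mu).
  apply: eq_Rintegral => s _; have [s0|s0] := leP 0 s.
    by rewrite step_ge// mul0r mulr0.
  rewrite indicE memNset ?mul0r// I01E => /andP[]; rewrite leNgt s0; by [].
have D s : 0 <= s <= a -> is_derive s 1 (horner p) (q s).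
  by move=> _; rewrite -pD; exact: is_derive_poly.
have qp : q = horner (deriv p) by apply/funext => s; rewrite pD.
have C s : 0 <= s <= a -> {for s, continuous q}.
  by move=> _; rewrite qp; exact: continuous_horner.
have := is_derive_FTC2 a0 D C => /(congr1 fine) /= FE.
transitivity (\int[mu]_(s in `[0, a]) q s); last first.
  by rewrite /Rintegral FE !pE !expr0n /= !mulr0 !addr0 subr0.
rewrite [RHS]Rintegral_mkcond; apply: ae_eq_Rintegral.
apply: ae_imp (ae_neq a) => s sa _; rewrite patchE.
have [sI|sI] := asboolP (I01 s); last first.
  rewrite indicE memNset// mul0r; case: ifPn => //; rewrite inE/= in_itv/= => /andP[h1 h2].
  by case: sI; rewrite I01E h1 (le_trans h2 a1).
rewrite indicE mem_set// mul1r; move: sI; rewrite I01E => /andP[s0 s1].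
case: ifPn; rewrite ?inE ?notin_setE/= in_itv/= s0/= /step lt_neqAle sa/=.
  by move=> ->; rewrite mul1r.
by move=> /negP/negbTE ->; rewrite mul0r.
Qed.

Lemma Rint_step_squares (z a b : R) : I01 z ->
  itg mu (fun s => \1_I01 s * (step z s * ((a - s) ^+ 2 * (b - s) ^+ 2))) /\
  \int[mu]_s (\1_I01 s * (step z s * ((a - s) ^+ 2 * (b - s) ^+ 2))) =
    a ^+ 2 * b ^+ 2 * z - a * b * (a + b) * z ^+ 2 +
    (a ^+ 2 + 4 * a * b + b ^+ 2) / 3 * z ^+ 3 - (a + b) / 2 * z ^+ 4 + z ^+ 5 / 5.
Proof.
move=> zI; have E s : (a - s) ^+ 2 * (b - s) ^+ 2 =
    quartic (a ^+ 2 * b ^+ 2) (- 2 * a * b * (a + b)) (a ^+ 2 + 4 * a * b + b ^+ 2)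
      (- 2 * (a + b)) 1 s by rewrite /quartic; ring.
have EI s : \1_I01 s * (step z s * ((a - s) ^+ 2 * (b - s) ^+ 2)) =
    \1_I01 s * (step z s * quartic (a ^+ 2 * b ^+ 2) (- 2 * a * b * (a + b))
      (a ^+ 2 + 4 * a * b + b ^+ 2) (- 2 * (a + b)) 1 s) by rewrite E.
rewrite (funext EI).
have [i ->] := Rint_step_quartic (a ^+ 2 * b ^+ 2) (- 2 * a * b * (a + b))
  (a ^+ 2 + 4 * a * b + b ^+ 2) (- 2 * (a + b)) 1 zI.
by split => //; field.
Qed.

Lemma step_le (x z s : R) : x <= z -> step x s * step z s = step x s.
Proof.
move=> xz; rewrite /step; case: ltP => h; rewrite ?mul0r//.
by rewrite (lt_le_trans h xz) mulr1.
Qed.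

Lemma rep_ipC (e f : @rep R) : rep_ip e f = rep_ip f e.
Proof.
by rewrite /rep_ip mulrC; congr (_ + _); apply: eq_Rintegral => s _; rewrite mulrC.
Qed.

Lemma indic01_sqr (s a b : R) : (\1_I01 s * a) * (\1_I01 s * b) = \1_I01 s * (a * b) :> R.
Proof. by rewrite indicE; case: (_ \in _); rewrite /= ?mul1r// !mul0r. Qed.

Lemma rep_ip_x0_le (x z : R) : I01 x -> I01 z -> z <= x ->
  rep_ip (rep_x0 x) (rep_x0 z) = kernel3 x z.
Proof.
move=> xI zI zx; rewrite /rep_ip /kernel3 zx /=; have I1 := @I01_1 R.
have [i1 e1] := Rint_step_squares x z zI; have [i2 e2] := Rint_step_squares 1 z zI.
have [i3 e3] := Rint_step_squares 1 x xI; have [i4 e4] := Rint_step_squares 1 1 I1.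
(* The product of the densities is expanded into four truncated terms. As z <= x,
   [step x s * step z s] is [step z s]; the factor [step 1 s], equal to 1 on [0, 1] off s = 1,
   brings the last term into the same form. *)
transitivity ((x - x ^+ 2) * (z - z ^+ 2) + \int[mu]_s
   (4^-1 * (\1_I01 s * (step z s * ((x - s) ^+ 2 * (z - s) ^+ 2))) -
    x ^+ 2 / 4 * (\1_I01 s * (step z s * ((1 - s) ^+ 2 * (z - s) ^+ 2))) -
    z ^+ 2 / 4 * (\1_I01 s * (step x s * ((1 - s) ^+ 2 * (x - s) ^+ 2))) +
    x ^+ 2 * z ^+ 2 / 4 * (\1_I01 s * (step 1 s * ((1 - s) ^+ 2 * (1 - s) ^+ 2))))).
  congr (_ + _); apply: ae_eq_Rintegral; apply: ae_imp (ae_neq 1) => s s1 _.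
  rewrite indic01_sqr; have [sI|sI] := asboolP (I01 s); last first.
    by rewrite indicE memNset//= !mul0r !mulr0 !subr0 addr0.
  have -> : step 1 s = 1.
    by move: sI; rewrite I01E => /andP[_ s1']; rewrite /step lt_neqAle s1 s1'.
  rewrite indicE mem_set//= !mul1r; have := step_le s zx.
  by move: (step z s) (step x s) => p q pq; rewrite -[X in 4^-1 * (X * _)]pq; field.
rewrite RintD; [|by do 2 (apply: itgB; last exact: itgZ); exact: itgZ|exact: itgZ].
rewrite RintB; [|by apply: itgB; exact: itgZ|exact: itgZ].
rewrite RintB; [|exact: itgZ|exact: itgZ].
rewrite !RintZ// e1 e2 e3 e4; by field.
Qed.

Lemma rep_ip_x0 (x z : R) : I01 x -> I01 z ->
  rep_ip (rep_x0 x) (rep_x0 z) = kernel3 x z.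
Proof.
move=> xI zI; have [zx|xz] := leP z x; first exact: rep_ip_x0_le.
rewrite rep_ipC rep_ip_x0_le//; last exact: ltW.
by rewrite /kernel3 (ltW xz) leNgt xz.
Qed.

Lemma rep_ip_t0_le (t r : R) : I01 t -> I01 r -> r <= t ->
  rep_ip (rep_t0 t) (rep_t0 r) = kernel2 t r.
Proof.
move=> tI rI rt; rewrite /rep_ip /kernel2 rt /=.
have [i e] := Rint_step_quartic (t * r) (- (t + r)) 1 0 0 rI.
transitivity (t * r + \int[mu]_s (\1_I01 s * (step r s * quartic (t * r) (- (t + r)) 1 0 0 s))).
  congr (_ + _); apply: eq_Rintegral => s _; rewrite indic01_sqr /quartic.
  by rewrite -[in RHS](step_le s rt); ring.
by rewrite e; field.
Qed.

Lemma rep_ip_t0 (t r : R) : I01 t -> I01 r ->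
  rep_ip (rep_t0 t) (rep_t0 r) = kernel2 t r.
Proof.
move=> tI rI; have [rt|tr] := leP r t; first exact: rep_ip_t0_le.
rewrite rep_ipC rep_ip_t0_le//; last exact: ltW.
rewrite /kernel2 (ltW tr) leNgt tr; ring.
Qed.

Lemma kernelW32_of_data (x t xi eta : R) : I01 x -> I01 t -> I01 xi -> I01 eta ->
  kernelW32 x t xi eta = of_data (tens (rep_x0 xi) (rep_t0 eta)) x t.
Proof.
move=> xI tI xiI etaI; have ? := rep_x0_ok; have ? := rep_t0_ok.
by rewrite /of_data tens_ip; auto; rewrite rep_ipC (rep_ipC (rep_t0 eta)) rep_ip_x0// rep_ip_t0.
Qed.

End Kernel.

(** * The operator L in terms of data *)

Section Operator.
Context {R : realType}.
Variables (alpha : R) (k1 k2 k3 : R -> R -> R).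
Hypothesis alpha1 : alpha <= 1.

Lemma caputo_ext (y z : R -> R -> R) : (forall x t, I01 x -> I01 t -> y x t = z x t) ->
  forall x t, I01 x -> I01 t -> caputo alpha y x t = caputo alpha z x t.
Proof.
move=> yz x t xI tI.
have E r : I01 r -> deta y x r = deta z x r.
  by move=> rI; apply: deriv01_ext => // s sI; exact: yz.
rewrite /caputo; case: eqP => _; first exact: E.
congr (_ * _); apply: eq_Rintegral => r; rewrite inE/= in_itv/= => /andP[r0 rt].
rewrite E//; move: tI; rewrite !I01E (ltW r0) => /andP[_ t1].
exact: le_trans (ltW rt) t1.
Qed.

Lemma dxi_ext (y z : R -> R -> R) : (forall x t, I01 x -> I01 t -> y x t = z x t) ->
  forall x t, I01 x -> I01 t -> dxi y x t = dxi z x t.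
Proof. by move=> yz x t xI tI; apply: deriv01_ext => // s sI; exact: yz. Qed.

Lemma deta_ext (y z : R -> R -> R) : (forall x t, I01 x -> I01 t -> y x t = z x t) ->
  forall x t, I01 x -> I01 t -> deta y x t = deta z x t.
Proof. by move=> yz x t xI tI; apply: deriv01_ext => // s sI; exact: yz. Qed.

Lemma burgersL_ext (y z : R -> R -> R) : (forall x t, I01 x -> I01 t -> y x t = z x t) ->
  forall x t, I01 x -> I01 t ->
  burgersL alpha k1 k2 k3 y x t = burgersL alpha k1 k2 k3 z x t.
Proof.
move=> yz x t xI tI; have dyz := dxi_ext yz.
by rewrite /burgersL (caputo_ext yz)// (dxi_ext dyz)// dyz// yz.
Qed.

Definition psi_data (x t : R) : data :=
  tens (rep_x0 x) (rep_caputo alpha t) + k1 x t *: tens (rep_x2 x) (rep_t0 t) +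
  k2 x t *: tens (rep_x0 x) (rep_t0 t) + k3 x t *: tens (rep_x1 x) (rep_t0 t).

Lemma psi_data_L2 (x t : R) : I01 x -> I01 t -> data_L2 (psi_data x t).
Proof.
move=> xI tI; have H := @data_preHilbert R.
have co := rep_caputo_ok alpha1 tI; have t0o := rep_t0_ok tI.
have x0o := rep_x0_ok xI; have x1o := rep_x1_ok xI; have x2o := rep_x2_ok xI.
do 3 (apply: (domD H); last by apply: (domZ H); exact: tens_L2).
exact: tens_L2.
Qed.

Lemma data_ip_psi (d : data) (x t : R) : data_L2 d -> I01 x -> I01 t ->
  data_ip d (psi_data x t) = data_ip d (tens (rep_x0 x) (rep_caputo alpha t)) +
    k1 x t * of_data_xx d x t + k2 x t * of_data d x t + k3 x t * of_data_x d x t.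
Proof.
move=> Ld xI tI; have H := @data_preHilbert R.
have co := rep_caputo_ok alpha1 tI; have t0o := rep_t0_ok tI.
have x0o := rep_x0_ok xI; have x1o := rep_x1_ok xI; have x2o := rep_x2_ok xI.
have L0c := tens_L2 x0o co; have L0 := tens_L2 x0o t0o.
have L1 := tens_L2 x1o t0o; have L2' := tens_L2 x2o t0o.
have Z (k : R) (e : @data R) : data_L2 e -> data_L2 (k *: e) by move=> he; exact: (domZ H k he).
have A (a b : @data R) : data_L2 a -> data_L2 b -> data_L2 (a + b) by move=> ha hb; exact: (domD H ha hb).
have Z2 := Z (k1 x t) _ L2'; have Z0 := Z (k2 x t) _ L0; have Z1 := Z (k3 x t) _ L1.
have S2 := A _ _ L0c Z2; have S0 := A _ _ S2 Z0.
by rewrite /psi_data (ipDr H S0 Z1 Ld) (ipDr H S2 Z0 Ld) (ipDr H L0c Z2 Ld) !(ipZr H).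
Qed.

Lemma burgersL_of_data (d : data) (x t : R) : data_L2 d -> I01 x -> I01 t ->
  burgersL alpha k1 k2 k3 (of_data d) x t = data_ip d (psi_data x t).
Proof.
move=> Ld xI tI; rewrite data_ip_psi// /burgersL caputo_of_data//.
by rewrite dxi2_of_data// dxi_of_data.
Qed.

(** As a function of (x, t) the kernel is attached to the tensor at (xi, eta), so L turns it into
    the pairing of that tensor with [psi_data]; by symmetry this is the value at (xi, eta) of the
    function attached to [psi_data]. *)
Lemma psi_of_data (p : nat -> R * R) (i : nat) (xi eta : R) : sqD (p i) ->
  I01 xi -> I01 eta ->
  psi alpha k1 k2 k3 p i xi eta = of_data (psi_data (p i).1 (p i).2) xi eta.
Proof.
move=> [xI tI] xiI etaI; rewrite /psi.
have L := tens_L2 (rep_x0_ok xiI) (rep_t0_ok etaI).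
rewrite (burgersL_ext (z := of_data (tens (rep_x0 xi) (rep_t0 eta))))//; last first.
  by move=> x t hx ht; rewrite kernelW32_of_data.
by rewrite burgersL_of_data// /of_data (ipC (@data_preHilbert R)).
Qed.

End Operator.

(** * Linear independence at new interior points *)

Section Cutoffs.
Context {R : realType}.
Notation mu := (@lebesgue_measure R).

Lemma rep_ip_itg (e f : @rep R) : rep_ok e -> rep_ok f ->
  itg mu (fun s => e (Some s) * f (Some s)).
Proof. by move=> /rep_ok_L2 a /rep_ok_L2 b; exact: L2M a b. Qed.

Lemma rep_ipDl (e e' f : @rep R) : rep_ok e -> rep_ok e' -> rep_ok f ->
  rep_ip (e + e') f = rep_ip e f + rep_ip e' f.
Proof.
move=> eo eo' fo; rewrite /rep_ip.
have -> : \int[mu]_s ((e + e') (Some s) * f (Some s)) =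
    \int[mu]_s (e (Some s) * f (Some s)) + \int[mu]_s (e' (Some s) * f (Some s)).
  rewrite -RintD; [|exact: rep_ip_itg|exact: rep_ip_itg].
  by apply: eq_Rintegral => s _; exact: mulrDl.
move: (\int[mu]_s _) (\int[mu]_s _) => a b.
by rewrite (mulrDl (e None) (e' None) (f None : R)); ring.
Qed.

Lemma rep_ipZl (k : R) (e f : @rep R) : rep_ok e -> rep_ok f ->
  rep_ip (k *: e) f = k * rep_ip e f.
Proof.
move=> eo fo; rewrite /rep_ip mulrDr -RintZ; last exact: rep_ip_itg.
congr (_ + _); first exact: (esym (mulrA k (e None : R) (f None : R))).
by apply: eq_Rintegral => s _; exact: (esym (mulrA k (e (Some s) : R) (f (Some s) : R))).
Qed.

(** Pairing with [rep_cut y] integrates a density over [0, y] and ignores the weight at [None]. All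
    test functions are combinations of these, which makes every pairing an explicit function of the
    knots. *)
Definition rep_cut (y : R) : rep := mkrep (0 : R) (step y).

Lemma rep_cut_ok y : rep_ok (rep_cut y).
Proof.
apply: (@mkrep_ok _ _ _ 1); first exact: measurable_step.
by move=> s _; exact: step_norm.
Qed.

Lemma step_min (x y s : R) : step y s * step x s = step (Num.min y x) s.
Proof.
have [xy|yx] := leP y x; first exact: step_le.
by rewrite mulrC step_le// ltW.
Qed.

Lemma min_I01 (x y : R) : I01 x -> I01 y -> I01 (Num.min y x).
Proof. by move=> xI yI; case: leP. Qed.

Lemma rep_ip_cut (y c : R) (g : R -> R) :
  rep_ip (rep_cut y) (mkrep c g) = \int[mu]_s (\1_I01 s * (step y s * g s)).
Proof.
rewrite /rep_ip /= mul0r add0r; apply: eq_Rintegral => s _.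
exact: indic01_sqr.
Qed.

(** The term y - y^2 + y^3 / 3 is the integral of (1 - s)^2 over [0, y], from the correction that
    enforces the value 0 at 1. On either side of x the result is a polynomial of degree at most 3 in
    the knot y, hence annihilated by fourth differences. *)
Lemma rep_ip_cut_x0 (y x : R) : I01 x -> I01 y ->
  let m := Num.min y x in rep_ip (rep_cut y) (rep_x0 x) =
  (x ^+ 2 * m - x * m ^+ 2 + m ^+ 3 / 3) / 2 - x ^+ 2 / 2 * (y - y ^+ 2 + y ^+ 3 / 3).
Proof.
move=> xI yI m; rewrite rep_ip_cut.
have [i1 e1] := Rint_step_quartic (x ^+ 2) (- 2 * x) 1 0 0 (min_I01 xI yI).
have [i2 e2] := Rint_step_quartic 1 (- 2) 1 0 0 yI.
transitivity (\int[mu]_s (2^-1 * (\1_I01 s * (step m s * quartic (x ^+ 2) (- 2 * x) 1 0 0 s)) -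
    x ^+ 2 / 2 * (\1_I01 s * (step y s * quartic 1 (- 2) 1 0 0 s)))).
  by apply: eq_Rintegral => s _; rewrite -step_min /quartic; field.
by rewrite RintB; [|exact: itgZ|exact: itgZ]; rewrite !RintZ// e1 e2 -/m; field.
Qed.

Lemma rep_ip_cut_x1 (y x : R) : I01 x -> I01 y ->
  let m := Num.min y x in rep_ip (rep_cut y) (rep_x1 x) =
  x * m - m ^+ 2 / 2 - x * (y - y ^+ 2 + y ^+ 3 / 3).
Proof.
move=> xI yI m; rewrite rep_ip_cut.
have [i1 e1] := Rint_step_quartic x (- 1) 0 0 0 (min_I01 xI yI).
have [i2 e2] := Rint_step_quartic 1 (- 2) 1 0 0 yI.
transitivity (\int[mu]_s (\1_I01 s * (step m s * quartic x (- 1) 0 0 0 s) -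
    x * (\1_I01 s * (step y s * quartic 1 (- 2) 1 0 0 s)))).
  by apply: eq_Rintegral => s _; rewrite -step_min /quartic; ring.
by rewrite RintB; [|exact: i1|exact: itgZ]; rewrite !RintZ// e1 e2 -/m; field.
Qed.

Lemma rep_ip_cut_x2 (y x : R) : I01 x -> I01 y ->
  rep_ip (rep_cut y) (rep_x2 x) = Num.min y x - (y - y ^+ 2 + y ^+ 3 / 3).
Proof.
move=> xI yI; rewrite rep_ip_cut.
have [i1 e1] := Rint_step_quartic 1 0 0 0 0 (min_I01 xI yI).
have [i2 e2] := Rint_step_quartic 1 (- 2) 1 0 0 yI.
transitivity (\int[mu]_s (\1_I01 s * (step (Num.min y x) s * quartic 1 0 0 0 0 s) -
    \1_I01 s * (step y s * quartic 1 (- 2) 1 0 0 s))).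
  by apply: eq_Rintegral => s _; rewrite -step_min /quartic; ring.
by rewrite RintB// e1 e2; field.
Qed.

Lemma rep_ip_cut_t0 (y t : R) : I01 t -> I01 y ->
  let m := Num.min y t in rep_ip (rep_cut y) (rep_t0 t) = t * m - m ^+ 2 / 2.
Proof.
move=> tI yI m; rewrite rep_ip_cut.
have [i e] := Rint_step_quartic t (- 1) 0 0 0 (min_I01 tI yI).
transitivity (\int[mu]_s (\1_I01 s * (step m s * quartic t (- 1) 0 0 0 s))).
  by apply: eq_Rintegral => s _; rewrite -step_min /quartic; ring.
by rewrite e -/m; field.
Qed.

Lemma rep_ip_cut_t1 (y t : R) : I01 t -> I01 y ->
  rep_ip (rep_cut y) (rep_t1 t) = Num.min y t.
Proof.
move=> tI yI; rewrite rep_ip_cut.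
have [i e] := Rint_step_quartic 1 0 0 0 0 (min_I01 tI yI).
transitivity (\int[mu]_s (\1_I01 s * (step (Num.min y t) s * quartic 1 0 0 0 0 s))).
  by apply: eq_Rintegral => s _; rewrite -step_min /quartic; ring.
by rewrite e; field.
Qed.

Lemma rep_ip_cut_frac (alpha y t : R) : alpha < 1 -> I01 t -> I01 y ->
  rep_ip (rep_cut y) (rep_frac alpha t) =
  (t `^ (2 - alpha) - (t - Num.min y t) `^ (2 - alpha)) / ((1 - alpha) * (2 - alpha)).
Proof.
move=> a1 tI yI; rewrite rep_ip_cut; set m := Num.min y t.
have b1 : -1 < 1 - alpha by lra.
have mt : m <= t by rewrite /m ge_min lexx orbT.
have [t0 t1] : 0 <= t /\ t <= 1 by move: tI; rewrite I01E => /andP[].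
have [m0 m1] : 0 <= m /\ m <= 1 by have := min_I01 tI yI; rewrite I01E => /andP[].
have [i1 e1] := Rint_powR b1 t0; have [i2 e2] := Rint_powR b1 mt.
(* [0, m[ is written as the difference of [0, t[ and [m, t[, because [Rint_powR] integrates up to
   the zero t of the base. *)
transitivity (\int[mu]_s ((1 - alpha)^-1 *
    (\1_(`[0, t[) s * (t - s) `^ (1 - alpha) - \1_(`[m, t[) s * (t - s) `^ (1 - alpha)))).
  apply: eq_Rintegral => s _.
  have -> : step y s * ((t - s) `^ (1 - alpha) / (1 - alpha) * step t s) =
      (t - s) `^ (1 - alpha) / (1 - alpha) * step m s.
    by rewrite -(step_min t y) mulrCA.
  rewrite !indicE !mem_setE !in_itv/= /step.
  have [s0|s0] := leP 0 s; have [sm|sm] := ltP s m => /=; rewrite ?mulr0 ?mul0r ?subr0.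
  - by rewrite (lt_le_trans sm mt) (le_trans (ltW sm) m1) /= !mulr1 !mul1r mulrC.
  - by rewrite subrr mulr0.
  - by rewrite mulr0.
  - by have := le_lt_trans m0 (le_lt_trans sm s0); rewrite ltxx.
rewrite RintZ; last exact: itgB.
rewrite RintB// e1 e2 subr0 (_ : 1 - alpha + 1 = 2 - alpha); last by ring.
by field; rewrite !gt_eqF//; lra.
Qed.

End Cutoffs.

(** * Splines in space and bumps in time *)

Section Test_functions.
Context {R : realType}.

(* Fourth differences of step functions: paired with a representer at z, they
   annihilate the cubic polynomials that arise when all knots are on the same
   side of z. *)
Definition rep_spline (x h : R) : rep :=
  rep_cut (x - 2 * h) + (- 4) *: rep_cut (x - h) + 6%:R *: rep_cut x +
  (- 4) *: rep_cut (x + h) + rep_cut (x + 2 * h).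

Lemma rep_spline_ok x h : rep_ok (rep_spline x h).
Proof.
have c := @rep_cut_ok R.
by do 4 (apply: rep_okD; last by (exact: c || apply: rep_okZ; exact: c)).
Qed.

Lemma rep_ip_spline (x h : R) f : rep_ok f -> rep_ip (rep_spline x h) f =
  rep_ip (rep_cut (x - 2 * h)) f - 4 * rep_ip (rep_cut (x - h)) f +
  6 * rep_ip (rep_cut x) f - 4 * rep_ip (rep_cut (x + h)) f +
  rep_ip (rep_cut (x + 2 * h)) f.
Proof.
move=> fo; have c := @rep_cut_ok R; have cZ k y := rep_okZ k (c y).
have o1 := rep_okD (c (x - 2 * h)) (cZ (- 4) (x - h)).
have o2 := rep_okD o1 (cZ 6%:R x); have o3 := rep_okD o2 (cZ (- 4) (x + h)).
rewrite /rep_spline (rep_ipDl o3)// (rep_ipDl o2)// (rep_ipDl o1)// (rep_ipDl (c _))//.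
by rewrite !rep_ipZl//; ring.
Qed.

(** For knots y <= x the pairing with [rep_cut y] is a cubic in y; beyond x it differs from this
    cubic by (x - y)^3 / 6. The weights -4 and 1 at x + h and x + 2 h thus give (4 - 8) h^3 / 6. *)
Lemma rep_ip_spline_at (x h : R) : 0 < h -> 2 * h <= x -> 2 * h <= 1 - x ->
  rep_ip (rep_spline x h) (rep_x0 x) != 0.
Proof.
move=> h0 hx hx1.
have I z : 0 <= z -> z <= 1 -> I01 z by move=> z0 z1; rewrite I01E z0.
have xI : I01 x by apply: I; lra.
rewrite rep_ip_spline; last exact: rep_x0_ok.
rewrite !rep_ip_cut_x0//; [|apply: I; lra..].
rewrite (@min_l _ _ (x - 2 * h)); last lra.
rewrite (@min_l _ _ (x - h)); last lra.
rewrite (@min_l _ _ x)// (@min_r _ _ (x + h)); last lra.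
rewrite (@min_r _ _ (x + 2 * h)); last lra.
set A := (X in X != 0); have -> : A = - (2 / 3) * h ^+ 3 by rewrite /A; field.
by rewrite mulf_neq0// ?expf_neq0// ?gt_eqF// lt_eqF//; lra.
Qed.

Lemma rep_ip_spline_away (x z h : R) : 0 < h -> 2 * h <= x -> 2 * h <= 1 - x ->
  I01 z -> 2 * h <= `|z - x| ->
  [/\ rep_ip (rep_spline x h) (rep_x0 z) = 0, rep_ip (rep_spline x h) (rep_x1 z) = 0 &
      rep_ip (rep_spline x h) (rep_x2 z) = 0].
Proof.
move=> h0 hx hx1 zI hz.
have I s : 0 <= s -> s <= 1 -> I01 s by move=> s0 s1; rewrite I01E s0.
have [y0 y1 y2 [y3 y4]] : [/\ I01 (x - 2 * h), I01 (x - h), I01 x &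
    I01 (x + h) /\ I01 (x + 2 * h)] by split; [..|split]; apply: I; lra.
have ? := rep_x0_ok zI; have ? := rep_x1_ok zI; have ? := rep_x2_ok zI.
rewrite !rep_ip_spline// !rep_ip_cut_x0// !rep_ip_cut_x1// !rep_ip_cut_x2//.
move: hz; case: (leP x z) => xz.
  rewrite ger0_norm ?subr_ge0// => hz; rewrite !min_l; try lra.
  by split; field.
rewrite ltr0_norm ?subr_lt0// => hz; rewrite !min_r; try lra.
by split; field.
Qed.

(* The weights add up to 0 and make the pairing with [rep_t0 t] vanish, but not
   the one with [rep_caputo alpha t]. *)
Definition rep_bump (t d : R) : rep :=
  3^-1 *: rep_cut (t - 2 * d) + (- (4 / 3)) *: rep_cut (t - d) + rep_cut t.

Lemma rep_bump_ok t d : rep_ok (rep_bump t d).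
Proof.
have c := @rep_cut_ok R.
by apply: rep_okD => //; apply: rep_okD; exact: rep_okZ.
Qed.

Lemma rep_ip_bump (t d : R) f : rep_ok f -> rep_ip (rep_bump t d) f =
  3^-1 * rep_ip (rep_cut (t - 2 * d)) f - 4 / 3 * rep_ip (rep_cut (t - d)) f +
  rep_ip (rep_cut t) f.
Proof.
move=> fo; have c := @rep_cut_ok R; have cZ k y := rep_okZ k (c y).
have o1 := rep_okD (cZ 3^-1 (t - 2 * d)) (cZ (- (4 / 3)) (t - d)).
rewrite /rep_bump (rep_ipDl o1)// (rep_ipDl (cZ _ _))// !rep_ipZl//.
by rewrite mulNr.
Qed.

Lemma rep_ip_bump_t0 (t d : R) : 0 < d -> 2 * d <= t -> t <= 1 ->
  rep_ip (rep_bump t d) (rep_t0 t) = 0.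
Proof.
move=> d0 dt t1; have I s : 0 <= s -> s <= 1 -> I01 s by move=> s0 s1; rewrite I01E s0.
have tI : I01 t by apply: I; lra.
rewrite rep_ip_bump; last exact: rep_t0_ok.
rewrite !rep_ip_cut_t0//; [|apply: I; lra..].
by rewrite !min_l//; [field|lra..].
Qed.

(** For alpha < 1 and g = 2 - alpha, the pairing is a positive multiple of (4 - 2^g) d^g, which is
    positive because g < 2; positivity of Gamma keeps the factor nonzero. For alpha = 1 the value is
    2 d / 3. *)
Lemma rep_ip_bump_caputo (alpha t d : R) : 0 < alpha -> alpha <= 1 ->
  0 < d -> 2 * d <= t -> t <= 1 ->
  rep_ip (rep_bump t d) (rep_caputo alpha t) != 0.
Proof.
move=> a0 a1 d0 dt t1; have I s : 0 <= s -> s <= 1 -> I01 s by move=> s0 s1; rewrite I01E s0.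
have tI : I01 t by apply: I; lra.
have I1 : I01 (t - d) by apply: I; lra.
have I2 : I01 (t - 2 * d) by apply: I; lra.
rewrite rep_ip_bump; last exact: rep_caputo_ok.
rewrite /rep_caputo; have [_|an] := eqVneq alpha 1.
  by rewrite !rep_ip_cut_t1// !min_l//; lra.
have lt1 : alpha < 1 by rewrite lt_neqAle an.
rewrite !(rep_ipC _ (_ *: _)).
rewrite !rep_ipZl; [|exact: rep_frac_ok|exact: rep_cut_ok|exact: rep_frac_ok
  |exact: rep_cut_ok|exact: rep_frac_ok|exact: rep_cut_ok].
rewrite !(rep_ipC (rep_frac _ _)) !rep_ip_cut_frac// !min_l//; try lra.
have -> : t - (t - 2 * d) = 2 * d by ring.
have -> : t - (t - d) = d by ring.
rewrite subrr powR0 ?subr0; last by rewrite gt_eqF//; lra.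
rewrite powRM ?ler0n ?(ltW d0)//.
have g0 := Gamma_gt0 a0 lt1; have p0 : 0 < d `^ (2 - alpha) by rewrite powR_gt0.
have p4 : 2 `^ (2 - alpha) < 4 :> R.
  have q1 : 1 < 2 `^ alpha :> R.
    have e1 : (1 : R) `^ alpha = 1 by rewrite powR1.
    by rewrite -[ltLHS]e1; apply: gt0_ltr_powR; rewrite ?nnegrE ?ltr1n.
  have q4 : 2 `^ (2 - alpha) * 2 `^ alpha = 4 :> R.
    by rewrite -powRD ?subrK ?powR_mulrn//; [ring|rewrite pnatr_eq0 implybT].
  have := powR_ge0 2 (2 - alpha); nra.
move: g0 p0 p4; move: (Gamma _) (d `^ _) (2 `^ _) (t `^ _) => G D P T G0 D0 P4.
rewrite (_ : _ + _ = G^-1 * ((4 - P) * D / 3 / ((1 - alpha) * (2 - alpha)))); last first.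
  by field; rewrite !gt_eqF//; lra.
rewrite gt_eqF// mulr_gt0 ?invr_gt0// divr_gt0//; last by rewrite mulr_gt0; lra.
by rewrite divr_gt0// mulr_gt0// subr_gt0.
Qed.

(** No knot lies before z, so the three cut-offs have the same pairing, and the weights of the bump
    add up to 0. *)
Lemma rep_ip_bump_before (alpha t d z : R) : alpha <= 1 ->
  0 < d -> t <= 1 -> I01 z -> z <= t - 2 * d ->
  rep_ip (rep_bump t d) (rep_t0 z) = 0 /\
  rep_ip (rep_bump t d) (rep_caputo alpha z) = 0.
Proof.
move=> a1 d0 t1 zI zt; have [z0 z1] : 0 <= z /\ z <= 1 by move: zI; rewrite I01E => /andP[].
have I s : 0 <= s -> s <= 1 -> I01 s by move=> s0 s1; rewrite I01E s0.
have tI : I01 t by apply: I; lra.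
have I1 : I01 (t - d) by apply: I; lra.
have I2 : I01 (t - 2 * d) by apply: I; lra.
rewrite !rep_ip_bump; [|exact: rep_caputo_ok|exact: rep_t0_ok].
rewrite !rep_ip_cut_t0// !min_r; try lra.
split; first by field.
rewrite /rep_caputo; have [_|an] := eqVneq alpha 1.
  by rewrite !rep_ip_cut_t1// !min_r; [field|lra..].
have lt1 : alpha < 1 by rewrite lt_neqAle an.
rewrite !(rep_ipC _ (_ *: _)).
rewrite !rep_ipZl; [|exact: rep_frac_ok|exact: rep_cut_ok|exact: rep_frac_ok
  |exact: rep_cut_ok|exact: rep_frac_ok|exact: rep_cut_ok].
rewrite !(rep_ipC (rep_frac _ _)) !rep_ip_cut_frac// !min_r; lra.
Qed.

End Test_functions.

(** * Independence of the representers *)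

Section Independence.
Context {R : realType}.

Lemma finite_lower_bound (n : nat) (f : 'I_n -> R) : (forall i, 0 < f i) ->
  exists2 d : R, 0 < d & forall i, d <= f i.
Proof.
move=> f0; exists (\big[Num.min/1]_(i < n) f i).
  by elim/big_ind : _ => // a b a0 b0; rewrite lt_min a0.
by move=> i; rewrite (bigD1 i)//= ge_min lexx.
Qed.

(* Indices with equal times are grouped; [i] is the latest time at which the
   group has a nonzero total weight. *)
Lemma latest_group (n : nat) (e t : 'I_n -> R) (i0 : 'I_n) :
  \sum_(k | t k == t i0) e k != 0 ->
  exists2 i, t i0 <= t i & forall phi : R -> R, phi (t i) != 0 ->
    (forall k, t k < t i -> phi (t k) = 0) -> \sum_k e k * phi (t k) != 0.
Proof.
pose W i := \sum_(k | t k == t i) e k; move=> W0.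
case: (@arg_maxP _ _ _ i0 (fun i => W i != 0) t W0) => i Wi imax.
exists i; first exact: imax.
(* [N k] is the size of the group of k. A sum of group totals over all indices counts each group
   that many times; dividing by [N] avoids the choice of a representative. *)
move=> phi phi_i phi0; pose N k : R := (\sum_(l | t l == t k) 1).
have N0 k : N k != 0.
  rewrite /N (bigD1 k)//= gt_eqF// ltr_wpDr//; exact: sumr_ge0.
have NW k l : t l = t k -> N l = N k /\ W l = W k.
  by move=> lk; split; rewrite /N /W lk.
have -> : \sum_k e k * phi (t k) = \sum_l phi (t l) / N l * W l.
  under [RHS]eq_bigr do rewrite mulr_sumr.
  rewrite [RHS](exchange_big_dep predT)//=; apply: eq_bigr => k _.
  transitivity (\sum_(l | t l == t k) phi (t k) / N k * e k).
    rewrite sumr_const -[X in X *+ _]mul1r -mulrnAl.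
    have -> : (1 : R) *+ #|[pred l | t l == t k]| = N k by rewrite /N sumr_const.
    by rewrite mulrA mulrCA mulfV// mulr1 mulrC.
  by apply: eq_big => [l|l /eqP lk]; rewrite 1?eq_sym// (NW _ _ lk).1 lk.
have -> : \sum_l phi (t l) / N l * W l = \sum_(l | t l == t i) phi (t i) / N i * W i.
  rewrite (bigID (fun l => t l == t i))/= [X in _ + X]big1 ?addr0.
    by apply: eq_bigr => l /eqP li; rewrite (NW _ _ li).1 (NW _ _ li).2 li.
  move=> l li; have [lt|] := ltP (t l) (t i); first by rewrite phi0// mul0r mul0r.
  rewrite le_eqVlt eq_sym (negbTE li) orFb => il.
  have [->|Wl] := eqVneq (W l) 0; first by rewrite mulr0.
  by have := imax l Wl; rewrite /= leNgt il.
rewrite sumr_const -[X in X *+ _]mul1r -mulrnAl.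
have -> : (1 : R) *+ #|[pred l | t l == t i]| = N i by rewrite /N sumr_const.
by rewrite !mulf_neq0// invr_neq0.
Qed.

Variables (alpha : R) (k1 k2 k3 : R -> R -> R).
Hypotheses (alpha0 : 0 < alpha) (alpha1 : alpha <= 1).
Variable p : nat -> R * R.
Hypothesis pD : forall i, sqD (p i).
Local Notation D i := (psi_data alpha k1 k2 k3 (p i).1 (p i).2).

Lemma psi_data_independent (j : nat) (c : nat -> R) :
  0 < (p j).1 -> (p j).1 < 1 -> 0 < (p j).2 ->
  (forall i, (i < j)%N -> p i != p j) ->
  ~ (forall v, data_L2 v -> data_ip v (D j) = \sum_(i < j) c i * data_ip v (D i)).
Proof.
set x := (p j).1; move=> x0 x1 tj0 first_j dep.
(* The coefficients of the relation, restricted to the points on the line xi = x; the spline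
   annihilates the other points. In the group of j only j itself has a nonzero weight, as no
   predecessor is the same point. *)
pose w (i : nat) : R := if (p i).1 == x then if (i < j)%N then - c i else 1 else 0.
pose t (i : 'I_j.+1) := (p i).2.
have wj : w j = 1 by rewrite /w eqxx ltnn.
have W : \sum_(k | t k == t ord_max) w k != 0.
  rewrite (bigD1 ord_max)//= big1 ?addr0; first by rewrite wj oner_eq0.
  move=> k /andP[/eqP tk kj]; rewrite /w; case: eqP => // xk.
  have kj' : (k < j)%N by rewrite ltn_neqAle -ltnS ltn_ord andbT; exact: kj.
  by have := first_j _ kj'; rewrite (surjective_pairing (p k)) xk -/(t k) tk -surjective_pairing eqxx.
have [i ti tmax] := latest_group W.
have tI (k : 'I_j.+1) : I01 (t k) by have [] := pD k.
have [ti0 ti1] : 0 < t i /\ t i <= 1.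
  split; first exact: lt_le_trans tj0 ti.
  by have := tI i; rewrite I01E => /andP[].
(* [h1] bounds from below the distances from x to the other abscissas, and [d1] the gaps between the
   chosen time and earlier ones; indices without a condition get the value 1. *)
have [h1 h10 h1P] : exists2 d : R, 0 < d & forall k : 'I_j.+1,
    d <= if (p k).1 == x then 1 else `|(p k).1 - x|.
  by apply: finite_lower_bound => k; case: eqVneq => // ?; rewrite normr_gt0 subr_eq0.
have [d1 d10 d1P] : exists2 d : R, 0 < d & forall k : 'I_j.+1,
    d <= if t k < t i then t i - t k else 1.
  by apply: finite_lower_bound => k; case: ifPn; rewrite ?subr_gt0.
pose h := Num.min h1 (Num.min x (1 - x)) / 2.
have m0 : 0 < Num.min h1 (Num.min x (1 - x)) by rewrite !lt_min h10 x0 subr_gt0.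
have h0 : 0 < h by rewrite divr_gt0.
have h2 : 2 * h = Num.min h1 (Num.min x (1 - x)) by rewrite /h; field.
have hx : 2 * h <= x by rewrite h2 !ge_min lexx !orbT.
have hx1 : 2 * h <= 1 - x by rewrite h2 !ge_min lexx !orbT.
have hh1 : 2 * h <= h1 by rewrite h2 ge_min lexx.
pose d := Num.min d1 (t i) / 2.
have n0 : 0 < Num.min d1 (t i) by rewrite lt_min d10.
have d0 : 0 < d by rewrite divr_gt0.
have d2 : 2 * d = Num.min d1 (t i) by rewrite /d; field.
have dt : 2 * d <= t i by rewrite d2 ge_min lexx orbT.
have dd1 : 2 * d <= d1 by rewrite d2 ge_min lexx.
pose a := rep_spline x h; pose b := rep_bump (t i) d.
have ao : rep_ok a by exact: rep_spline_ok.
have bo : rep_ok b by exact: rep_bump_ok.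
(* On the line xi = x the pairing with the test tensor depends on the time only, as [latest_group]
   requires. *)
pose phi (s : R) := rep_ip a (rep_x0 x) * rep_ip b (rep_caputo alpha s) +
  (k1 x s * rep_ip a (rep_x2 x) + k2 x s * rep_ip a (rep_x0 x) +
   k3 x s * rep_ip a (rep_x1 x)) * rep_ip b (rep_t0 s).
have E z s : I01 z -> I01 s -> data_ip (tens a b) (psi_data alpha k1 k2 k3 z s) =
    rep_ip a (rep_x0 z) * rep_ip b (rep_caputo alpha s) +
    (k1 z s * rep_ip a (rep_x2 z) + k2 z s * rep_ip a (rep_x0 z) +
     k3 z s * rep_ip a (rep_x1 z)) * rep_ip b (rep_t0 s).
  move=> zI sI; have co := rep_caputo_ok alpha1 sI; have so := rep_t0_ok sI.
  have ? := rep_x0_ok zI; have ? := rep_x1_ok zI; have ? := rep_x2_ok zI.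
  rewrite data_ip_psi//; last exact: tens_L2.
  by rewrite /of_data /of_data_x /of_data_xx !tens_ip//; ring.
have phiE (k : 'I_j.+1) : w k * phi (t k) = w k * data_ip (tens a b) (D k).
  have [xI sI] := pD k; rewrite E// /w; case: eqVneq => [xk|_]; last by rewrite !mul0r.
  by rewrite xk.
have away (k : nat) : (k < j)%N -> (p k).1 != x -> data_ip (tens a b) (D k) = 0.
  move=> kj kx; have [xI sI] := pD k; rewrite E//.
  have := h1P (Ordinal (leqW kj)); rewrite /= (negbTE kx) => h1k.
  have [-> -> ->] := rep_ip_spline_away h0 hx hx1 xI (le_trans hh1 h1k).
  by rewrite !mulr0 !addr0 !mul0r addr0.
have : \sum_(k < j.+1) w k * phi (t k) != 0.
  apply: tmax.
    rewrite /phi (rep_ip_bump_t0 d0 dt ti1) mulr0 addr0 mulf_neq0//.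
      exact: rep_ip_spline_at.
    exact: rep_ip_bump_caputo.
  move=> k ki; have := d1P k; rewrite ki => dk.
  have kt : t k <= t i - 2 * d by lra.
  have [b0 b1] := rep_ip_bump_before alpha1 d0 ti1 (tI k) kt.
  by rewrite /phi b0 b1 !mulr0 addr0.
rewrite (eq_bigr _ (fun k _ => phiE k)) big_ord_recr/= wj mul1r dep; last exact: tens_L2.
rewrite -big_split/= big1 ?eqxx// => k _; rewrite /w ltn_ord.
case: eqVneq => [_|kx]; first by rewrite mulNr addNr.
by rewrite away// mul0r mulr0 addr0.
Qed.

End Independence.

(** * Convergence to the solution *)

Lemma add4_eq (V : nmodType) (a b c d a' b' c' d' : V) :
  a = a' -> b = b' -> c = c' -> d = d' -> a + b + c + d = a' + b' + c' + d'.
Proof. by move=> -> -> -> ->. Qed.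

(** * Dependence on the values in the square only *)

Section Extensionality.
Context {R : realType}.
Implicit Types (y z v w : R -> R -> R) (g h : R -> R).

Definition eq_sqD y z := forall x t, I01 x -> I01 t -> y x t = z x t.

Lemma iter_dxi_ext n y z : eq_sqD y z -> eq_sqD (iter n dxi y) (iter n dxi z).
Proof. by move=> yz; elim: n => //= n IH; exact: dxi_ext. Qed.

Lemma iter_deta_ext n y z : eq_sqD y z -> eq_sqD (iter n deta y) (iter n deta z).
Proof. by move=> yz; elim: n => //= n IH; exact: deta_ext. Qed.

Lemma iter_deriv01_ext n g h : (forall x, I01 x -> g x = h x) ->
  forall x, I01 x -> iter n deriv01 g x = iter n deriv01 h x.
Proof. by move=> gh; elim: n => //= n IH x xI; exact: deriv01_ext. Qed.

Lemma W3_inner_ext (g g' h h' : R -> R) : (forall x, I01 x -> g x = g' x) ->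
  (forall x, I01 x -> h x = h' x) -> W3_inner g h = W3_inner g' h'.
Proof.
move=> gE hE; have I0 := @I01_0 R; have I1 := @I01_1 R; apply: add4_eq.
- by apply: mul_eq; [exact: gE|exact: hE].
- by apply: mul_eq; [exact: deriv01_ext gE I0|exact: deriv01_ext hE I0].
- by apply: mul_eq; [exact: gE|exact: hE].
- apply: eq_Rintegral => x; rewrite inE => xI.
  by apply: mul_eq; [exact: (iter_deriv01_ext 3 gE)|exact: (iter_deriv01_ext 3 hE)].
Qed.

Lemma W32_inner_ext y y' v v' : eq_sqD y y' -> eq_sqD v v' ->
  W32_inner y v = W32_inner y' v'.
Proof.
move=> yE vE; have I0 := @I01_0 R; have I1 := @I01_1 R.
have T := iter_deta_ext; have X := iter_dxi_ext.
apply: add4_eq.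
- apply: eq_bigr => i _; apply: eq_Rintegral => t; rewrite inE => tI.
  apply: mul_eq; first exact: (T 2%N _ _ (X i _ _ yE)).
  exact: (T 2%N _ _ (X i _ _ vE)).
- apply: eq_Rintegral => t; rewrite inE => tI.
  by apply: mul_eq; [exact: (T 2%N _ _ yE)|exact: (T 2%N _ _ vE)].
- apply: eq_bigr => j _; apply: W3_inner_ext => x xI; first exact: (T j _ _ yE).
  exact: (T j _ _ vE).
- apply: eq_Rintegral => z; rewrite inE => -[xI tI].
  apply: mul_eq; first exact: (X 3%N _ _ (T 2%N _ _ yE)).
  exact: (X 3%N _ _ (T 2%N _ _ vE)).
Qed.

Lemma W32_inner_data y v (d e : data) : data_L2 d -> data_L2 e ->
  eq_sqD y (of_data d) -> eq_sqD v (of_data e) -> W32_inner y v = data_ip d e.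
Proof. by move=> Ld Le yd ve; rewrite (W32_inner_ext yd ve) W32_inner_of_data. Qed.

Lemma W32_norm_data y (d : data) : data_L2 d -> eq_sqD y (of_data d) ->
  W32_norm y = Num.sqrt (data_ip d d).
Proof. by move=> Ld yd; rewrite /W32_norm (W32_inner_data Ld Ld yd yd). Qed.

Lemma of_data_sum (n : nat) (c : 'I_n -> R) (d : 'I_n -> data) (x t : R) :
  I01 x -> I01 t -> (forall i, data_L2 (d i)) ->
  of_data (\sum_(i < n) c i *: d i) x t = \sum_(i < n) c i * of_data (d i) x t.
Proof.
move=> xI tI Ld; apply: (ip_suml (@data_preHilbert R)) => //.
exact: tens_L2 (rep_x0_ok xI) (rep_t0_ok tI).
Qed.

Lemma of_dataB (d e : data) (x t : R) : I01 x -> I01 t -> data_L2 d -> data_L2 e ->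
  of_data (d - e) x t = of_data d x t - of_data e x t.
Proof.
move=> xI tI Ld Le; apply: (ipBl (@data_preHilbert R)) => //.
exact: tens_L2 (rep_x0_ok xI) (rep_t0_ok tI).
Qed.

End Extensionality.

(** * Passage to the limit at moving points *)

Section Convergence.
Context {R : realType}.
Notation mu := (@lebesgue_measure R).

Lemma rep_ip_bound (e : @rep R) (K : R) : rep_ok e -> (forall o, `|e o : R| <= K) ->
  0 <= rep_ip e e <= K ^+ 2 + K ^+ 2.
Proof.
move=> eo eK; have K0 : 0 <= K by apply: le_trans (eK None).
have sq o : 0 <= (e o : R) * e o <= K ^+ 2.
  have := eK o; rewrite -expr2 sqr_ge0 ler_norml => /andP[? ?]; nra.
have [a0 aK] : 0 <= (e None : R) * e None /\ (e None : R) * e None <= K ^+ 2.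
  by have /andP[] := sq None.
have Iint := itg_indic (@measurable_I01 R) (@I01_lty R).
have [b0 bK] : 0 <= \int[mu]_s ((e (Some s) : R) * e (Some s)) /\
    \int[mu]_s ((e (Some s) : R) * e (Some s)) <= K ^+ 2.
  split; first by apply: Rintegral_ge0 => s _; have /andP[] := sq (Some s).
  have -> : K ^+ 2 = \int[mu]_s (K ^+ 2 * \1_I01 s).
    rewrite RintZ// /Rintegral integral_indic//; last exact: measurable_I01.
    rewrite -[LHS]mulr1; congr (_ * _); transitivity (fine (mu (@I01 R))).
      by rewrite /I01 lebesgue_measure_itv/= lte01 sube0.
    by congr (fine (_ _)); apply/seteqP; split => [x|x []].
  apply: Rint_le; [exact: rep_ip_itg|exact: itgZ|move=> s].
  have [_ eI _] := eo; have [sI|sI] := asboolP (I01 s).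
    by rewrite indicE mem_set// mulr1; have /andP[] := sq (Some s).
  by rewrite eI// mulr0 mulr_ge0// ?sqr_ge0.
rewrite /rep_ip addr_ge0//=; exact: lerD.
Qed.

(** The tensors have bounded norms, so by Cauchy-Schwarz the part [v_ n - v] tends to 0; the fixed
    [v] is covered by [data_ip_tens_cvg]. This evaluates converging approximations at moving
    points. *)
Lemma data_ip_cvg_tens_cvg (v_ : nat -> data) (v : data) e_ f_ (e f : @rep R) :
  (forall n, data_L2 (v_ n)) -> data_L2 v ->
  data_ip (v_ n - v) (v_ n - v) @[n --> \oo] --> 0 ->
  rep_cvg e_ e -> rep_cvg f_ f ->
  data_ip (v_ n) (tens (e_ n) (f_ n)) @[n --> \oo] --> data_ip v (tens e f).
Proof.
move=> Lv_ Lv cv ee ff; have H := @data_preHilbert R.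
have weak := data_ip_tens_cvg Lv ee ff.
have [eo_ eo _ _ [K eK]] := ee; have [fo_ fo _ _ [M fM]] := ff.
have LT n : data_L2 (tens (e_ n) (f_ n)) by exact: tens_L2.
have LB n : data_L2 (v_ n - v) by exact: (domB H).
suff small : data_ip (v_ n - v) (tens (e_ n) (f_ n)) @[n --> \oo] --> 0.
  have E n : data_ip (v_ n) (tens (e_ n) (f_ n)) =
      data_ip (v_ n - v) (tens (e_ n) (f_ n)) + data_ip v (tens (e_ n) (f_ n)).
    by rewrite (ipBl H)// subrK.
  by rewrite (funext E) -[X in _ --> X]add0r; exact: cvgD.
pose C := (K ^+ 2 + K ^+ 2) * (M ^+ 2 + M ^+ 2).
have TC n : data_ip (tens (e_ n) (f_ n)) (tens (e_ n) (f_ n)) <= C.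
  have /andP[a0 aK] := rep_ip_bound (eo_ n) (eK n).
  have /andP[b0 bM] := rep_ip_bound (fo_ n) (fM n).
  by rewrite tens_ip//; apply: ler_pM.
have C0 : 0 <= C by apply: le_trans (TC 0%N); exact: (ip_ge0 H).
apply/norm_cvg0P.
have sC : Num.sqrt (data_ip (v_ n - v) (v_ n - v) * C) @[n --> \oo] --> (0 : R).
  rewrite -[X in _ --> X]sqrtr0 -(mul0r C).
  apply: (continuous_cvg _ (@sqrt_continuous R _)).
  by apply: cvgM => //; exact: cvg_cst.
apply: (@squeeze_cvgr _ _ _ _ (cst 0) (fun n => Num.sqrt (data_ip (v_ n - v) (v_ n - v) * C))) => //.
  apply: nearW => n /=; rewrite normr_ge0 /= -sqrtr_sqr ler_sqrt.
    apply: le_trans (cauchy_schwarz H (LB n) (LT n)) _.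
    by apply: ler_wpM2l => //; exact: (ip_ge0 H).
  by rewrite mulr_ge0//; exact: (ip_ge0 H).
exact: cvg_cst.
Qed.

Lemma cvg_subseq (u : nat -> R) (l : R) (j : nat -> nat) : u @ \oo --> l ->
  (forall n, (n <= j n)%N) -> u (j n) @[n --> \oo] --> l.
Proof.
move=> ul nj A /ul[N _ NA]; exists N => // n /= Nn; apply: NA => /=.
exact: leq_trans Nn (nj n).
Qed.

Lemma cvg_sqD_continuous (k : R -> R -> R) (x t : R) (u v : nat -> R) :
  {within sqD, continuous (fun z : R * R => k z.1 z.2)} -> I01 x -> I01 t ->
  (forall n, I01 (u n)) -> (forall n, I01 (v n)) ->
  u @ \oo --> x -> v @ \oo --> t -> k (u n) (v n) @[n --> \oo] --> k x t.
Proof.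
move=> /subspace_continuousP kc xI tI uI vI ux vt.
have kxt := kc (x, t) (conj xI tI).
have uv : (u n, v n) @[n --> \oo] --> (x, t) by exact: (cvg_pair ux vt).
move=> A /kxt kA; have [N _ NP] := uv _ kA; exists N => // n /NP; apply.
by split; [exact: uI|exact: vI].
Qed.

End Convergence.

(** * Accumulation of new interior points *)

Section Density.
Context {R : realType}.

(** Each step keeps an open half that misses the next value. The interval serves as a side of a box
    free of the first n points, so that density yields points of large index. *)
Lemma avoid_finite (n : nat) (s : nat -> R) (a b : R) : a < b ->
  exists a' b', [/\ a <= a', a' < b', b' <= b &
    forall i, (i < n)%N -> ~~ (a' < s i < b')].
Proof.
move=> ab; elim: n => [|n [a' [b' [aa ab' bb sP]]]]; first by exists a, b.
have [h|h] := leP (s n) ((a' + b') / 2).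
  exists ((a' + b') / 2), b'; split => //; [lra|lra|move=> i].
  rewrite ltnS leq_eqVlt => /predU1P[->|/sP]; first by rewrite ltNge h.
  by apply: contra => /andP[i1 ->]; rewrite andbT; lra.
exists a', ((a' + b') / 2); split => //; [lra|lra|move=> i].
rewrite ltnS leq_eqVlt => /predU1P[->|/sP]; first by rewrite negb_and -!leNgt (ltW h) orbT.
by apply: contra => /andP[-> i2]/=; lra.
Qed.

Variable p : nat -> R * R.
Hypothesis dense : sqD `<=` closure (range p).

Definition new_interior j := [/\ 0 < (p j).1, (p j).1 < 1, 0 < (p j).2 &
  forall i, (i < j)%N -> p i != p j].

(** Density gives a point of the sequence in an open box that lies in the interior, close to q, and
    whose abscissas avoid those of the first n points. The least index j of this point has no equal
    predecessor, and j >= n by the choice of the box. *)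
Lemma dense_new_interior (n : nat) (q : R * R) (eps : R) : sqD q -> 0 < eps ->
  exists j, [/\ (n <= j)%N, new_interior j,
    `|(p j).1 - q.1| < eps & `|(p j).2 - q.2| < eps].
Proof.
move=> [q1I q2I] e0.
have box (c : R) : I01 c -> Num.max 0 (c - eps) < Num.min 1 (c + eps).
  by rewrite I01E => /andP[c0 c1]; rewrite lt_min !gt_max; lra.
have [a [b [qa ab bq pP]]] := avoid_finite n (fun i => (p i).1) (box _ q1I).
have boxP (c s : R) : Num.max 0 (c - eps) < s -> s < Num.min 1 (c + eps) ->
    [/\ 0 < s, s < 1 & `|s - c| < eps].
  rewrite gt_max lt_min ltr_norml => /andP[s0 cs] /andP[s1 sc]; split => //; lra.
pose c2 := Num.max 0 (q.2 - eps); pose d2 := Num.min 1 (q.2 + eps).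
have cd : c2 < d2 by exact: box.
pose r : R * R := ((a + b) / 2, (c2 + d2) / 2).
have midP (c s s' : R) : Num.max 0 (c - eps) <= s -> s < s' -> s' <= Num.min 1 (c + eps) ->
    I01 ((s + s') / 2).
  rewrite ge_max le_min I01E => /andP[s0 _] ss /andP[s1 _]; lra.
have rD : sqD r by split; [exact: midP qa ab bq|exact: midP (lexx _) cd (lexx _)].
have N : nbhs r (`]a, b[%classic `*` `]c2, d2[%classic).
  exists (`]a, b[%classic, `]c2, d2[%classic) => //=.
  by split; apply: near_in_itvoo; rewrite in_itv/=; lra.
have [_ [[m _ <-]]] := dense rD N.
rewrite /= !in_itv/= => -[/andP[m1 m2] /andP[m3 m4]].
have ex : exists j, p j == p m by exists m.
case: (ex_minnP ex) => j /eqP jm jmin; exists j; rewrite jm.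
have [x0 x1 xq] := boxP q.1 _ (le_lt_trans qa m1) (lt_le_trans m2 bq).
have [t0 _ tq] := boxP q.2 _ m3 m4.
split => //; last first.
  split; rewrite ?jm// => i ij; apply/negP => /jmin; by rewrite leqNgt ij.
rewrite leqNgt; apply/negP => /pP; by rewrite jm m1 m2.
Qed.

Lemma new_interior_sequence (q : R * R) : sqD q -> exists j : nat -> nat,
  [/\ forall n, (n <= j n)%N, forall n, new_interior (j n),
    (p (j n)).1 @[n --> \oo] --> q.1 & (p (j n)).2 @[n --> \oo] --> q.2].
Proof.
move=> qD.
have ex (n : nat) : exists j, [/\ (n <= j)%N, new_interior j,
    `|(p j).1 - q.1| < n.+1%:R^-1 & `|(p j).2 - q.2| < n.+1%:R^-1].
  by apply: dense_new_interior => //; rewrite invr_gt0.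
have [j jP] := choice ex.
have cvg_close (u : nat -> R) (l : R) :
    (forall n, `|u n - l| < n.+1%:R^-1) -> u @ \oo --> l.
  move=> ul; apply/subr_cvg0/norm_cvg0P.
  apply: (@squeeze_cvgr _ _ _ _ (cst 0) (fun n : nat => n.+1%:R^-1)).
  - by apply: nearW => n /=; rewrite normr_ge0 ltW.
  - exact: cvg_cst.
  - exact: cvg_harmonic.
by exists j; split; [| |apply: cvg_close..] => n; have [] := jP n.
Qed.

End Density.

(** * From the Gram-Schmidt limit to the exact solution *)

Section Main.
Context {R : realType}.
Variables (alpha : R) (k1 k2 k3 k4 f : R -> R -> R).
Hypothesis alpha1 : alpha <= 1.
Variable p : nat -> R * R.
Hypothesis pD : forall i, sqD (p i).
Local Notation D := (fun i => psi_data alpha k1 k2 k3 (p i).1 (p i).2).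
Local Notation ps := (psi alpha k1 k2 k3 p).
Variable beta : nat -> nat -> R.

Let H := @data_preHilbert R.

Lemma psi_data_dom i : data_L2 (D i).
Proof. by have [xI tI] := pD i; exact: psi_data_L2. Qed.

Lemma psibar_of_data i : eq_sqD (psibar ps beta i) (of_data (gs_basis D beta i)).
Proof.
move=> x t xI tI; rewrite /psibar /gs_basis of_data_sum//; last first.
  by move=> k; exact: psi_data_dom.
by apply: eq_bigr => k _; rewrite psi_of_data.
Qed.

Lemma gs_residual_of_data i :
  eq_sqD (gs_residual ps beta i) (of_data (gs_rest (@data_ip R) D beta i)).
Proof.
have dB := dom_gs_basis H beta psi_data_dom.
have dP := psi_data_dom.
move=> x t xI tI; rewrite /gs_residual /gs_rest of_dataB//; last first.
  by apply: (dom_sum H) => k; exact: dB.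
rewrite of_data_sum// psi_of_data//; congr (_ - _); apply: eq_bigr => k _.
rewrite (psibar_of_data k)//; congr (_ * _).
apply: W32_inner_data; [exact: dP|exact: dB| |exact: psibar_of_data].
by move=> x' t' xI' tI'; exact: psi_of_data.
Qed.

Lemma gs_norm_of_data i : W32_norm (gs_residual ps beta i) = gs_norm (@data_ip R) D beta i.
Proof.
apply: W32_norm_data; last exact: gs_residual_of_data.
exact: (dom_gs_rest H (D := D) beta psi_data_dom i).
Qed.

Lemma nterm_approx_of_data (B : nat -> R) n :
  eq_sqD (nterm_approx B (psibar ps beta) n) (of_data (gs_partial D beta B n)).
Proof.
move=> x t xI tI; rewrite /nterm_approx /gs_partial of_data_sum//; last first.
  by move=> k; exact: (dom_gs_basis H (D := D) beta psi_data_dom k).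
by apply: eq_bigr => k _; rewrite psibar_of_data.
Qed.

Hypotheses
  (k1c : {within sqD, continuous (fun z : R * R => k1 z.1 z.2)})
  (k2c : {within sqD, continuous (fun z : R * R => k2 z.1 z.2)})
  (k3c : {within sqD, continuous (fun z : R * R => k3 z.1 z.2)})
  (k4c : {within sqD, continuous (fun z : R * R => k4 z.1 z.2)})
  (fc : {within sqD, continuous (fun z : R * R => f z.1 z.2)}).
Hypothesis dense : sqD `<=` closure (range p).

(** The prescribed values are passed to the limit along new interior points tending to (x, t). On
    the left the data [s] are fixed; on the right [S (j n)] tends to [s] because n <= j n. *)
Lemma limit_is_solution (S : nat -> data) (s : data) :
  (forall n, data_L2 (S n)) -> data_L2 s ->
  data_ip (S n - s) (S n - s) @[n --> \oo] --> 0 ->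
  (forall j, new_interior p j -> data_ip s (D j) =
     burgersF f k4 (p j).1 (p j).2 (of_data (S j) (p j).1 (p j).2)
       (of_data_x (S j) (p j).1 (p j).2)) ->
  burgers_solution alpha k1 k2 k3 k4 f (of_data s).
Proof.
move=> LS Ls Ss sD; split; first exact: W32_of_data.
move=> x t xI tI; rewrite burgersL_of_data// dxi_of_data// data_ip_psi//.
have [j [nj jgood jx jt]] := new_interior_sequence dense (conj xI tI : sqD (x, t)).
pose u n := (p (j n)).1; pose v n := (p (j n)).2.
have uI n : I01 (u n) by have [] := pD (j n).
have vI n : I01 (v n) by have [] := pD (j n).
have kc (k : R -> R -> R) : {within sqD, continuous (fun z : R * R => k z.1 z.2)} ->
    k (u n) (v n) @[n --> \oo] --> k x t.
  by move=> kc; exact: (cvg_sqD_continuous (u := u) (v := v) kc xI tI uI vI jx jt).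
have x0c := rep_deriv_continuous xI (rep_x0_deriv xI) uI jx.
have x1c := rep_deriv_continuous xI (rep_x1_deriv xI) uI jx.
have x2c := rep_x2_continuous xI uI jx.
have t0c := rep_deriv_continuous tI (rep_t0_deriv tI) vI jt.
have cc := rep_caputo_continuous alpha1 tI vI jt.
have Ssj := cvg_subseq Ss nj.
have lhs : data_ip s (D (j n)) @[n --> \oo] -->
    data_ip s (tens (rep_x0 x) (rep_caputo alpha t)) +
    k1 x t * of_data_xx s x t + k2 x t * of_data s x t + k3 x t * of_data_x s x t.
  under eq_fun => n do rewrite (data_ip_psi _ _ _ alpha1 Ls (uI n) (vI n)).
  apply: cvgD; [apply: cvgD; [apply: cvgD|]|]; [|apply: cvgM; [exact: kc|]..];
    exact: data_ip_tens_cvg.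
have rhs : data_ip s (D (j n)) @[n --> \oo] -->
    burgersF f k4 x t (of_data s x t) (of_data_x s x t).
  under eq_fun => n do rewrite sD//.
  apply: cvgB; first exact: kc.
  apply: cvgM; [apply: cvgM; [exact: kc|]|].
    exact: (data_ip_cvg_tens_cvg (fun n => LS (j n)) Ls Ssj x0c t0c).
  exact: (data_ip_cvg_tens_cvg (fun n => LS (j n)) Ls Ssj x1c t0c).
exact: (cvg_unique _ lhs rhs).
Qed.

End Main.

Theorem theorem4p1 (R : realType) (alpha : R)
    (halpha0 : 0 < alpha) (halpha1 : alpha <= 1)
    (k1 k2 k3 k4 f : R -> R -> R)
    (hk1 : {within sqD, continuous (fun z : R * R => k1 z.1 z.2)})
    (hk2 : {within sqD, continuous (fun z : R * R => k2 z.1 z.2)})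
    (hk3 : {within sqD, continuous (fun z : R * R => k3 z.1 z.2)})
    (hk4 : {within sqD, continuous (fun z : R * R => k4 z.1 z.2)})
    (hf : {within sqD, continuous (fun z : R * R => f z.1 z.2)})
    (p : nat -> R * R) (hpD : forall i, sqD (p i)) (hp0 : p 0%N = (0, 0))
    (beta : nat -> nat -> R)
    (hbeta : gram_schmidt (psi alpha k1 k2 k3 p) beta)
    (y : R -> R -> R)
    (hy : burgers_solution alpha k1 k2 k3 k4 f y)
    (hy_unique : forall z : R -> R -> R,
        burgers_solution alpha k1 k2 k3 k4 f z ->
        forall xi eta, I01 xi -> I01 eta -> z xi eta = y xi eta)
    (B : nat -> R)
    (hB : forall i,
        B i = \sum_(k < i.+1) beta i k *
          burgersF f k4 (p k).1 (p k).2
            (prev_approx y B (psibar (psi alpha k1 k2 k3 p) beta) k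
               (p k).1 (p k).2)
            (dxi (prev_approx y B (psibar (psi alpha k1 k2 k3 p) beta) k)
               (p k).1 (p k).2))
    (hbounded : exists M : R, forall n,
        W32_norm (nterm_approx B (psibar (psi alpha k1 k2 k3 p) beta) n) <= M)
    (hdense : sqD `<=` closure (range p)) :
  ((fun n => W32_norm (fun xi eta =>
       nterm_approx B (psibar (psi alpha k1 k2 k3 p) beta) n xi eta - y xi eta))
     @ \oo --> (0 : R)) /\
  (forall xi eta, I01 xi -> I01 eta ->
     series (fun i => B i * psibar (psi alpha k1 k2 k3 p) beta i xi eta)
       @ \oo --> y xi eta).

Proof.
have H := @data_preHilbert R.
set ps := psi alpha k1 k2 k3 p in hbeta hB hbounded *.
pose D i := psi_data alpha k1 k2 k3 (p i).1 (p i).2.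
have dD i : data_L2 (D i) := psi_data_dom k1 k2 k3 halpha1 hpD i.
have normE := gs_norm_of_data k1 k2 k3 halpha1 hpD beta.
have barE := psibar_of_data k1 k2 k3 halpha1 hpD beta.
have appE := nterm_approx_of_data k1 k2 k3 halpha1 hpD beta B.
have dE := dom_gs_basis H beta dD; have dS := dom_gs_partial H beta dD B.
have diag i : beta i i = (gs_norm (@data_ip R) D beta i)^-1.
  by rewrite -normE; exact: hbeta.1.
have off i j : (j < i)%N -> beta i j =
    - (\sum_(j <= k < i) data_ip (D i) (gs_basis D beta k) * beta k j) /
      gs_norm (@data_ip R) D beta i.
  move=> ji; rewrite hbeta.2// normE; congr (- _ / _); apply: eq_bigr => k _.
  congr (_ * _); apply: W32_inner_data; [exact: dD|exact: dE| |exact: barE].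
  by move=> x t xI tI; exact: psi_of_data.
have bounded : exists M, forall n,
    Num.sqrt (data_ip (gs_partial D beta B n) (gs_partial D beta B n)) <= M.
  have [M MP] := hbounded; exists M => n.
  by rewrite -(W32_norm_data (dS n) (appE n)).
(* [F k] depends on earlier coefficients through the approximation, but the Gram-Schmidt argument
   only needs it as a given sequence of numbers. *)
pose F k := burgersF f k4 (p k).1 (p k).2
  (prev_approx y B (psibar ps beta) k (p k).1 (p k).2)
  (dxi (prev_approx y B (psibar ps beta) k) (p k).1 (p k).2).
have [s [Ls cvS sD]] :=
  gs_partial_cvg H dD diag off (F := F) hB (@data_complete R) bounded.
have good j : new_interior p j -> data_ip s (D j) =
    burgersF f k4 (p j).1 (p j).2 (of_data (gs_partial D beta B j) (p j).1 (p j).2)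
      (of_data_x (gs_partial D beta B j) (p j).1 (p j).2).
  move=> [x0 x1 t0 first_j]; have [xI tI] := hpD j.
  rewrite sD; last first.
    apply/eqP => /(gs_skipped_dependent H dD)[c cP].
    exact: (psi_data_independent halpha0 halpha1 hpD x0 x1 t0 first_j cP).
  (* The index j is not 0, because p 0 = (0, 0) is not an interior point; so the convention for rank
     0 does not interfere. *)
  rewrite /F; have -> : prev_approx y B (psibar ps beta) j = nterm_approx B (psibar ps beta) j.
    by case: j x0 {x1 t0 first_j xI tI} => [|//]; rewrite hp0 ltxx.
  by rewrite (dxi_ext (appE j))// (appE j)// dxi_of_data.
have sol := limit_is_solution halpha1 hpD hk1 hk2 hk3 hk4 hf hdense dS Ls cvS good.
have sy : eq_sqD (of_data s) y by exact: hy_unique.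
split.
  have E n : W32_norm (fun xi eta => nterm_approx B (psibar ps beta) n xi eta - y xi eta) =
      Num.sqrt (data_ip (gs_partial D beta B n - s) (gs_partial D beta B n - s)).
    apply: W32_norm_data; first exact: (domB H).
    by move=> x t xI tI; rewrite of_dataB// -sy// (appE n).
  rewrite (funext E) -[X in _ --> X]sqrtr0.
  exact: (continuous_cvg _ (@sqrt_continuous R _) cvS).
move=> x t xI tI; rewrite -sy//.
have -> : series (fun i => B i * psibar ps beta i x t) =
    (fun n => of_data (gs_partial D beta B n) x t).
  by apply/funext => n; rewrite -(appE n)// /series/= big_mkord.
apply: (ip_cvg H dS Ls _ cvS).
exact: tens_L2 (rep_x0_ok xI) (rep_t0_ok tI).
Qed.
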